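(* Let $\sigma\in(\tfrac12,1)$. For every $k\in\mathbb{R}$ there exist $\omega>0$ and a nonzero function $Q_{\omega,k}\in H^1(\mathbb{R})$ solving $$\mathcal{P}_k Q_{\omega,k}+\omega^{2\sigma}Q_{\omega,k}-|Q_{\omega,k}|^{2}Q_{\omega,k}=0 \quad\text{on }\mathbb{R}.$$ Moreover $Q_{\omega,k}\in C^\infty(\mathbb{R})$. Consequently $u(t,x)=e^{-it(|k|^{2\sigma}-\omega^{2\sigma})}e^{ikx}Q_{\omega,k}(x-2t\sigma|k|^{2\sigma-2}k)$ is a traveling solution of $i\partial_tu-(-\Delta)^\sigma u+|u|^2u=0$.
   Context: For $k\in\mathbb{R}$, $\mathcal{P}_k$ is the Fourier multiplier operator $\widehat{\mathcal{P}_k f}(\xi)=p_k(\xi)\hat f(\xi)$ on functions on $\mathbb{R}$ with symbol $p_k(\xi)=|\xi+k|^{2\sigma}-|k|^{2\sigma}-2\sigma|k|^{2\sigma-2}k\xi$ (for $k=0$, $p_0(\xi)=|\xi|^{2\sigma}$, i.e. $\mathcal{P}_0=(-\Delta)^\sigma$). Equivalently $\mathcal{P}_k=e^{-ikx}(-\Delta)^\sigma e^{ikx}-|k|^{2\sigma}+2i\sigma|k|^{2\sigma-2}k\,\partial_x$. Here $(-\Delta)^\sigma$ is the fractional Laplacian with symbol $|\xi|^{2\sigma}$. *)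

(* Defs.v *)
From Stdlib Require Import Reals.
From Coquelicot Require Import Coquelicot.
Open Scope R_scope.

Definition minf := Rbar_locally m_infty.
Definition pinf := Rbar_locally p_infty.

(* a^s for a >= 0, with the convention 0^s = 0 (only used for a = |.|, and
   in |k|^(2s-2) k the value at k = 0 is irrelevant since it is multiplied by k). *)
Definition rpow (a s : R) : R := if Rle_dec a 0 then 0 else Rpower a s.

Definition cis (t : R) : C := (cos t, sin t).

Definition reF (f : R -> C) : R -> R := fun x => fst (f x).
Definition imF (f : R -> C) : R -> R := fun x => snd (f x).

Definition smooth (f : R -> C) : Prop :=
  forall (n : nat) (x : R), ex_derive_n (reF f) n x /\ ex_derive_n (imF f) n x.

Definition cderiv (f : R -> C) : R -> C :=
  fun x => (Derive (reF f) x, Derive (imF f) x).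

(* f in L^2(R) (for continuous f): int_R |f|^2 < oo *)
Definition L2 (f : R -> C) : Prop :=
  ex_RInt_gen (V := R_NormedModule) (fun x => (Cmod (f x))^2) minf pinf.

Definition H1_smooth (f : R -> C) : Prop := L2 f /\ L2 (cderiv f).

Definition test_fun (phi : R -> C) : Prop :=
  smooth phi /\ exists M : R, forall x, M < Rabs x -> phi x = 0%C.

Definition fourier (f : R -> C) (xi : R) : C :=
  RInt_gen (V := C_R_CompleteNormedModule) (fun x => (cis (- (x * xi)) * f x)%C) minf pinf.

Definition p_sym (sigma k xi : R) : R :=
  rpow (Rabs (xi + k)) (2 * sigma) - rpow (Rabs k) (2 * sigma)
  - 2 * sigma * rpow (Rabs k) (2 * sigma - 2) * k * xi.

(* Fourier multiplier P_k applied to a test function: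
   P_k phi (x) = (1/2pi) int e^{i x xi} p_k(xi) hat phi(xi) dxi.
   For k = 0 this is the fractional Laplacian (-Delta)^sigma. *)
Definition Pk (sigma k : R) (phi : R -> C) (x : R) : C :=
  (RtoC (/ (2 * PI)) *
   RInt_gen (V := C_R_CompleteNormedModule) (fun xi => (cis (x * xi) * RtoC (p_sym sigma k xi) * fourier phi xi)%C)
            minf pinf)%C.

(* Q solves  P_k Q + omega^{2 sigma} Q - |Q|^2 Q = 0  in the sense of
   distributions on R (P_k has real symbol, so <P_k Q, phi> = <Q, P_k phi>). *)
Definition standing_eq (sigma k omega : R) (Q : R -> C) : Prop :=
  forall phi, test_fun phi ->
    is_RInt_gen (V := C_R_NormedModule)
      (fun x => (Q x * Cconj (Pk sigma k phi x)
                 + RtoC (rpow omega (2 * sigma)) * Q x * Cconj (phi x)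
                 - RtoC ((Cmod (Q x))^2) * Q x * Cconj (phi x))%C)
      minf pinf (RtoC 0).

(* u solves  i d_t u - (-Delta)^sigma u + |u|^2 u = 0 : classically
   differentiable in t, and for every t the equation holds in the sense of
   distributions in x. *)
Definition NLS_solution (sigma : R) (u : R -> R -> C) : Prop :=
  exists ut : R -> R -> C,
    (forall t x, is_derive (K := R_AbsRing) (V := C_R_NormedModule) (fun s => u s x) t (ut t x)) /\
    (forall t phi, test_fun phi ->
      is_RInt_gen (V := C_R_NormedModule)
        (fun x => (Ci * ut t x * Cconj (phi x)
                   - u t x * Cconj (Pk sigma 0 phi x)
                   + RtoC ((Cmod (u t x))^2) * u t x * Cconj (phi x))%C)
        minf pinf (RtoC 0)).

Definition traveling (sigma k omega : R) (Q : R -> C) (t x : R) : C :=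
  (cis (- (t * (rpow (Rabs k) (2 * sigma) - rpow omega (2 * sigma))))
   * cis (k * x)
   * Q ((x - 2 * t * sigma * rpow (Rabs k) (2 * sigma - 2) * k)%R))%C.

(* Main.v *)
Require Import Defs.
From Stdlib Require Import Reals Lra Lia Psatz Classical ClassicalEpsilon.
From Coquelicot Require Import Coquelicot.
From mathcomp Require filter.
Open Scope R_scope.

(* The equation is solved on the Fourier side, where it reads [m g = g * g~ * g] with [m = p_k + omega^(2 sigma)]
   and [g] real. Discretise the frequencies with mesh [h = 1/n] and cut-off [3n]. Maximising the quartic form
   [sum g_a g_b g_c g_d] over [a - b + c = d] under [sum m g^2 = 1] gives, in finite dimension, a solution that may
   be taken nonnegative because passing to [|g|] increases the form. Since [1/m] is integrable ([2 sigma > 1]),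
   [h sum g] is bounded above, and the equation bootstraps this to bounds on all moments; it is bounded below because
   the quartic form is at most [(h sum g)^2 (h sum g^2)]. So the trigonometric polynomials [Q_n] with coefficients [h g]
   have all derivatives bounded, [Q_n(0) >= c > 0], and bounded [H^1] norm over a period. Positivity of [g] thus pins the
   profile at the origin and no concentration-compactness argument is needed: the limit [Q] along a free
   ultrafilter is smooth, nonzero and in [H^1]. The weak equation passes to the limit because [P_k phi] is
   [O(|x|^(-2 sigma))] for a test function [phi] (second differences of its Fourier transform), and Fourier inversion
   for [P_k phi] evaluates the pairing with each exponential. *)

(** * Limits along a free ultrafilter *)

(** A single ultrafilter supplies, without subsequences, the limits at every point, phase and
    derivative order at once, but it transmits only non-strict bounds that are uniform in [n]. Hence
    the form of the calculus: derivatives come from remainders at most [C t^2], continuity from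
    equicontinuity, improper integrals from truncation errors fixed by the majorant alone. The
    maximiser comes with a multiplier [V] depending on the mesh [h]; it has to be scaled away, and
    the scaling factor stays bounded because [h^3 V] is bounded below. The cube of a trigonometric
    polynomial leaves the frequency grid, so [Q_n] solves the equation only up to modes beyond the
    cut-off. Tested against [phi] they contribute [O(h)], by the decay of the Fourier transform of
    [phi]. The symbol has a kink at [xi = -k], so [P_k phi] is not a Schwartz function, while the
    exponentials it is paired with do not decay. The pairing is therefore computed by hand, with
    Abel summation. All this is done with real integrals of [cos (... + t)]: the phase [-PI/2]
    produces sines and [PI/2] a derivative. *)

Record free_ultra (U : (nat -> Prop) -> Prop) : Prop := {
  fu_and : forall P Q, U P -> U Q -> U (fun n => P n /\ Q n);
  fu_imp : forall P Q : nat -> Prop, (forall n, P n -> Q n) -> U P -> U Q;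
  fu_ev : forall N, U (fun n => (N <= n)%nat);
  fu_proper : ~ U (fun _ => False);
  fu_ultra : forall P, U P \/ U (fun n => ~ P n) }.

(** The filter of cofinite sets is extended to a maximal filter; containing the cofinite sets makes
    the result free. *)
Lemma free_ultra_exists : exists U, free_ultra U.
Proof.
pose (E := fun P : nat -> Prop => exists N, forall n, (N <= n)%nat -> P n).
assert (HE : @filter.ProperFilter nat E).
{ split.
  - intros [N HN]. exact (HN N (le_n N)).
  - split.
    + exists 0%nat. intros n _. exact I.
    + intros P Q [N HN] [N' HN']. exists (max N N'). intros n Hn.
      split; [apply HN | apply HN']; lia.
    + intros P Q HPQ [N HN]. exists N. intros n Hn. apply HPQ, HN, Hn. }
destruct (filter.ultraFilterLemma HE) as [U [HU HEU]].
pose proof (@filter.ultra_proper _ _ HU) as HP.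
pose proof (@filter.filter_filter _ _ HP) as HF.
assert (Himp : forall P Q : nat -> Prop, (forall n, P n -> Q n) -> U P -> U Q).
{ intros P Q H. exact (@filter.filterS _ _ HF P Q H). }
exists U. constructor.
- intros P Q H1 H2. exact (@filter.filterI _ _ HF P Q H1 H2).
- exact Himp.
- intros N. apply HEU. exists N. auto.
- exact (@filter.filter_not_empty _ _ HP).
- intros P. destruct (classic (U (fun n => ~ P n))) as [H | H]; [now right | left].
  (* [G] is the filter generated by [U] and [P]. It is proper because the complement of [P] is not
     in [U], so maximality gives [G = U], and [G] contains [P]. *)
  pose (G := fun A : nat -> Prop => U (fun n => P n -> A n)).
  assert (HG : @filter.ProperFilter nat G).
  { split.
    - intros H'. apply H. revert H'. apply Himp. intros n Hn Hp. exact (Hn Hp).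
    - split.
      + unfold G. apply (Himp (fun _ => True)); [now intros | exact (@filter.filterT _ _ HF)].
      + intros A B HA HB. unfold G in *.
        refine (Himp _ _ _ (@filter.filterI _ _ HF _ _ HA HB)).
        intros n [H1 H2] Hp. split; [exact (H1 Hp) | exact (H2 Hp)].
      + intros A B HAB. unfold G. apply Himp. intros n H1 Hp. exact (HAB n (H1 Hp)). }
  rewrite <- (@filter.max_filter _ _ HU G HG).
  + unfold G. apply (Himp (fun _ => True)); [now intros | exact (@filter.filterT _ _ HF)].
  + intros A HA. unfold G. revert HA. apply Himp. now intros.
Qed.

Definition ulim (U : (nat -> Prop) -> Prop) (u : nat -> R) (l : R) : Prop :=
  forall e, 0 < e -> U (fun n => Rabs (u n - l) < e).

Section Ulim.

Variables (U : (nat -> Prop) -> Prop) (HU : free_ultra U).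

Lemma fu_all (P : nat -> Prop) : (forall n, P n) -> U P.
Proof.
intros H. apply (fu_imp U HU (fun n => (0 <= n)%nat)); [auto | apply (fu_ev U HU)].
Qed.

Lemma fu_ex (P : nat -> Prop) : U P -> exists n, P n.
Proof.
intros H. apply NNPP. intros H'. apply (fu_proper U HU).
revert H. apply (fu_imp U HU). intros n Hn. apply H'. now exists n.
Qed.

(** Plays the role of Bolzano-Weierstrass: the limit is the supremum of the levels that [u] stays
    above on a set of [U]. By the ultrafilter dichotomy, a level beyond the supremum is missed on a
    set of [U]. *)
Lemma ulim_bounded_ex (u : nat -> R) (C : R) :
  (forall n, Rabs (u n) <= C) -> exists l, ulim U u l.
Proof.
intros HC.
pose (E := fun a => U (fun n => a <= u n)).
destruct (completeness E) as [l [Hl1 Hl2]].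
- exists C. intros a Ha. destruct (fu_ex _ Ha) as [n Hn].
  specialize (HC n). apply Rabs_le_between in HC. lra.
- exists (- C). apply fu_all. intros n. specialize (HC n).
  apply Rabs_le_between in HC. lra.
- exists l. intros e He.
  assert (H1 : U (fun n => l - e / 2 <= u n)).
  { destruct (fu_ultra U HU (fun n => l - e / 2 <= u n)) as [H | H]; [exact H |].
    exfalso. assert (Hub : is_upper_bound E (l - e / 2)).
    { intros a Ha. destruct (fu_ex _ (fu_and U HU _ _ Ha H)) as [n [Hn1 Hn2]]. lra. }
    specialize (Hl2 _ Hub). lra. }
  assert (H2 : U (fun n => ~ (l + e / 2 <= u n))).
  { destruct (fu_ultra U HU (fun n => l + e / 2 <= u n)) as [H | H]; [| exact H].
    exfalso. specialize (Hl1 _ H). lra. }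
  refine (fu_imp U HU _ _ _ (fu_and U HU _ _ H1 H2)).
  intros n [Hn1 Hn2]. apply Rabs_def1; lra.
Qed.

Lemma ulim_const (c : R) : ulim U (fun _ => c) c.
Proof. intros e He. apply fu_all. intros _. rewrite Rminus_diag, Rabs_R0. exact He. Qed.

Lemma ulim_ext (u v : nat -> R) (l : R) : (forall n, u n = v n) -> ulim U u l -> ulim U v l.
Proof.
intros H Hu e He. refine (fu_imp U HU _ _ _ (Hu e He)). intros n Hn. now rewrite <- H.
Qed.

Lemma ulim_plus (u v : nat -> R) (l l' : R) :
  ulim U u l -> ulim U v l' -> ulim U (fun n => u n + v n) (l + l').
Proof.
intros Hu Hv e He.
refine (fu_imp U HU _ _ _ (fu_and U HU _ _ (Hu (e / 2) _) (Hv (e / 2) _))); try lra.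
intros n [H1 H2]. replace (u n + v n - (l + l')) with ((u n - l) + (v n - l')) by ring.
eapply Rle_lt_trans; [apply Rabs_triang | lra].
Qed.

Lemma ulim_mult (u v : nat -> R) (l l' : R) :
  ulim U u l -> ulim U v l' -> ulim U (fun n => u n * v n) (l * l').
Proof.
intros Hu Hv e He.
pose (D := Rabs l + Rabs l' + 1).
assert (HD : 1 <= D) by (unfold D; pose proof (Rabs_pos l); pose proof (Rabs_pos l'); lra).
pose (d := Rmin 1 (e / (2 * D))).
assert (Hd : 0 < d) by (apply Rmin_pos; [lra | apply Rdiv_lt_0_compat; lra]).
assert (Hd1 : d <= 1) by apply Rmin_l.
assert (Hd2 : d * D <= e / 2).
{ replace (e / 2) with (e / (2 * D) * D) by (field; lra).
  apply Rmult_le_compat_r; [lra | apply Rmin_r]. }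
refine (fu_imp U HU _ _ _ (fu_and U HU _ _ (Hu d Hd) (Hv d Hd))).
intros n [H1 H2].
replace (u n * v n - l * l') with ((u n - l) * (v n - l') + (u n - l) * l' + l * (v n - l')) by ring.
eapply Rle_lt_trans; [apply Rabs_triang |].
eapply Rle_lt_trans; [apply Rplus_le_compat_r, Rabs_triang |].
rewrite !Rabs_mult.
pose proof (Rabs_pos l). pose proof (Rabs_pos l').
pose proof (Rabs_pos (u n - l)). pose proof (Rabs_pos (v n - l')).
assert (Rabs (u n - l) * Rabs (v n - l') <= d * 1) by (apply Rmult_le_compat; lra).
assert (Rabs (u n - l) * Rabs l' <= d * Rabs l') by (apply Rmult_le_compat_r; lra).
assert (Rabs l * Rabs (v n - l') <= Rabs l * d) by (apply Rmult_le_compat_l; lra).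
unfold D in Hd2. nra.
Qed.

Lemma ulim_scal (c : R) (u : nat -> R) (l : R) :
  ulim U u l -> ulim U (fun n => c * u n) (c * l).
Proof. intros H. apply ulim_mult; [apply ulim_const | exact H]. Qed.

Lemma ulim_minus (u v : nat -> R) (l l' : R) :
  ulim U u l -> ulim U v l' -> ulim U (fun n => u n - v n) (l - l').
Proof.
intros Hu Hv. replace (l - l') with (l + -1 * l') by ring.
apply (ulim_ext (fun n => u n + -1 * v n)); [intros; ring |].
apply ulim_plus; [exact Hu | now apply ulim_scal].
Qed.

Lemma ulim_le (u v : nat -> R) (l l' : R) :
  U (fun n => u n <= v n) -> ulim U u l -> ulim U v l' -> l <= l'.
Proof.
intros H Hu Hv. apply Rnot_lt_le. intros Hlt.
destruct (fu_ex _ (fu_and U HU _ _ H (fu_and U HU _ _ (Hu ((l - l') / 2) ltac:(lra))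
  (Hv ((l - l') / 2) ltac:(lra))))) as [n [H1 [H2 H3]]].
apply Rabs_def2 in H2. apply Rabs_def2 in H3. lra.
Qed.

Lemma ulim_unique (u : nat -> R) (l l' : R) : ulim U u l -> ulim U u l' -> l = l'.
Proof.
intros H H'.
apply Rle_antisym; [apply (ulim_le u u) | apply (ulim_le u u)]; auto;
  apply fu_all; intros; lra.
Qed.

Lemma ulim_abs_le (u : nat -> R) (l C : R) :
  (forall n, Rabs (u n) <= C) -> ulim U u l -> Rabs l <= C.
Proof.
intros HC Hu. apply Rabs_le. split.
- apply (ulim_le (fun _ => - C) u); [| apply ulim_const | exact Hu].
  apply fu_all. intros n. specialize (HC n). apply Rabs_le_between in HC. lra.
- apply (ulim_le u (fun _ => C)); [| exact Hu | apply ulim_const].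
  apply fu_all. intros n. specialize (HC n). apply Rabs_le_between in HC. lra.
Qed.

End Ulim.

(** * Finite sums *)

Fixpoint fsum (n : nat) (f : nat -> R) : R :=
  match n with O => 0 | S n' => fsum n' f + f n' end.

Lemma fsum_ext (n : nat) (f g : nat -> R) :
  (forall i, (i < n)%nat -> f i = g i) -> fsum n f = fsum n g.
Proof.
induction n as [| n IH]; simpl; intros H; [reflexivity |].
rewrite IH by (intros; apply H; lia). rewrite H by lia. reflexivity.
Qed.

Lemma fsum_plus (n : nat) (f g : nat -> R) :
  fsum n (fun i => f i + g i) = fsum n f + fsum n g.
Proof. induction n as [| n IH]; simpl; [ring | rewrite IH; ring]. Qed.

Lemma fsum_scal (n : nat) (c : R) (f : nat -> R) :
  fsum n (fun i => c * f i) = c * fsum n f.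
Proof. induction n as [| n IH]; simpl; [ring | rewrite IH; ring]. Qed.

Lemma fsum_scal_r (n : nat) (c : R) (f : nat -> R) :
  fsum n (fun i => f i * c) = fsum n f * c.
Proof. induction n as [| n IH]; simpl; [ring | rewrite IH; ring]. Qed.

Lemma fsum_minus (n : nat) (f g : nat -> R) :
  fsum n (fun i => f i - g i) = fsum n f - fsum n g.
Proof. induction n as [| n IH]; simpl; [ring | rewrite IH; ring]. Qed.

Lemma fsum_zero (n : nat) : fsum n (fun _ => 0) = 0.
Proof. induction n as [| n IH]; simpl; [ring | rewrite IH; ring]. Qed.

Lemma fsum_const (n : nat) (c : R) : fsum n (fun _ => c) = INR n * c.
Proof. induction n as [| n IH]; [simpl; ring | cbn [fsum]; rewrite IH, S_INR; ring]. Qed.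

Lemma fsum_le (n : nat) (f g : nat -> R) :
  (forall i, (i < n)%nat -> f i <= g i) -> fsum n f <= fsum n g.
Proof.
induction n as [| n IH]; simpl; intros H; [lra |].
apply Rplus_le_compat; [apply IH; intros; apply H; lia | apply H; lia].
Qed.

Lemma fsum_nonneg (n : nat) (f : nat -> R) :
  (forall i, (i < n)%nat -> 0 <= f i) -> 0 <= fsum n f.
Proof. intros H. rewrite <- (fsum_zero n). now apply fsum_le. Qed.

Lemma fsum_abs (n : nat) (f : nat -> R) : Rabs (fsum n f) <= fsum n (fun i => Rabs (f i)).
Proof.
induction n as [| n IH]; simpl; [rewrite Rabs_R0; lra |].
eapply Rle_trans; [apply Rabs_triang | lra].
Qed.

Lemma fsum_swap (n p : nat) (f : nat -> nat -> R) :
  fsum n (fun i => fsum p (fun j => f i j)) = fsum p (fun j => fsum n (fun i => f i j)).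
Proof.
induction n as [| n IH]; simpl; [now rewrite fsum_zero | rewrite IH, <- fsum_plus; reflexivity].
Qed.

Lemma fsum_term_le (n : nat) (f : nat -> R) (e : nat) :
  (forall i, (i < n)%nat -> 0 <= f i) -> (e < n)%nat -> f e <= fsum n f.
Proof.
intros H He. induction n as [| n IH]; [lia |]. simpl.
destruct (Nat.eq_dec e n) as [-> | Hne].
- assert (0 <= fsum n f) by (apply fsum_nonneg; intros; apply H; lia). lra.
- assert (f e <= fsum n f) by (apply IH; [intros; apply H; lia | lia]).
  assert (0 <= f n) by (apply H; lia). lra.
Qed.

Definition indic (b : bool) : R := if b then 1 else 0.

Lemma indic_nonneg (b : bool) : 0 <= indic b.
Proof. destruct b; simpl; lra. Qed.

Lemma indic_le1 (b : bool) : indic b <= 1.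
Proof. destruct b; simpl; lra. Qed.

Lemma fsum_delta (n e : nat) (f : nat -> R) :
  fsum n (fun i => indic (i =? e)%nat * f i) = indic (e <? n)%nat * f e.
Proof.
induction n as [| n IH]; cbn [fsum]; [simpl; ring |].
rewrite IH.
destruct (Nat.eqb_spec n e) as [He | He]; destruct (Nat.ltb_spec e n);
  destruct (Nat.ltb_spec e (S n)); subst; simpl; try lia; ring.
Qed.

Lemma is_derive_fsum (n : nat) (f df : nat -> R -> R) (x : R) :
  (forall i, (i < n)%nat -> is_derive (f i) x (df i x)) ->
  is_derive (fun t => fsum n (fun i => f i t)) x (fsum n (fun i => df i x)).
Proof.
induction n as [| n IH]; simpl; intros H; [apply (@is_derive_const R_AbsRing R_NormedModule) |].
apply (@is_derive_plus R_AbsRing R_NormedModule); [apply IH; intros; apply H; lia | apply H; lia].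
Qed.

Lemma ulim_fsum (U : (nat -> Prop) -> Prop) (HU : free_ultra U) (n : nat)
  (f : nat -> nat -> R) (l : nat -> R) :
  (forall i, (i < n)%nat -> ulim U (f i) (l i)) ->
  ulim U (fun p => fsum n (fun i => f i p)) (fsum n l).
Proof.
induction n as [| n IH]; simpl; intros H; [apply ulim_const, HU |].
apply ulim_plus; [exact HU | apply IH; intros; apply H; lia | apply H; lia].
Qed.

(** * The discrete variational problem *)

(* Fourier coefficients of |Q|^2 Q: the frequency of [X conj(Y) Z] is [a - b + c]. *)
Definition trilin (K : nat) (X Y Z : nat -> R) (d : nat) : R :=
  fsum K (fun a => fsum K (fun b => fsum K (fun c =>
    indic (a + c =? b + d)%nat * (X a * Y b * Z c)))).

Definition quadrilin (K : nat) (X Y Z W : nat -> R) : R :=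
  fsum K (fun d => trilin K X Y Z d * W d).

Lemma trilin_sym (K : nat) (X Y Z : nat -> R) (d : nat) :
  trilin K X Y Z d = trilin K Z Y X d.
Proof.
unfold trilin.
rewrite (fsum_swap K K (fun a b => fsum K (fun c => indic (a + c =? b + d)%nat * (X a * Y b * Z c)))).
rewrite (fsum_swap K K (fun a b => fsum K (fun c => indic (a + c =? b + d)%nat * (Z a * Y b * X c)))).
apply fsum_ext; intros b _.
rewrite (fsum_swap K K (fun i c => indic (i + c =? b + d)%nat * (X i * Y b * Z c))).
apply fsum_ext; intros a _. apply fsum_ext; intros c _.
rewrite (Nat.add_comm c a). ring.
Qed.

Lemma quadrilin_expand (K : nat) (X Y Z W : nat -> R) :
  quadrilin K X Y Z W =
  fsum K (fun d => fsum K (fun a => fsum K (fun b => fsum K (fun c =>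
    indic (a + c =? b + d)%nat * (X a * Y b * Z c * W d))))).
Proof.
unfold quadrilin, trilin. apply fsum_ext; intros d _.
rewrite <- fsum_scal_r. apply fsum_ext; intros a _.
rewrite <- fsum_scal_r. apply fsum_ext; intros b _.
rewrite <- fsum_scal_r. apply fsum_ext; intros c _. ring.
Qed.

Lemma quadrilin_sym13 (K : nat) (X Y Z W : nat -> R) :
  quadrilin K X Y Z W = quadrilin K Z Y X W.
Proof. unfold quadrilin. apply fsum_ext; intros d _. now rewrite trilin_sym. Qed.

Lemma quadrilin_sym_swap (K : nat) (X Y Z W : nat -> R) :
  quadrilin K X Y Z W = quadrilin K Y X W Z.
Proof.
rewrite !quadrilin_expand.
(* The constraint [a + c = b + d] is invariant under exchanging the pairs [(a, c)] and [(b, d)]. *)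
transitivity (fsum K (fun c => fsum K (fun b => fsum K (fun a => fsum K (fun d =>
    indic (a + c =? b + d)%nat * (X a * Y b * Z c * W d)))))).
- transitivity (fsum K (fun d => fsum K (fun c => fsum K (fun b => fsum K (fun a =>
    indic (a + c =? b + d)%nat * (X a * Y b * Z c * W d)))))).
  + apply fsum_ext; intros d _.
    rewrite (fsum_swap K K (fun a b => fsum K (fun c => indic (a + c =? b + d)%nat * (X a * Y b * Z c * W d)))).
    rewrite (fsum_swap K K (fun c b => fsum K (fun a => indic (a + c =? b + d)%nat * (X a * Y b * Z c * W d)))).
    apply fsum_ext; intros b _. apply fsum_swap.
  + rewrite (fsum_swap K K (fun d c => fsum K (fun b => fsum K (fun a => indic (a + c =? b + d)%nat * (X a * Y b * Z c * W d))))).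
    apply fsum_ext; intros c _.
    rewrite (fsum_swap K K (fun d b => fsum K (fun a => indic (a + c =? b + d)%nat * (X a * Y b * Z c * W d)))).
    apply fsum_ext; intros b _. apply fsum_swap.
- apply fsum_ext; intros d _. apply fsum_ext; intros a _.
  apply fsum_ext; intros b _. apply fsum_ext; intros c _.
  rewrite (Nat.eqb_sym (b + d) (a + c)). ring.
Qed.

Lemma fsum_ind_le1 (K a : nat) (P : nat -> bool) :
  (forall i, P i = true -> i = a) -> fsum K (fun i => indic (P i)) <= 1.
Proof.
intros H. apply Rle_trans with (fsum K (fun i => indic (i =? a)%nat * 1)).
- apply fsum_le; intros i _. destruct (P i) eqn:E.
  + rewrite (H i E), Nat.eqb_refl. simpl; lra.
  + simpl. pose proof (indic_nonneg (i =? a)%nat). lra.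
- rewrite (fsum_delta K a (fun _ => 1)). pose proof (indic_le1 (a <? K)%nat). lra.
Qed.

(* Two of the three summation indices determine the third. *)
Lemma trilin_le_fst (K : nat) (X Y Z : nat -> R) (d : nat) (w : R) :
  (forall i, (i < K)%nat -> 0 <= X i <= w) -> (forall i, 0 <= Y i) -> (forall i, 0 <= Z i) ->
  trilin K X Y Z d <= w * fsum K Y * fsum K Z.
Proof.
intros HX HY HZ. unfold trilin.
rewrite (fsum_swap K K (fun a b => fsum K (fun c => indic (a + c =? b + d)%nat * (X a * Y b * Z c)))).
apply Rle_trans with (fsum K (fun b => fsum K (fun c => w * Y b * Z c))).
- apply fsum_le; intros b Hb. rewrite fsum_swap. apply fsum_le; intros c Hc.
  apply Rle_trans with (fsum K (fun a => (w * Y b * Z c) * indic (a + c =? b + d)%nat)).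
  + apply fsum_le; intros a Ha. destruct (HX a Ha) as [H1 H2].
    rewrite (Rmult_comm (w * Y b * Z c)). apply Rmult_le_compat_l; [apply indic_nonneg |].
    apply Rmult_le_compat_r; [apply HZ |]. now apply Rmult_le_compat_r.
  + rewrite fsum_scal.
    assert (0 <= w * Y b * Z c).
    { destruct (HX b Hb). apply Rmult_le_pos; [apply Rmult_le_pos; [lra |] |]; auto. }
    rewrite <- (Rmult_1_r (w * Y b * Z c)) at 2. apply Rmult_le_compat_l; [assumption |].
    apply (fsum_ind_le1 K (b + d - c)%nat _).
    intros i Hi. apply Nat.eqb_eq in Hi. lia.
- apply Req_le. rewrite (Rmult_assoc w), <- fsum_scal_r, <- fsum_scal.
  apply fsum_ext; intros b _. rewrite <- !fsum_scal. apply fsum_ext; intros c _. ring.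
Qed.

Lemma trilin_le_thd (K : nat) (X Y Z : nat -> R) (d : nat) (w : R) :
  (forall i, (i < K)%nat -> 0 <= Z i <= w) -> (forall i, 0 <= Y i) -> (forall i, 0 <= X i) ->
  trilin K X Y Z d <= w * fsum K Y * fsum K X.
Proof. intros. rewrite trilin_sym. now apply trilin_le_fst. Qed.

Lemma trilin_le_snd (K : nat) (X Y Z : nat -> R) (d : nat) (w : R) :
  (forall i, (i < K)%nat -> 0 <= Y i <= w) -> (forall i, 0 <= X i) -> (forall i, 0 <= Z i) ->
  trilin K X Y Z d <= w * fsum K X * fsum K Z.
Proof.
intros HY HX HZ. unfold trilin.
apply Rle_trans with (fsum K (fun a => fsum K (fun c => w * X a * Z c))).
- apply fsum_le; intros a Ha. rewrite fsum_swap. apply fsum_le; intros c Hc.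
  apply Rle_trans with (fsum K (fun b => (w * X a * Z c) * indic (a + c =? b + d)%nat)).
  + apply fsum_le; intros b Hb. destruct (HY b Hb) as [H1 H2].
    rewrite (Rmult_comm (w * X a * Z c)). apply Rmult_le_compat_l; [apply indic_nonneg |].
    apply Rmult_le_compat_r; [apply HZ |]. rewrite (Rmult_comm w). apply Rmult_le_compat_l; auto.
  + rewrite fsum_scal.
    assert (0 <= w * X a * Z c).
    { destruct (HY a Ha). apply Rmult_le_pos; [apply Rmult_le_pos; [lra |] |]; auto. }
    rewrite <- (Rmult_1_r (w * X a * Z c)) at 2. apply Rmult_le_compat_l; [assumption |].
    apply (fsum_ind_le1 K (a + c - d)%nat _).
    intros i Hi. apply Nat.eqb_eq in Hi. lia.
- apply Req_le. rewrite (Rmult_assoc w), <- fsum_scal_r, <- fsum_scal.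
  apply fsum_ext; intros b _. rewrite <- !fsum_scal. apply fsum_ext; intros c _. ring.
Qed.

(** By [X a * X b <= (X a ^ 2 + X b ^ 2) / 2] the form splits into two double sums, in each of which
    the constraint determines the remaining index. Unlike the bounds with a supremum, this one
    involves only the [l^2] and [l^1] norms, which are the first to be controlled. *)
Lemma trilin_le_l2 (K : nat) (X : nat -> R) (d : nat) :
  (forall i, 0 <= X i) ->
  trilin K X X X d <= fsum K (fun i => X i ^ 2) * fsum K X.
Proof.
intros HX.
pose (X2 := fun i => X i ^ 2 / 2).
apply Rle_trans with
  (fsum K (fun a => fsum K (fun c => X2 a * X c)) + fsum K (fun b => fsum K (fun c => X2 b * X c))).
- unfold trilin.
  apply Rle_trans with
    (fsum K (fun a => fsum K (fun b => fsum K (fun c => indic (a + c =? b + d)%nat * (X2 a * X c) +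
      indic (a + c =? b + d)%nat * (X2 b * X c))))).
  + apply fsum_le; intros a _; apply fsum_le; intros b _; apply fsum_le; intros c _.
    rewrite <- Rmult_plus_distr_l. apply Rmult_le_compat_l; [apply indic_nonneg |].
    unfold X2. rewrite <- Rmult_plus_distr_r. apply Rmult_le_compat_r; [apply HX |].
    pose proof (pow2_ge_0 (X a - X b)). nra.
  + rewrite (fsum_ext K _ (fun a => fsum K (fun b => fsum K (fun c => indic (a + c =? b + d)%nat * (X2 a * X c))) +
       fsum K (fun b => fsum K (fun c => indic (a + c =? b + d)%nat * (X2 b * X c))))).
    2:{ intros a _. rewrite <- fsum_plus. apply fsum_ext; intros b _. now rewrite fsum_plus. }
    rewrite fsum_plus. 
    assert (HX2 : forall i, 0 <= X2 i) by (intros i; unfold X2; pose proof (HX i); nra).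
    apply Rplus_le_compat.
    * apply fsum_le; intros a _. rewrite fsum_swap. apply fsum_le; intros c _.
      rewrite fsum_scal_r. rewrite <- (Rmult_1_l (X2 a * X c)) at 2.
      apply Rmult_le_compat_r; [apply Rmult_le_pos; auto |].
      apply (fsum_ind_le1 K (a + c - d)%nat _).
      intros i Hi. apply Nat.eqb_eq in Hi. lia.
    * rewrite (fsum_swap K K (fun a b => fsum K (fun c => indic (a + c =? b + d)%nat * (X2 b * X c)))).
      apply fsum_le; intros b _. rewrite fsum_swap. apply fsum_le; intros c _.
      rewrite fsum_scal_r. rewrite <- (Rmult_1_l (X2 b * X c)) at 2.
      apply Rmult_le_compat_r; [apply Rmult_le_pos; auto |].
      apply (fsum_ind_le1 K (b + d - c)%nat _).
      intros i Hi. apply Nat.eqb_eq in Hi. lia.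
- apply Req_le. rewrite <- fsum_plus, <- fsum_scal_r. apply fsum_ext; intros a _.
  rewrite !fsum_scal. unfold X2. field.
Qed.

Lemma trilin_nonneg (K : nat) (X Y Z : nat -> R) (d : nat) :
  (forall i, 0 <= X i) -> (forall i, 0 <= Y i) -> (forall i, 0 <= Z i) -> 0 <= trilin K X Y Z d.
Proof.
intros HX HY HZ. unfold trilin.
apply fsum_nonneg; intros a _; apply fsum_nonneg; intros b _; apply fsum_nonneg; intros c _.
apply Rmult_le_pos; [apply indic_nonneg |]. apply Rmult_le_pos; [apply Rmult_le_pos |]; auto.
Qed.

Lemma quadrilin_le_abs (K : nat) (X : nat -> R) :
  quadrilin K X X X X <=
  quadrilin K (fun i => Rabs (X i)) (fun i => Rabs (X i)) (fun i => Rabs (X i)) (fun i => Rabs (X i)).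
Proof.
rewrite !quadrilin_expand.
apply fsum_le; intros d _; apply fsum_le; intros a _; apply fsum_le; intros b _; apply fsum_le; intros c _.
apply Rmult_le_compat_l; [apply indic_nonneg |]. rewrite <- !Rabs_mult. apply Rle_abs.
Qed.

(** The two symmetries of the form move [w] into the last slot in each of the four product-rule
    terms. *)
Lemma is_derive_quadrilin (K : nat) (g w : nat -> R) :
  is_derive (fun t => quadrilin K (fun i => g i + t * w i) (fun i => g i + t * w i)
    (fun i => g i + t * w i) (fun i => g i + t * w i)) 0 (4 * quadrilin K g g g w).
Proof.
replace (4 * quadrilin K g g g w) with
  (quadrilin K w g g g + quadrilin K g w g g + quadrilin K g g w g + quadrilin K g g g w).
2:{ rewrite (quadrilin_sym_swap K g w g g), (quadrilin_sym13 K w g g g).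
    rewrite <- (quadrilin_sym_swap K g g g w). ring. }
rewrite !quadrilin_expand.
apply (is_derive_ext (fun t => fsum K (fun d => fsum K (fun a => fsum K (fun b => fsum K (fun c =>
  indic (a + c =? b + d)%nat * ((g a + t * w a) * (g b + t * w b) * (g c + t * w c) * (g d + t * w d)))))))).
{ intros t. now rewrite quadrilin_expand. }
rewrite <- !fsum_plus.
apply (is_derive_fsum K (fun d t => _) (fun d t => _)); intros d _.
rewrite <- !fsum_plus.
apply (is_derive_fsum K (fun d t => _) (fun d t => _)); intros a _.
rewrite <- !fsum_plus.
apply (is_derive_fsum K (fun d t => _) (fun d t => _)); intros b _.
rewrite <- !fsum_plus.
apply (is_derive_fsum K (fun d t => _) (fun d t => _)); intros c _.
auto_derive; [trivial | ring].
Qed.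

Definition wnorm (K : nat) (M g : nat -> R) : R := fsum K (fun i => M i * g i ^ 2).

Lemma is_derive_wnorm (K : nat) (M g w : nat -> R) :
  is_derive (fun t => wnorm K M (fun i => g i + t * w i)) 0 (2 * fsum K (fun i => M i * g i * w i)).
Proof.
rewrite <- fsum_scal. unfold wnorm.
apply (is_derive_fsum K (fun i t => M i * (g i + t * w i) ^ 2) (fun i t => 2 * (M i * g i * w i))).
intros i _. auto_derive; [trivial | ring].
Qed.

Lemma derive_at_minimum (f : R -> R) (l : R) :
  is_derive f 0 l -> (forall t, f 0 <= f t) -> l = 0.
Proof.
intros Hd Hm. apply is_derive_Reals in Hd.
assert (pr : derivable_pt f 0) by (exists l; exact Hd).
rewrite <- (derive_pt_eq_0 f 0 l pr Hd).
apply (deriv_minimum f (-1) 1 0 pr); try lra. intros x _ _. apply Hm.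
Qed.

(** The constraint set is compact, so a maximising sequence is passed to the limit coordinate by
    coordinate along an ultrafilter. By homogeneity the maximum property becomes an inequality for
    every [w]; the equation then comes from an unconstrained minimum, with the maximum [S] itself as
    multiplier. *)
Lemma discrete_maximizer (K : nat) (M : nat -> R) :
  (0 < K)%nat -> (forall i, 0 < M i) ->
  exists (S : R) (g : nat -> R), 0 < S /\ (forall i, 0 <= g i) /\ wnorm K M g = 1 /\
    (forall w, quadrilin K w w w w <= S * wnorm K M w ^ 2) /\
    (forall d, (d < K)%nat -> trilin K g g g d = S * M d * g d).
Proof.
intros HK HM. destruct free_ultra_exists as [U HU].
pose (F := fun g => quadrilin K g g g g).
pose (E := fun v => exists g, wnorm K M g = 1 /\ v = F g).
assert (Hcoord : forall g i, (i < K)%nat -> wnorm K M g = 1 -> g i ^ 2 <= / M i).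
{ intros g i Hi Hg.
  assert (H : M i * g i ^ 2 <= 1).
  { rewrite <- Hg. unfold wnorm. apply (fsum_term_le K (fun i => M i * g i ^ 2)); [| exact Hi].
    intros j _. pose proof (HM j). apply Rmult_le_pos; [lra | apply pow2_ge_0]. }
  pose proof (HM i). apply (Rmult_le_reg_l (M i)); [lra |]. rewrite Rinv_r by lra. lra. }
assert (Hgb : forall g i, (i < K)%nat -> wnorm K M g = 1 -> Rabs (g i) <= 1 + / M i).
{ intros g i Hi Hg. specialize (Hcoord g i Hi Hg). pose proof (Rabs_pos (g i)).
  rewrite <- pow2_abs in Hcoord. nra. }
pose (D := 1 + fsum K (fun i => / M i)).
assert (HD : forall i, (i < K)%nat -> 1 + / M i <= D).
{ intros i Hi. unfold D.
  pose proof (fsum_term_le K (fun i => / M i) i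
    (fun j _ => Rlt_le _ _ (Rinv_0_lt_compat _ (HM j))) Hi) as H. simpl in H. lra. }
destruct (completeness E) as [S [HS1 HS2]].
(* Every coordinate is at most [D] in modulus on the constraint set, which bounds the form through
   [trilin_le_fst]. *)
- exists (D * (fsum K (fun _ => D) * fsum K (fun _ => D)) * (INR K * D)). intros v [g [Hg ->]]. unfold F.
  eapply Rle_trans; [apply quadrilin_le_abs |]. unfold quadrilin.
  assert (Hs : fsum K (fun i => Rabs (g i)) <= fsum K (fun _ => D)).
  { apply fsum_le. intros i Hi. eapply Rle_trans; [apply Hgb; auto | auto]. }
  assert (Hs0 : 0 <= fsum K (fun i => Rabs (g i))) by (apply fsum_nonneg; intros; apply Rabs_pos).
  assert (HDp : 0 <= D).
  { specialize (HD 0%nat HK). pose proof (Rinv_0_lt_compat _ (HM 0%nat)). lra. }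
  apply Rle_trans with (fsum K (fun _ => D * (fsum K (fun _ => D) * fsum K (fun _ => D)) * D)).
  + apply fsum_le; intros d Hd. apply Rmult_le_compat.
    * apply trilin_nonneg; intros; apply Rabs_pos.
    * apply Rabs_pos.
    * eapply Rle_trans; [apply trilin_le_fst with (w := D) |].
      -- intros i Hi. split; [apply Rabs_pos |]. eapply Rle_trans; [apply Hgb; auto | auto].
      -- intros; apply Rabs_pos.
      -- intros; apply Rabs_pos.
      -- rewrite Rmult_assoc. apply Rmult_le_compat_l; [exact HDp |]. apply Rmult_le_compat; auto.
    * eapply Rle_trans; [apply Hgb; auto | auto].
  + apply Req_le. rewrite (fsum_const K (D * (fsum K (fun _ => D) * fsum K (fun _ => D)) * D)). ring.
(* The constraint set is nonempty: all the weight is put at index [0]. *)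
- pose (g0 := fun i => indic (i =? 0)%nat * sqrt (/ M 0%nat)).
  exists (F g0), g0. split; [| reflexivity]. unfold wnorm, g0.
  rewrite (fsum_ext K _ (fun i => indic (i =? 0)%nat * 1)).
  + rewrite (fsum_delta K 0 (fun _ => 1)). apply Nat.ltb_lt in HK. rewrite HK. simpl; ring.
  + intros i _. destruct (Nat.eqb_spec i 0) as [-> | _]; simpl; [| ring].
    rewrite Rmult_1_l, Rmult_1_r. rewrite sqrt_sqrt by (pose proof (Rinv_0_lt_compat _ (HM 0%nat)); lra).
    field. pose proof (HM 0%nat); lra.
- assert (Hmax : exists gs : nat -> nat -> R,
    forall p, wnorm K M (gs p) = 1 /\ S - / (INR p + 1) <= F (gs p)).
  { apply (choice (fun p g => wnorm K M g = 1 /\ S - / (INR p + 1) <= F g)).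
    intros p. apply NNPP. intros Hn.
    assert (Hub : is_upper_bound E (S - / (INR p + 1))).
    { intros v [g [Hg ->]]. apply Rnot_lt_le. intros Hlt. apply Hn. exists g. split; [exact Hg | lra]. }
    specialize (HS2 _ Hub). pose proof (RinvN_pos p). lra. }
  destruct Hmax as [gs Hgs].
  assert (Hlim : exists gl : nat -> R, forall i, (i < K)%nat -> ulim U (fun p => gs p i) (gl i)).
  { apply (choice (fun i l => (i < K)%nat -> ulim U (fun p => gs p i) l)). intros i.
    destruct (classic (i < K)%nat) as [Hi | Hi].
    - destruct (ulim_bounded_ex U HU (fun p => gs p i) (1 + / M i)) as [l Hl]; [| now exists l].
      intros p. apply Hgb; [exact Hi | apply Hgs].
    - exists 0. tauto. }
  destruct Hlim as [gl Hgl].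
  assert (Hnorm : wnorm K M gl = 1).
  { apply (ulim_unique U HU (fun p => wnorm K M (gs p))).
    - unfold wnorm. apply (ulim_fsum U HU K (fun i p => M i * gs p i ^ 2) (fun i => M i * gl i ^ 2)).
      intros i Hi. apply ulim_scal; [exact HU |]. simpl.
      apply ulim_mult; [exact HU | auto |]. apply ulim_mult; [exact HU | auto | apply ulim_const, HU].
    - apply (ulim_ext U HU (fun _ => 1)); [intros p; symmetry; apply Hgs | apply ulim_const, HU]. }
  assert (HFl : ulim U (fun p => F (gs p)) (F gl)).
  { unfold F. rewrite quadrilin_expand.
    apply (ulim_ext U HU (fun p => fsum K (fun d => fsum K (fun a => fsum K (fun b => fsum K (fun c =>
      indic (a + c =? b + d)%nat * (gs p a * gs p b * gs p c * gs p d))))))).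
    { intros p. now rewrite quadrilin_expand. }
    apply (ulim_fsum U HU K (fun d p => _)); intros d Hd.
    apply (ulim_fsum U HU K (fun a p => _)); intros a Ha.
    apply (ulim_fsum U HU K (fun b p => _)); intros b Hb.
    apply (ulim_fsum U HU K (fun c p => _)); intros c Hc.
    apply ulim_scal; [exact HU |].
    apply ulim_mult; [exact HU | | auto]. apply ulim_mult; [exact HU | | auto].
    apply ulim_mult; auto. }
  assert (HFS : F gl = S).
  { apply Rle_antisym.
    - apply HS1. now exists gl.
    - apply (ulim_le U HU (fun p => S - / (INR p + 1)) (fun p => F (gs p))); [| | exact HFl].
      + apply fu_all; [exact HU |]. intros p. apply Hgs.
      + intros e He. destruct (archimed_cor1 e He) as [N [HN1 HN2]].
        refine (fu_imp U HU _ _ _ (fu_ev U HU N)). intros p Hp.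
        replace (S - / (INR p + 1) - S) with (- / (INR p + 1)) by ring.
        rewrite Rabs_Ropp, Rabs_pos_eq by (left; apply RinvN_pos).
        eapply Rle_lt_trans; [| exact HN1]. apply Rinv_le_contravar.
        * apply lt_0_INR. lia.
        * apply le_INR in Hp. lra. }
  (* Absolute values keep the constraint and cannot lower the form, so [g] is again a maximiser. *)
  pose (g := fun i => Rabs (gl i)).
  assert (Hg1 : wnorm K M g = 1).
  { rewrite <- Hnorm. unfold wnorm, g. apply fsum_ext. intros i _. now rewrite pow2_abs. }
  assert (HgS : F g = S).
  { apply Rle_antisym; [apply HS1; now exists g |]. rewrite <- HFS. apply quadrilin_le_abs. }
  assert (Hhom : forall w, quadrilin K w w w w <= S * wnorm K M w ^ 2).
  { intros w. assert (Hw : 0 <= wnorm K M w).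
    { apply fsum_nonneg. intros i _. pose proof (HM i). apply Rmult_le_pos; [lra | apply pow2_ge_0]. }
    destruct (Rle_lt_or_eq_dec _ _ Hw) as [Hpos | H0].
    - pose (q := / sqrt (wnorm K M w)).
      assert (Hsq : 0 < sqrt (wnorm K M w)) by now apply sqrt_lt_R0.
      assert (Hq2 : q ^ 2 * wnorm K M w = 1).
      { unfold q. rewrite <- (sqrt_sqrt (wnorm K M w)) at 2 by lra. field. lra. }
      assert (H1 : F (fun i => q * w i) <= S).
      { apply HS1. eexists. split; [| reflexivity]. rewrite <- Hq2. unfold wnorm.
        rewrite <- fsum_scal. apply fsum_ext. intros i _. ring. }
      assert (H2 : F (fun i => q * w i) = q ^ 4 * quadrilin K w w w w).
      { unfold F. rewrite !quadrilin_expand.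
        rewrite <- fsum_scal; apply fsum_ext; intros d _. rewrite <- fsum_scal; apply fsum_ext; intros a _.
        rewrite <- fsum_scal; apply fsum_ext; intros b _. rewrite <- fsum_scal; apply fsum_ext; intros c _.
        ring. }
      rewrite H2 in H1.
      replace (quadrilin K w w w w) with (q ^ 4 * quadrilin K w w w w * wnorm K M w ^ 2).
      + apply Rmult_le_compat_r; [apply pow2_ge_0 | exact H1].
      + replace (q ^ 4 * quadrilin K w w w w * wnorm K M w ^ 2)
          with (quadrilin K w w w w * (q ^ 2 * wnorm K M w) ^ 2) by ring. rewrite Hq2. ring.
    (* When the weighted norm vanishes [w] cannot be normalised, but then it is zero at all the
       summed indices. *)
    - assert (Hz : forall i, (i < K)%nat -> w i = 0).
      { intros i Hi. pose proof (HM i).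
        assert (M i * w i ^ 2 <= 0).
        { rewrite H0. unfold wnorm. apply (fsum_term_le K (fun i => M i * w i ^ 2)); [| exact Hi].
          intros j _. pose proof (HM j). apply Rmult_le_pos; [lra | apply pow2_ge_0]. }
        assert (w i ^ 2 <= 0) by nra. nra. }
      rewrite <- H0. unfold quadrilin.
      rewrite (fsum_ext K _ (fun _ => 0)); [rewrite fsum_zero; lra |].
      intros d Hd. rewrite (Hz d Hd). ring. }
  assert (HEL : forall d, (d < K)%nat -> trilin K g g g d = S * M d * g d).
  { intros d Hd. pose (w := fun i => indic (i =? d)%nat).
    (* Along [g + t w] the difference [S * wnorm ^ 2 - F] is nonnegative by [Hhom] and zero at
       [t = 0], where [wnorm] is [1] and [F] is [S]. Its derivative vanishes there, and a factor [4]
       cancels from both terms. *)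
    assert (Hder : is_derive (fun t => S * wnorm K M (fun i => g i + t * w i) ^ 2 -
        F (fun i => g i + t * w i)) 0
      (S * (2 * wnorm K M (fun i => g i + 0 * w i) * (2 * fsum K (fun i => M i * g i * w i))) -
        4 * quadrilin K g g g w)).
    { apply (@is_derive_minus R_AbsRing R_NormedModule); [| apply is_derive_quadrilin].
      apply (is_derive_scal (fun t => wnorm K M (fun i => g i + t * w i) ^ 2)).
      evar_last. apply is_derive_pow. apply is_derive_wnorm. simpl. ring. }
    assert (Hw0 : wnorm K M (fun i => g i + 0 * w i) = 1).
    { rewrite <- Hg1. apply fsum_ext. intros i _. ring. }
    assert (HF0 : F (fun i => g i + 0 * w i) = S).
    { rewrite <- HgS. unfold F. rewrite !quadrilin_expand.
      apply fsum_ext; intros ? _; apply fsum_ext; intros ? _; apply fsum_ext; intros ? _; apply fsum_ext; intros ? _.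
      ring. }
    rewrite Hw0 in Hder. apply derive_at_minimum in Hder.
    - assert (H1 : fsum K (fun i => M i * g i * w i) = M d * g d).
      { unfold w. rewrite (fsum_ext K _ (fun i => indic (i =? d)%nat * (M i * g i))) by (intros; ring).
        rewrite (fsum_delta K d (fun i => M i * g i)). apply Nat.ltb_lt in Hd. rewrite Hd. simpl; ring. }
      assert (H2 : quadrilin K g g g w = trilin K g g g d).
      { unfold quadrilin, w. rewrite (fsum_ext K _ (fun i => indic (i =? d)%nat * trilin K g g g i)) by (intros; ring).
        rewrite (fsum_delta K d (trilin K g g g)). apply Nat.ltb_lt in Hd. rewrite Hd. simpl; ring. }
      rewrite H1, H2 in Hder. lra.
    - intros t. rewrite Hw0, HF0. pose proof (Hhom (fun i => g i + t * w i)) as H. unfold F. lra. }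
  exists S, g. repeat split; auto.
  (* Positivity of [S]: on the indicator of index [0], the resonance [0 + 0 = 0] alone gives the
     form a value at least [1]. *)
  + pose proof (Hhom (fun i => indic (i =? 0)%nat)) as H.
    assert (H1 : 1 <= quadrilin K (fun i => indic (i =? 0)%nat) (fun i => indic (i =? 0)%nat)
      (fun i => indic (i =? 0)%nat) (fun i => indic (i =? 0)%nat)).
    { rewrite quadrilin_expand.
      assert (Hpos : forall a b c d, 0 <= indic (a + c =? b + d)%nat * (indic (a =? 0)%nat * indic (b =? 0)%nat *
         indic (c =? 0)%nat * indic (d =? 0)%nat)).
      { intros. repeat apply Rmult_le_pos; apply indic_nonneg. }
      eapply Rle_trans; [| apply (fsum_term_le K _ 0); auto].
      2:{ intros. repeat (apply fsum_nonneg; intros). apply Hpos. }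
      eapply Rle_trans; [| apply (fsum_term_le K _ 0); auto].
      2:{ intros. repeat (apply fsum_nonneg; intros). apply Hpos. }
      eapply Rle_trans; [| apply (fsum_term_le K _ 0); auto].
      2:{ intros. repeat (apply fsum_nonneg; intros). apply Hpos. }
      eapply Rle_trans; [| apply (fsum_term_le K _ 0); auto].
      simpl. lra. }
    pose proof (pow2_ge_0 (wnorm K M (fun i => indic (i =? 0)%nat))). nra.
  + intros i. apply Rabs_pos.
Qed.

(** * Integrals over the line with an algebraic majorant *)

Definition wt (s x : R) : R := Rpower (1 + Rabs x) (- s).

(** The exact integral of [wt s] over [[A, +oo)] when [1 < s] and [0 <= A]. *)
Definition tail (s A : R) : R := Rpower (1 + A) (1 - s) / (s - 1).

Lemma ex_RInt_cont (f : R -> R) (a b : R) : (forall x, continuous f x) -> ex_RInt f a b.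
Proof. intros H. apply (@ex_RInt_continuous R_CompleteNormedModule). intros z _. apply H. Qed.

Lemma RInt_Chasles_cont (f : R -> R) (a b c : R) : (forall x, continuous f x) ->
  RInt f a b + RInt f b c = RInt f a c.
Proof. intros H. apply (RInt_Chasles f a b c); now apply ex_RInt_cont. Qed.

Section Weight.

Variables (s : R) (Hs : 1 < s).

Lemma wt_pos (x : R) : 0 < wt s x.
Proof. apply exp_pos. Qed.

Lemma wt_le1 (x : R) : wt s x <= 1.
Proof.
unfold wt. apply Rle_trans with (Rpower (1 + Rabs x) 0).
2:{ rewrite Rpower_O; [lra | pose proof (Rabs_pos x); lra]. }
apply Rle_Rpower; [pose proof (Rabs_pos x); lra | lra].
Qed.

Lemma wt_opp (x : R) : wt s (- x) = wt s x.
Proof. unfold wt. now rewrite Rabs_Ropp. Qed.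

Lemma continuous_wt (x : R) : continuous (wt s) x.
Proof.
unfold wt, Rpower.
apply (continuous_comp (fun x => - s * ln (1 + Rabs x)) exp); [| apply continuous_exp].
apply (continuous_mult (fun _ => - s) (fun x => ln (1 + Rabs x))); [apply continuous_const |].
apply (continuous_comp (fun x => 1 + Rabs x) ln).
- apply (continuous_plus (fun _ => 1) Rabs); [apply continuous_const | apply continuous_Rabs].
- apply continuous_ln. pose proof (Rabs_pos x). lra.
Qed.

(** Makes [wt s] comparable with its values at distance at most [1], so that Riemann sums of mesh at
    most [1] are controlled by the integral. *)
Lemma wt_le_shift (x y : R) : Rabs (x - y) <= 1 -> wt s x <= Rpower 2 s * wt s y.
Proof.
intros H. unfold wt.
assert (Hx := Rabs_pos x). assert (Hy := Rabs_pos y).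
assert (H1 : 1 + Rabs y <= 2 * (1 + Rabs x)).
{ pose proof (Rabs_triang x (y - x)) as H'. replace (x + (y - x)) with y in H' by ring.
  rewrite Rabs_minus_sym in H'. lra. }
rewrite !Rpower_Ropp.
apply (Rmult_le_reg_l (Rpower (1 + Rabs x) s)); [apply exp_pos |].
rewrite Rinv_r by (apply Rgt_not_eq, exp_pos).
apply (Rmult_le_reg_r (Rpower (1 + Rabs y) s)); [apply exp_pos |].
rewrite Rmult_1_l.
replace (Rpower (1 + Rabs x) s * (Rpower 2 s * / Rpower (1 + Rabs y) s) * Rpower (1 + Rabs y) s)
  with (Rpower 2 s * Rpower (1 + Rabs x) s).
2:{ field. apply Rgt_not_eq, exp_pos. }
rewrite Rpower_mult_distr by lra. apply Rle_Rpower_l; lra.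
Qed.

Lemma tail_pos (A : R) : 0 < tail s A.
Proof. apply Rdiv_lt_0_compat; [apply exp_pos | lra]. Qed.

Lemma tail_decr (A B : R) : 0 <= A <= B -> tail s B <= tail s A.
Proof.
intros H. unfold tail, Rdiv. apply Rmult_le_compat_r; [left; apply Rinv_0_lt_compat; lra |].
replace (1 - s) with (- (s - 1)) by ring. rewrite !Rpower_Ropp.
apply Rinv_le_contravar; [apply exp_pos |]. apply Rle_Rpower_l; lra.
Qed.

Lemma tail_small (e : R) : 0 < e -> exists A, 0 <= A /\ tail s A < e.
Proof.
intros He. pose (X := Rmax 1 (Rpower (e * (s - 1) / 2) (/ (1 - s)))).
assert (HX : 1 <= X) by apply Rmax_l.
exists (X - 1). split; [lra |]. unfold tail. replace (1 + (X - 1)) with X by ring.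
assert (Hp : 0 < e * (s - 1) / 2) by (apply Rdiv_lt_0_compat; [apply Rmult_lt_0_compat; lra | lra]).
assert (H : Rpower X (1 - s) <= e * (s - 1) / 2).
{ replace (1 - s) with (- (s - 1)) at 1 by ring. rewrite Rpower_Ropp.
  replace (e * (s - 1) / 2) with (/ Rpower (Rpower (e * (s - 1) / 2) (/ (1 - s))) (s - 1)).
  - apply Rinv_le_contravar; [apply exp_pos |]. apply Rle_Rpower_l; [lra |].
    split; [apply exp_pos | apply Rmax_r].
  - rewrite Rpower_mult. replace (/ (1 - s) * (s - 1)) with (-1) by (field; lra).
    replace (-1) with (- (1)) by ring. rewrite Rpower_Ropp, Rpower_1 by exact Hp.
    rewrite Rinv_inv. reflexivity. }
apply (Rmult_lt_reg_r (s - 1)); [lra |]. unfold Rdiv. rewrite Rmult_assoc, Rinv_l by lra.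
rewrite Rmult_1_r. eapply Rle_lt_trans; [exact H |].
assert (0 < e * (s - 1)) by (apply Rmult_lt_0_compat; lra). lra.
Qed.

Lemma RInt_wt_pos (a b : R) : 0 <= a <= b -> RInt (wt s) a b = tail s a - tail s b.
Proof.
intros Hab. replace (tail s a - tail s b) with (minus (- tail s b) (- tail s a)) by (unfold minus, plus, opp; simpl; ring).
apply is_RInt_unique.
apply (is_RInt_ext (fun x => Rpower (1 + x) (- s))).
{ intros x Hx. rewrite Rmin_left, Rmax_right in Hx by lra. unfold wt. rewrite Rabs_pos_eq; [reflexivity | lra]. }
apply (is_RInt_derive (fun x => - tail s x) (fun x => Rpower (1 + x) (- s))).
- intros x Hx. rewrite Rmin_left, Rmax_right in Hx by lra. unfold tail, Rpower. auto_derive; [lra |].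
  replace (- s * ln (1 + x)) with ((1 - s) * ln (1 + x) + - ln (1 + x)) by ring.
  rewrite (exp_plus ((1 - s) * ln (1 + x)) (- ln (1 + x))), exp_Ropp, exp_ln by lra.
  field. lra.
- intros x Hx. rewrite Rmin_left, Rmax_right in Hx by lra. unfold Rpower.
  apply (@ex_derive_continuous R_AbsRing R_NormedModule). auto_derive. lra.
Qed.

Lemma RInt_wt_tail (A a b : R) : 0 <= A <= a -> a <= b -> RInt (wt s) a b <= tail s A.
Proof.
intros H H'. rewrite RInt_wt_pos by lra. pose proof (tail_pos b). pose proof (tail_decr A a H). lra.
Qed.

Lemma RInt_opp_var (f : R -> R) (a b : R) : (forall x, continuous f x) ->
  RInt f a b = RInt (fun x => f (- x)) (- b) (- a).
Proof.
intros Hf. symmetry. apply is_RInt_unique.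
assert (H : is_RInt f (- - b) (- - a) (- RInt f a b)).
{ rewrite !Ropp_involutive. apply (is_RInt_swap f b a (RInt f a b)).
  apply (@RInt_correct R_CompleteNormedModule), ex_RInt_cont, Hf. }
apply is_RInt_comp_opp, is_RInt_opp in H. rewrite <- (Ropp_involutive (RInt f a b)).
refine (is_RInt_ext _ _ _ _ _ _ H). intros x _. apply Ropp_involutive.
Qed.

Lemma RInt_wt_tail_neg (A a b : R) : 0 <= A -> a <= b <= - A -> RInt (wt s) a b <= tail s A.
Proof.
intros H H'. rewrite RInt_opp_var by apply continuous_wt.
rewrite (RInt_ext _ (wt s)) by (intros; apply wt_opp). apply RInt_wt_tail; lra.
Qed.

Lemma RInt_wt_bound (a b : R) : a <= b -> RInt (wt s) a b <= 2 * tail s 0.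
Proof.
intros Hab.
pose proof (tail_pos 0).
destruct (Rle_dec 0 a) as [Ha | Ha]; [pose proof (RInt_wt_tail 0 a b); lra |].
destruct (Rle_dec b 0) as [Hb | Hb]; [pose proof (RInt_wt_tail_neg 0 a b); lra |].
rewrite <- (RInt_Chasles_cont _ a 0 b) by apply continuous_wt.
pose proof (RInt_wt_tail 0 0 b). pose proof (RInt_wt_tail_neg 0 a 0). lra.
Qed.

Definition dominated (C : R) (f : R -> R) : Prop :=
  (forall x, continuous f x) /\ (forall x, Rabs (f x) <= C * wt s x).

Lemma dominated_const_pos (C : R) (f : R -> R) : dominated C f -> 0 <= C.
Proof.
intros [_ H]. specialize (H 0). pose proof (Rabs_pos (f 0)). pose proof (wt_pos 0). nra.
Qed.

Lemma RInt_abs_le (f : R -> R) (C a b : R) : dominated C f -> a <= b ->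
  Rabs (RInt f a b) <= C * RInt (wt s) a b.
Proof.
intros [Hc Hb] Hab.
change (C * RInt (wt s) a b) with (scal C (RInt (wt s) a b)).
rewrite <- RInt_scal by (apply ex_RInt_cont, continuous_wt).
apply (norm_RInt_le f (fun x => scal C (wt s x)) a b); auto.
- apply (@RInt_correct R_CompleteNormedModule), ex_RInt_cont, Hc.
- apply (@RInt_correct R_CompleteNormedModule), ex_RInt_cont. intros x.
  apply (continuous_scal_r C (wt s)), continuous_wt.
Qed.

Lemma dominated_window (f : R -> R) (C A a b : R) : dominated C f -> 0 <= A -> a <= - A -> A <= b ->
  Rabs (RInt f a b - RInt f (- A) A) <= 2 * C * tail s A.
Proof.
intros Hf HA Ha Hb. pose proof (dominated_const_pos _ _ Hf) as HC. destruct Hf as [Hc Hd].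
rewrite <- (RInt_Chasles_cont f a (- A) b Hc), <- (RInt_Chasles_cont f (- A) A b Hc).
replace (RInt f a (- A) + (RInt f (- A) A + RInt f A b) - RInt f (- A) A)
  with (RInt f a (- A) + RInt f A b) by ring.
eapply Rle_trans; [apply Rabs_triang |].
pose proof (RInt_abs_le f C a (- A) (conj Hc Hd) Ha).
pose proof (RInt_abs_le f C A b (conj Hc Hd) Hb).
pose proof (RInt_wt_tail A A b ltac:(lra) Hb).
pose proof (RInt_wt_tail_neg A a (- A) HA ltac:(lra)).
nra.
Qed.

(** Replaces the filters in the definition of the improper integral by an epsilon condition; the two
    endpoints go to infinity independently. *)
Lemma is_RInt_gen_window (f : R -> R) (l : R) :
  (forall a b, ex_RInt f a b) ->
  (forall e, 0 < e -> exists A, forall a b, a < - A -> A < b -> Rabs (RInt f a b - l) < e) ->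
  is_RInt_gen f minf pinf l.
Proof.
intros Hex Hl P [e He].
destruct (Hl e (cond_pos e)) as [A HA].
exists (fun a => a < - A) (fun b => A < b).
- exists (- A). auto.
- exists A. auto.
- intros a b Ha Hb. exists (RInt f a b). split; [apply (@RInt_correct R_CompleteNormedModule), Hex |].
  apply He. apply HA; auto.
Qed.

Lemma is_RInt_gen_window_inv (f : R -> R) (l e : R) :
  is_RInt_gen f minf pinf l -> 0 < e ->
  exists A, 0 <= A /\ forall a b, a < - A -> A < b -> Rabs (RInt f a b - l) < e.
Proof.
intros H He.
destruct (H (fun y => Rabs (y - l) < e)) as [P Q [p HP] [q HQ] HPQ].
{ exists (mkposreal e He). intros y Hy. exact Hy. }
exists (Rmax 0 (Rmax (- p) q)).
pose proof (Rmax_l (- p) q). pose proof (Rmax_r (- p) q).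
pose proof (Rmax_l 0 (Rmax (- p) q)). pose proof (Rmax_r 0 (Rmax (- p) q)).
split; [lra |]. intros a b Ha Hb.
destruct (HPQ a b) as [y [Hy1 Hy2]]; [apply HP; lra | apply HQ; lra |].
simpl in Hy1. now rewrite (is_RInt_unique _ _ _ _ Hy1).
Qed.

(** The integrals over [[-n, n]] are Cauchy by [dominated_window]. The explicit truncation error is
    kept in the conclusion because it depends only on [C] and [s]: the exchange of limit and
    integral uses it uniformly over a family. *)
Lemma dominated_integral (f : R -> R) (C : R) : dominated C f ->
  exists l, is_RInt_gen f minf pinf l /\
    forall A, 0 <= A -> Rabs (l - RInt f (- A) A) <= 2 * C * tail s A.
Proof.
intros Hf. pose proof (dominated_const_pos _ _ Hf) as HC.
assert (Hcau : Cauchy_crit (fun n => RInt f (- INR n) (INR n))).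
(* Two windows cost [2 * C * tail s A] each; the extra [4] covers the case [C = 0]. *)
{ intros e He. destruct (tail_small (e / (4 * C + 4))) as [A [HA1 HA2]].
  { apply Rdiv_lt_0_compat; lra. }
  assert (HA3 : 4 * C * tail s A < e).
  { pose proof (tail_pos A).
    apply (Rmult_lt_compat_r (4 * C + 4)) in HA2; [| lra].
    unfold Rdiv in HA2. rewrite Rmult_assoc, Rinv_l in HA2 by lra. nra. }
  destruct (INR_unbounded A) as [N HN].
  exists N. intros n p Hn Hp. unfold Rdist.
  apply le_INR in Hn. apply le_INR in Hp.
  pose proof (dominated_window f C A (- INR n) (INR n) Hf HA1 ltac:(lra) ltac:(lra)).
  pose proof (dominated_window f C A (- INR p) (INR p) Hf HA1 ltac:(lra) ltac:(lra)).
  replace (RInt f (- INR n) (INR n) - RInt f (- INR p) (INR p)) with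
    ((RInt f (- INR n) (INR n) - RInt f (- A) A) - (RInt f (- INR p) (INR p) - RInt f (- A) A)) by ring.
  eapply Rle_lt_trans; [apply Rabs_triang |]. rewrite Rabs_Ropp. lra. }
destruct (Rcomplete.R_complete _ Hcau) as [l Hl]. exists l.
assert (HT : forall A, 0 <= A -> Rabs (l - RInt f (- A) A) <= 2 * C * tail s A).
{ intros A HA. apply Rnot_lt_le. intros Hlt.
  destruct (Hl (Rabs (l - RInt f (- A) A) - 2 * C * tail s A) ltac:(lra)) as [N HN].
  destruct (INR_unbounded A) as [N' HN']. specialize (HN (max N N') ltac:(lia)).
  assert (INR N' <= INR (max N N')) by (apply le_INR; lia).
  pose proof (dominated_window f C A (- INR (max N N')) (INR (max N N')) Hf HA ltac:(lra) ltac:(lra)) as H1.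
  unfold Rdist in HN.
  pose proof (Rabs_triang (l - RInt f (- INR (max N N')) (INR (max N N')))
    (RInt f (- INR (max N N')) (INR (max N N')) - RInt f (- A) A)) as H2.
  rewrite (Rabs_minus_sym l (RInt f (- INR (max N N')) (INR (max N N')))) in H2.
  replace (l - RInt f (- INR (max N N')) (INR (max N N')) +
    (RInt f (- INR (max N N')) (INR (max N N')) - RInt f (- A) A)) with (l - RInt f (- A) A) in H2 by ring.
  lra. }
split; [| exact HT].
apply is_RInt_gen_window; [intros; apply ex_RInt_cont, Hf |].
intros e He. destruct (tail_small (e / (4 * C + 4))) as [A [HA1 HA2]].
{ apply Rdiv_lt_0_compat; lra. }
assert (HA3 : 4 * C * tail s A < e).
{ pose proof (tail_pos A).
  apply (Rmult_lt_compat_r (4 * C + 4)) in HA2; [| lra].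
  unfold Rdiv in HA2. rewrite Rmult_assoc, Rinv_l in HA2 by lra. nra. }
exists A. intros a b Ha Hb.
pose proof (dominated_window f C A a b Hf HA1 ltac:(lra) ltac:(lra)) as H1.
specialize (HT A HA1). rewrite Rabs_minus_sym in HT.
replace (RInt f a b - l) with ((RInt f a b - RInt f (- A) A) + (RInt f (- A) A - l)) by ring.
eapply Rle_lt_trans; [apply Rabs_triang |]. lra.
Qed.

End Weight.

Lemma is_RInt_gen_le (f g : R -> R) (lf lg : R) :
  (forall a b, ex_RInt f a b) -> (forall a b, ex_RInt g a b) -> (forall x, f x <= g x) ->
  is_RInt_gen f minf pinf lf -> is_RInt_gen g minf pinf lg -> lf <= lg.
Proof.
intros Hf Hg Hfg If Ig. apply Rnot_lt_le. intros Hlt.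
destruct (is_RInt_gen_window_inv f lf ((lf - lg) / 2) If ltac:(lra)) as [A [HA HA']].
destruct (is_RInt_gen_window_inv g lg ((lf - lg) / 2) Ig ltac:(lra)) as [B [HB HB']].
pose (D := A + B + 1).
specialize (HA' (- D) D ltac:(unfold D; lra) ltac:(unfold D; lra)).
specialize (HB' (- D) D ltac:(unfold D; lra) ltac:(unfold D; lra)).
assert (RInt f (- D) D <= RInt g (- D) D).
{ apply RInt_le; auto. unfold D; lra. }
apply Rabs_def2 in HA'. apply Rabs_def2 in HB'. lra.
Qed.

Lemma is_RInt_gen_abs_le (f g : R -> R) (lf lg : R) :
  (forall x, continuous f x) -> (forall x, continuous g x) -> (forall x, Rabs (f x) <= g x) ->
  is_RInt_gen f minf pinf lf -> is_RInt_gen g minf pinf lg -> Rabs lf <= lg.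
Proof.
intros Hf Hg Hfg If Ig. apply Rabs_le. split.
- assert (- lg <= lf); [| lra].
  apply (is_RInt_gen_le (fun x => - g x) f); auto; try (intros; apply ex_RInt_cont; auto).
  + intros x. apply (continuous_opp g), Hg.
  + intros x. specialize (Hfg x). apply Rabs_le_between in Hfg. lra.
  + apply (is_RInt_gen_opp g lg); exact Ig.
- apply (is_RInt_gen_le f g); auto; try (intros; apply ex_RInt_cont; auto).
  intros x. specialize (Hfg x). apply Rabs_le_between in Hfg. lra.
Qed.

(** * Uniform bounds for the discrete solutions *)

(** With [N = S n] the spacing is [1 / N], and [3 N^2] nodes lie on each side of the index [mid n],
    which carries the frequency [0]. The frequencies fill [[-3 N, 3 N]] and are multiples of
    [1 / N], so all exponentials share the period [2 PI N]. Shifting the indices into [nat] turns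
    resonance into [a + c = b + d], free of subtraction. *)
Definition mesh (n : nat) : R := / INR (S n).
Definition mid (n : nat) : nat := (3 * S n * S n)%nat.
Definition len (n : nat) : nat := (2 * mid n + 1)%nat.
Definition node (n a : nat) : R := (INR a - INR (mid n)) * mesh n.

Lemma mesh_pos (n : nat) : 0 < mesh n.
Proof. apply Rinv_0_lt_compat, lt_0_INR. lia. Qed.

Lemma mesh_le1 (n : nat) : mesh n <= 1.
Proof.
unfold mesh. rewrite <- Rinv_1. apply Rinv_le_contravar; [lra |].
replace 1 with (INR 1) by reflexivity. apply le_INR. lia.
Qed.

Lemma mesh_mult (n : nat) : mesh n * INR (S n) = 1.
Proof. unfold mesh. apply Rinv_l. apply not_0_INR. lia. Qed.

Lemma node_step (n a : nat) : node n (S a) = node n a + mesh n.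
Proof. unfold node. rewrite S_INR. ring. Qed.

Lemma node_resonant (n a b c d : nat) : (a + c = b + d)%nat ->
  node n a - node n b + node n c = node n d.
Proof.
intros H. unfold node. apply (f_equal INR) in H. rewrite !plus_INR in H.
replace (INR a) with (INR b + INR d - INR c) by lra. ring.
Qed.

(** A Riemann sum: on each cell, of length at most [1], [wt_le_shift] bounds the left endpoint value
    by values of the integrand. The bound is the same for all [n]. *)
Lemma sum_wt_le (s : R) (n : nat) : 1 < s ->
  mesh n * fsum (len n) (fun a => wt s (node n a)) <= Rpower 2 s * (2 * tail s 0).
Proof.
intros Hs. pose proof (mesh_pos n) as Hh. pose proof (mesh_le1 n) as Hh1.
assert (Hmono : forall p, node n 0 <= node n p).
{ induction p as [| p IH]; [lra | rewrite node_step; lra]. }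
assert (H : forall p, mesh n * fsum p (fun a => wt s (node n a)) <= Rpower 2 s * RInt (wt s) (node n 0) (node n p)).
{ induction p as [| p IH].
  - simpl. rewrite RInt_point. unfold zero; simpl. lra.
  - cbn [fsum].
    rewrite <- (RInt_Chasles_cont (wt s) _ (node n p)) by (intros; apply continuous_wt).
    assert (H1 : mesh n * wt s (node n p) <= Rpower 2 s * RInt (wt s) (node n p) (node n (S p))).
    { change (Rpower 2 s * RInt (wt s) (node n p) (node n (S p))) with
        (scal (Rpower 2 s) (RInt (wt s) (node n p) (node n (S p)))).
      rewrite <- RInt_scal by (apply ex_RInt_cont; intros; apply continuous_wt).
      replace (mesh n * wt s (node n p)) with (RInt (fun _ => wt s (node n p)) (node n p) (node n (S p))).
      2:{ rewrite RInt_const, node_step. unfold scal; simpl; unfold mult; simpl. ring. }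
      apply RInt_le.
      - rewrite node_step; lra.
      - apply ex_RInt_const.
      - apply ex_RInt_cont. intros x. apply (continuous_scal_r (Rpower 2 s) (wt s)), continuous_wt.
      - intros x Hx. rewrite node_step in Hx. apply wt_le_shift; [lra |].
        apply Rabs_le. lra. }
    lra. }
eapply Rle_trans; [apply H |]. apply Rmult_le_compat_l; [left; apply exp_pos |].
apply RInt_wt_bound; auto.
Qed.

Lemma fsum_indic_interval (K lo l : nat) : (lo + l <= K)%nat ->
  fsum K (fun a => indic ((lo <=? a)%nat && (a <? lo + l)%nat)) = INR l.
Proof.
intros H.
assert (G : forall p, fsum p (fun a => indic ((lo <=? a)%nat && (a <? lo + l)%nat)) = INR (min (p - lo) l)).
{ induction p as [| p IH]; [reflexivity |]. cbn [fsum]. rewrite IH.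
  destruct (Nat.leb_spec lo p); destruct (Nat.ltb_spec p (lo + l)); simpl indic.
  - replace (min (S p - lo) l) with (S (min (p - lo) l)) by lia. rewrite S_INR. ring.
  - replace (min (S p - lo) l) with (min (p - lo) l) by lia. ring.
  - replace (min (S p - lo) l) with (min (p - lo) l) by lia. ring.
  - replace (min (S p - lo) l) with (min (p - lo) l) by lia. ring. }
rewrite G. f_equal. lia.
Qed.

(** * Bounds on the maximisers that do not depend on the mesh *)

Section DiscreteSolutions.

Variables (s : R) (Hs : 1 < s) (Hs2 : s <= 2) (m : R -> R) (c mmax : R).
Hypothesis (Hc : 0 < c).
Hypothesis (Hm : forall x, c <= m x * wt s x).
Hypothesis (Hmmax : forall x, Rabs x <= 3 -> m x <= mmax).

Lemma symbol_ge (x : R) : c <= m x.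
Proof.
pose proof (Hm x). pose proof (wt_pos s x). pose proof (wt_le1 s Hs x).
assert (0 < m x). { apply (Rmult_lt_reg_r (wt s x)); lra. } nra.
Qed.

(** Since [s > 1], the weight [wt s] absorbs one power of [1 + Rabs x]. This power is the gain in
    each step of the moment bootstrap. *)
Lemma symbol_ge_lin (x : R) : c * (1 + Rabs x) <= m x.
Proof.
pose proof (Hm x) as H. pose proof (symbol_ge x). pose proof (Rabs_pos x).
assert (Hw : wt s x * (1 + Rabs x) <= 1).
{ unfold wt. rewrite <- (Rpower_1 (1 + Rabs x)) at 2 by lra. rewrite <- Rpower_plus.
  apply Rle_trans with (Rpower (1 + Rabs x) 0); [apply Rle_Rpower; lra | rewrite Rpower_O; lra]. }
apply Rle_trans with (m x * wt s x * (1 + Rabs x)).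
- apply Rmult_le_compat_r; lra.
- rewrite Rmult_assoc. rewrite <- (Rmult_1_r (m x)) at 2. apply Rmult_le_compat_l; lra.
Qed.

(** The test vector [w] is the indicator of the frequencies in [[-3, 3]]. When the frequencies of
    [a], [b], [d] lie in [[-1, 1)], the resonant one, of index [b + d - a], lies in [[-3, 3]]; so
    the form is at least [(2 N)^3] with [N = S n], and [8] is [(2 N h)^3]. *)
Lemma max_value_lower_bound (n : nat) (V : R) :
  (forall w, quadrilin (len n) w w w w <= V * wnorm (len n) (fun a => mesh n * m (node n a)) w ^ 2) ->
  8 / (7 * mmax) ^ 2 <= mesh n ^ 3 * V.
Proof.
intros HV.
assert (Hmm : c <= mmax).
{ eapply Rle_trans; [apply (symbol_ge 0) |]. apply Hmmax. rewrite Rabs_R0; lra. }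
pose (N := S n).
assert (HN : (1 <= N)%nat) by (unfold N; lia).
assert (HmidN : (3 * N <= mid n)%nat) by (unfold mid, N; nia).
pose (w := fun a => indic ((mid n - 3 * N <=? a)%nat && (a <? mid n - 3 * N + (6 * N + 1))%nat)).
pose (v := fun a => indic ((mid n - N <=? a)%nat && (a <? mid n - N + 2 * N)%nat)).
assert (Hh := mesh_pos n). assert (HhN := mesh_mult n). fold N in HhN.
assert (HNr : 1 <= INR N) by (replace 1 with (INR 1) by reflexivity; now apply le_INR).
(* The support has [6 N + 1] nodes, and [h (6 N + 1) <= 7]. *)
assert (Hw1 : wnorm (len n) (fun a => mesh n * m (node n a)) w <= 7 * mmax).
{ unfold wnorm. apply Rle_trans with (fsum (len n) (fun a => (mesh n * mmax) * w a)).
  - apply fsum_le. intros a Ha. unfold w.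
    destruct (Nat.leb_spec (mid n - 3 * N) a); destruct (Nat.ltb_spec a (mid n - 3 * N + (6 * N + 1)));
      simpl; try lra.
    rewrite !Rmult_1_r. apply Rmult_le_compat_l; [lra |]. apply Hmmax.
    unfold node. rewrite Rabs_mult, (Rabs_pos_eq (mesh n)) by lra.
    apply Rle_trans with ((3 * INR N) * mesh n); [| nra].
    apply Rmult_le_compat_r; [lra |]. apply Rabs_le.
    replace (3 * INR N) with (INR (3 * N)) by (rewrite mult_INR; simpl; ring).
    split.
    + assert (INR (mid n) <= INR a + INR (3 * N)) by (rewrite <- plus_INR; apply le_INR; lia). lra.
    + assert (INR a <= INR (mid n) + INR (3 * N)) by (rewrite <- plus_INR; apply le_INR; lia). lra.
  - rewrite fsum_scal. unfold w. rewrite fsum_indic_interval by (unfold len; lia).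
    replace (INR (6 * N + 1)) with (6 * INR N + 1) by (rewrite plus_INR, mult_INR; simpl; ring).
    replace (mesh n * mmax * (6 * INR N + 1)) with (mmax * (6 * (mesh n * INR N) + mesh n)) by ring.
    rewrite HhN. pose proof (mesh_le1 n). nra. }
assert (Hw0 : 0 <= wnorm (len n) (fun a => mesh n * m (node n a)) w).
{ apply fsum_nonneg. intros a _. pose proof (symbol_ge (node n a)).
  apply Rmult_le_pos; [apply Rmult_le_pos; lra | apply pow2_ge_0]. }
assert (HF : (2 * INR N) ^ 3 <= quadrilin (len n) w w w w).
{ assert (Hv : fsum (len n) v = 2 * INR N).
  { unfold v. rewrite fsum_indic_interval by (unfold len; lia). rewrite mult_INR. simpl. ring. }
  rewrite quadrilin_expand.
  apply Rle_trans with (fsum (len n) (fun d => fsum (len n) (fun a => fsum (len n) (fun b => v d * v a * v b)))).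
  - apply Req_le. rewrite <- Hv. symmetry.
    transitivity (fsum (len n) (fun d => v d * (fsum (len n) v * fsum (len n) v))).
    + apply fsum_ext; intros d _.
      rewrite <- (fsum_scal_r (len n) (fsum (len n) v) v), <- fsum_scal. apply fsum_ext; intros a _.
      rewrite fsum_scal. ring.
    + rewrite fsum_scal_r. ring.
  - apply fsum_le; intros d Hd; apply fsum_le; intros a Ha; apply fsum_le; intros b Hb.
    assert (Hpos : forall x, 0 <= w x) by (intros; apply indic_nonneg).
    assert (Hgen : forall x, 0 <= indic (a + x =? b + d)%nat * (w a * w b * w x * w d)).
    { intros x. repeat apply Rmult_le_pos; auto; apply indic_nonneg. }
    assert (Hin : forall x, v x = 0 \/ (v x = 1 /\ w x = 1 /\ (mid n - N <= x)%nat /\ (x < mid n + N)%nat)).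
    { intros x. unfold v, w. destruct (Nat.leb_spec (mid n - N) x); destruct (Nat.ltb_spec x (mid n - N + 2 * N));
      cbn [andb indic]; auto.
      right. destruct (Nat.leb_spec (mid n - 3 * N) x); [| lia].
      destruct (Nat.ltb_spec x (mid n - 3 * N + (6 * N + 1))); [| lia].
      cbn [andb indic]. repeat split; auto; lia. }
    assert (Hsum0 : 0 <= fsum (len n) (fun x => indic (a + x =? b + d)%nat * (w a * w b * w x * w d))).
    { apply fsum_nonneg; auto. }
    destruct (Hin d) as [Ed | [Ed [Wd [Ld1 Ld2]]]]; [rewrite Ed, !Rmult_0_l; exact Hsum0 |].
    destruct (Hin a) as [Ea | [Ea [Wa [La1 La2]]]]; [rewrite Ea, Rmult_0_r, Rmult_0_l; exact Hsum0 |].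
    destruct (Hin b) as [Eb | [Eb [Wb [Lb1 Lb2]]]]; [rewrite Eb, Rmult_0_r; exact Hsum0 |].
    rewrite Ea, Eb, Ed.
    eapply Rle_trans; [| apply (fsum_term_le (len n) _ (b + d - a)); [intros i _; apply Hgen | unfold len; clear - Ld2 La1 Lb2 HmidN HN; lia]].
    rewrite Wa, Wb, Wd. replace (a + (b + d - a))%nat with (b + d)%nat by lia.
    rewrite Nat.eqb_refl. unfold w at 1.
    destruct (Nat.leb_spec (mid n - 3 * N) (b + d - a)); [| lia].
    destruct (Nat.ltb_spec (b + d - a) (mid n - 3 * N + (6 * N + 1))); [| lia]. simpl. lra. }
specialize (HV w).
assert (HVp : 0 <= V).
{ assert (0 < (2 * INR N) ^ 3) by (apply pow_lt; lra).
  pose proof (pow2_ge_0 (wnorm (len n) (fun a => mesh n * m (node n a)) w)). nra. }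
assert (HV2 : (2 * INR N) ^ 3 <= V * (7 * mmax) ^ 2).
{ eapply Rle_trans; [exact HF |]. eapply Rle_trans; [exact HV |].
  apply Rmult_le_compat_l; [exact HVp |]. apply pow_incr. lra. }
assert (H7 : 0 < (7 * mmax) ^ 2) by (apply pow_lt; lra).
apply (Rmult_le_reg_r ((7 * mmax) ^ 2)); [exact H7 |].
unfold Rdiv. rewrite Rmult_assoc, Rinv_l by lra.
replace (8 * 1) with (mesh n ^ 3 * (2 * INR N) ^ 3).
- rewrite Rmult_assoc. apply Rmult_le_compat_l; [apply pow_le; lra | exact HV2].
- replace (mesh n ^ 3 * (2 * INR N) ^ 3) with (8 * (mesh n * INR N) ^ 3) by ring. rewrite HhN. ring.
Qed.

(** On a resonance, [1 + |node d|] is at most the sum of the same quantities at [a], [b], [e], so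
    its power [j] can be charged to one of the three factors, at the cost [3 ^ j]. That factor is
    then taken in supremum and the two others in [l^1]; there are three such terms, hence [3 ^ S j].
    The linear growth of [m] supplies the extra power on the left. *)
Lemma moment_bootstrap (n : nat) (G : nat -> R) (j : nat) (D0 Cj : R) :
  (forall i, 0 <= G i) ->
  (forall d, (d < len n)%nat -> m (node n d) * G d = mesh n ^ 2 * trilin (len n) G G G d) ->
  mesh n * fsum (len n) G <= D0 ->
  (forall a, (a < len n)%nat -> (1 + Rabs (node n a)) ^ j * G a <= Cj) ->
  forall d, (d < len n)%nat -> (1 + Rabs (node n d)) ^ S j * G d <= 3 ^ S j * Cj * D0 ^ 2 / c.
Proof.
intros HG HEL HD HCj d Hd.
pose (X := fun a => 1 + Rabs (node n a)). pose (K := len n).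
pose (XG := fun a => X a ^ j * G a).
assert (HX : forall a, 1 <= X a) by (intros a; unfold X; pose proof (Rabs_pos (node n a)); lra).
assert (HXj : forall a, 0 <= X a ^ j) by (intros a; apply pow_le; pose proof (HX a); lra).
assert (HXG : forall a, 0 <= XG a) by (intros; apply Rmult_le_pos; auto).
assert (HS0 : 0 <= fsum K G) by (apply fsum_nonneg; auto).
pose proof (mesh_pos n) as Hh.
assert (Htri : X d ^ j * trilin K G G G d <= 3 ^ j * (3 * (Cj * fsum K G * fsum K G))).
{ apply Rle_trans with (3 ^ j * (trilin K XG G G d + trilin K G XG G d + trilin K G G XG d)).
  - unfold trilin. rewrite <- !fsum_plus, <- !fsum_scal.
    apply fsum_le; intros a _. rewrite <- !fsum_plus, <- !fsum_scal.
    apply fsum_le; intros b _. rewrite <- !fsum_plus, <- !fsum_scal.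
    apply fsum_le; intros e _.
    destruct (Nat.eqb_spec (a + e) (b + d)) as [E | E]; simpl indic; [| lra].
    assert (Hnode := node_resonant n a b e d E).
    assert (HXd : X d <= X a + X b + X e).
    { unfold X. rewrite <- Hnode. unfold Rminus.
      pose proof (Rabs_triang (node n a + - node n b) (node n e)).
      pose proof (Rabs_triang (node n a) (- node n b)). rewrite Rabs_Ropp in *. lra. }
    assert (Hpow : X d ^ j <= 3 ^ j * (X a ^ j + X b ^ j + X e ^ j)).
    { pose proof (HX a). pose proof (HX b). pose proof (HX e). pose proof (HX d).
      assert (Hmx : exists z, (z = a \/ z = b \/ z = e) /\ X d <= 3 * X z).
      { destruct (Rle_dec (X a) (X b)); destruct (Rle_dec (X b) (X e)); destruct (Rle_dec (X a) (X e)).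
        all: try (exists e; split; [tauto | lra]); try (exists b; split; [tauto | lra]);
             try (exists a; split; [tauto | lra]). }
      destruct Hmx as [z [Hz Hz']].
      apply Rle_trans with ((3 * X z) ^ j); [apply pow_incr; lra |]. rewrite Rpow_mult_distr.
      apply Rmult_le_compat_l; [apply pow_le; lra |].
      pose proof (HXj a). pose proof (HXj b). pose proof (HXj e).
      destruct Hz as [-> | [-> | ->]]; lra. }
    replace (3 ^ j * (1 * (XG a * G b * G e) + 1 * (G a * XG b * G e) + 1 * (G a * G b * XG e)))
      with (3 ^ j * (X a ^ j + X b ^ j + X e ^ j) * (G a * G b * G e)) by (unfold XG; ring).
    rewrite Rmult_1_l. apply Rmult_le_compat_r; [| exact Hpow].
    apply Rmult_le_pos; [apply Rmult_le_pos |]; auto.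
  - apply Rmult_le_compat_l; [apply pow_le; lra |].
    assert (Hb : forall i, (i < K)%nat -> 0 <= XG i <= Cj) by (intros i Hi; split; [auto | now apply HCj]).
    pose proof (trilin_le_fst K XG G G d Cj Hb HG HG).
    pose proof (trilin_le_snd K G XG G d Cj Hb HG HG).
    pose proof (trilin_le_thd K G G XG d Cj Hb HG HG). lra. }
specialize (HEL d Hd). fold K in HEL.
pose proof (symbol_ge_lin (node n d)) as Hlin. fold (X d) in Hlin.
assert (HCp : 0 <= Cj). { eapply Rle_trans; [apply (HXG d) |]. now apply HCj. }
assert (Hfin : c * (X d ^ S j * G d) <= 3 ^ S j * Cj * D0 ^ 2).
{ apply Rle_trans with (X d ^ j * (m (node n d) * G d)).
  - replace (c * (X d ^ S j * G d)) with (X d ^ j * (c * X d * G d)) by (simpl; ring).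
    apply Rmult_le_compat_l; [auto |]. now apply Rmult_le_compat_r.
  - rewrite HEL. apply Rle_trans with (mesh n ^ 2 * (3 ^ j * (3 * (Cj * fsum K G * fsum K G)))).
    + replace (X d ^ j * (mesh n ^ 2 * trilin K G G G d)) with (mesh n ^ 2 * (X d ^ j * trilin K G G G d)) by ring.
      apply Rmult_le_compat_l; [apply pow2_ge_0 | exact Htri].
    + replace (mesh n ^ 2 * (3 ^ j * (3 * (Cj * fsum K G * fsum K G))))
        with (3 ^ S j * Cj * (mesh n * fsum K G) ^ 2) by (simpl; ring).
      apply Rmult_le_compat_l.
      * apply Rmult_le_pos; [apply pow_le; lra | exact HCp].
      * apply pow_incr. split; [apply Rmult_le_pos; lra | exact HD]. }
apply (Rmult_le_reg_l c); [exact Hc |].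
replace (c * (3 ^ S j * Cj * D0 ^ 2 / c)) with (3 ^ S j * Cj * D0 ^ 2) by (field; lra).
exact Hfin.
Qed.

(** The maximiser [g] is rescaled to [G = b g] so that the multiplier becomes [1]. The lower bound
    on [h^3 V] bounds [b] from above, and all constants are fixed from [c], [mmax] and [s] before
    [n] is introduced. *)
Lemma discrete_solutions :
  exists (c1 : R) (Cs : nat -> R), 0 < c1 /\ forall n, exists G : nat -> R,
    (forall i, 0 <= G i) /\
    (forall d, (d < len n)%nat -> m (node n d) * G d = mesh n ^ 2 * trilin (len n) G G G d) /\
    c1 <= mesh n * fsum (len n) G /\
    (forall j, mesh n * fsum (len n) (fun a => (1 + Rabs (node n a)) ^ j * G a) <= Cs j) /\
    mesh n * fsum (len n) (fun a => (1 + Rabs (node n a)) ^ 2 * G a ^ 2) <= Cs 0%nat.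
Proof.
assert (Hmm : c <= mmax).
{ eapply Rle_trans; [apply (symbol_ge 0) |]. apply Hmmax. rewrite Rabs_R0; lra. }
pose (c0 := 8 / (7 * mmax) ^ 2).
assert (Hc0 : 0 < c0) by (apply Rdiv_lt_0_compat; [lra | apply pow_lt; lra]).
pose (b0 := / sqrt c0).
assert (Hsc0 : 0 < sqrt c0) by now apply sqrt_lt_R0.
assert (Hb0 : 0 < b0) by now apply Rinv_0_lt_compat.
pose (Cw := Rpower 2 s * (2 * tail s 0)).
(* [D0] bounds [h sum G], through [2 g <= m g^2 + 1 / m] and the summability of [1 / m]; [D2] bounds
   [h sum G^2], through [m >= c]. *)
pose (D0 := b0 * ((1 + Cw / c) / 2)). pose (D2 := b0 ^ 2 / c).
(* [P j] bounds [(1 + Rabs (node n a)) ^ j * G a] at every node. The base value comes from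
   [trilin_le_l2] inserted in the equation, the recursion is that of [moment_bootstrap]. *)
pose (P := fix P (j : nat) : R := match j with O => D2 * D0 / c | S j' => 3 ^ S j' * P j' * D0 ^ 2 / c end).
exists (sqrt c), (fun j => P (j + 2)%nat * Cw + P 2%nat * P 2%nat * Cw). split; [now apply sqrt_lt_R0 |].
intros n. pose (h := mesh n). pose (K := len n).
assert (Hh : 0 < h) by apply mesh_pos.
assert (Hmp : forall x, 0 < m x) by (intros x; pose proof (symbol_ge x); lra).
destruct (discrete_maximizer K (fun a => h * m (node n a))) as [V [g [HV [Hg [Hgn [HF HEL]]]]]].
{ unfold K, len. lia. }
{ intros i. apply Rmult_lt_0_compat; auto. }
pose proof (max_value_lower_bound n V HF) as HVlow. fold h c0 in HVlow.
pose (L := h ^ 3 * V).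
assert (HL : c0 <= L) by exact HVlow.
(* Replacing [g] by [b g] multiplies the linear side by [b] and the cubic side by [b^3]; the choice
   [b^2 L = 1] balances them. *)
pose (b := / sqrt L).
assert (HsL : 0 < sqrt L) by (apply sqrt_lt_R0; lra).
assert (Hb : 0 < b) by now apply Rinv_0_lt_compat.
assert (HbL : b ^ 2 * L = 1).
{ unfold b. rewrite <- (sqrt_sqrt L) at 2 by lra. field. lra. }
assert (Hbb0 : b <= b0).
{ apply Rinv_le_contravar; [exact Hsc0 |]. apply sqrt_le_1; lra. }
pose (G := fun a => b * g a).
assert (HG : forall i, 0 <= G i) by (intros i; apply Rmult_le_pos; [lra | auto]).
assert (HtriG : forall d, trilin K G G G d = b ^ 3 * trilin K g g g d).
{ intros d. unfold trilin. rewrite <- fsum_scal; apply fsum_ext; intros a _.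
  rewrite <- fsum_scal; apply fsum_ext; intros e _. rewrite <- fsum_scal; apply fsum_ext; intros f _.
  unfold G. ring. }
assert (HELG : forall d, (d < K)%nat -> m (node n d) * G d = h ^ 2 * trilin K G G G d).
{ intros d Hd. rewrite HtriG, HEL by exact Hd. unfold G.
  replace (h ^ 2 * (b ^ 3 * (V * (h * m (node n d)) * g d))) with ((b ^ 2 * L) * (m (node n d) * (b * g d)))
    by (unfold L; ring). rewrite HbL. ring. }
assert (Hgn' : h * fsum K (fun a => m (node n a) * g a ^ 2) = 1).
{ rewrite <- Hgn. unfold wnorm. rewrite <- fsum_scal. apply fsum_ext; intros a _. ring. }
assert (HCw0 : 0 <= Cw).
{ unfold Cw. apply Rmult_le_pos; [left; apply exp_pos | pose proof (tail_pos s Hs 0); lra]. }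
assert (Hgl1 : h * fsum K g <= (1 + Cw / c) / 2).
{ apply Rle_trans with (h * fsum K (fun a => / 2 * (m (node n a) * g a ^ 2) + / (2 * c) * wt s (node n a))).
  - apply Rmult_le_compat_l; [lra |]. apply fsum_le; intros a _.
    pose proof (Hm (node n a)) as H1. pose proof (Hmp (node n a)) as H2.
    assert (H3 : / m (node n a) <= / c * wt s (node n a)).
    { apply (Rmult_le_reg_l (c * m (node n a))); [apply Rmult_lt_0_compat; lra |].
      replace (c * m (node n a) * / m (node n a)) with c by (field; lra).
      replace (c * m (node n a) * (/ c * wt s (node n a))) with (m (node n a) * wt s (node n a)) by (field; lra).
      exact H1. }
    assert (H4 : 2 * g a <= m (node n a) * g a ^ 2 + / m (node n a)).
    { apply (Rmult_le_reg_l (m (node n a))); [lra |].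
      replace (m (node n a) * (m (node n a) * g a ^ 2 + / m (node n a)))
        with ((m (node n a) * g a) ^ 2 + 1) by (field; lra).
      pose proof (pow2_ge_0 (m (node n a) * g a - 1)). nra. }
    replace (/ (2 * c) * wt s (node n a)) with (/ 2 * (/ c * wt s (node n a))) by (field; lra). lra.
  - rewrite fsum_plus, !fsum_scal. rewrite Rmult_plus_distr_l.
    replace (h * (/ 2 * fsum K (fun i => m (node n i) * g i ^ 2))) with (/ 2 * (h * fsum K (fun i => m (node n i) * g i ^ 2))) by ring.
    rewrite Hgn'. pose proof (sum_wt_le s n Hs) as H. fold h K Cw in H.
    replace (h * (/ (2 * c) * fsum K (fun i => wt s (node n i)))) with (/ (2 * c) * (h * fsum K (fun i => wt s (node n i)))) by ring.
    assert (0 < / (2 * c)) by (apply Rinv_0_lt_compat; lra).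
    apply Rle_trans with (/ 2 * 1 + / (2 * c) * Cw); [apply Rplus_le_compat_l, Rmult_le_compat_l; lra |].
    apply Req_le. field. lra. }
assert (HGl1 : h * fsum K G <= D0).
{ unfold G. rewrite fsum_scal. replace (h * (b * fsum K g)) with (b * (h * fsum K g)) by ring.
  unfold D0. apply Rmult_le_compat; auto; [lra |].
  apply Rmult_le_pos; [lra |]. apply fsum_nonneg; auto. }
assert (HG2m : h * fsum K (fun a => m (node n a) * G a ^ 2) = b ^ 2).
{ rewrite <- (Rmult_1_r (b ^ 2)). rewrite <- Hgn'. rewrite <- !fsum_scal. apply fsum_ext; intros a _.
  unfold G. ring. }
assert (HG2c : c * (h * fsum K (fun a => G a ^ 2)) <= b ^ 2).
{ rewrite <- HG2m. replace (c * (h * fsum K (fun a => G a ^ 2))) with (h * (c * fsum K (fun a => G a ^ 2))) by ring.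
  apply Rmult_le_compat_l; [lra |]. rewrite <- fsum_scal. apply fsum_le; intros a _.
  apply Rmult_le_compat_r; [apply pow2_ge_0 | apply symbol_ge]. }
assert (HG2 : h * fsum K (fun a => G a ^ 2) <= D2).
{ unfold D2. apply (Rmult_le_reg_l c); [exact Hc |]. eapply Rle_trans; [exact HG2c |].
  replace (c * (b0 ^ 2 / c)) with (b0 ^ 2) by (field; lra). apply pow_incr. lra. }
assert (HGs0 : 0 <= h * fsum K G) by (apply Rmult_le_pos; [lra | apply fsum_nonneg; auto]).
assert (HG20 : 0 <= h * fsum K (fun a => G a ^ 2)).
{ apply Rmult_le_pos; [lra | apply fsum_nonneg; intros; apply pow2_ge_0]. }
assert (HT : forall d, h ^ 2 * trilin K G G G d <= (h * fsum K (fun a => G a ^ 2)) * (h * fsum K G)).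
{ intros d. replace ((h * fsum K (fun a => G a ^ 2)) * (h * fsum K G))
    with (h ^ 2 * (fsum K (fun a => G a ^ 2) * fsum K G)) by ring.
  apply Rmult_le_compat_l; [apply pow2_ge_0 |]. now apply trilin_le_l2. }
assert (HP : forall j a, (a < K)%nat -> (1 + Rabs (node n a)) ^ j * G a <= P j).
{ induction j as [| j IH]; intros a Ha.
  - simpl. rewrite Rmult_1_l. apply (Rmult_le_reg_l c); [exact Hc |].
    replace (c * (D2 * D0 / c)) with (D2 * D0) by (field; lra).
    apply Rle_trans with (m (node n a) * G a); [apply Rmult_le_compat_r; [auto | apply symbol_ge] |].
    rewrite HELG by exact Ha. eapply Rle_trans; [apply HT |]. apply Rmult_le_compat; auto.
  - apply (moment_bootstrap n G j D0 (P j)); auto. }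
assert (HPp : forall j, 0 <= P j).
{ intros j. eapply Rle_trans; [| apply (HP j 0%nat)].
  - apply Rmult_le_pos; [apply pow_le; pose proof (Rabs_pos (node n 0)); lra | auto].
  - unfold K, len; lia. }
(* Since [s <= 2], two additional moments turn a pointwise bound into the summable majorant
   [wt s]. *)
assert (Hwt2 : forall a, 1 <= (1 + Rabs (node n a)) ^ 2 * wt s (node n a)).
{ intros a. pose proof (Rabs_pos (node n a)). unfold wt.
  rewrite <- (Rpower_pow 2 (1 + Rabs (node n a))) by lra. rewrite <- Rpower_plus.
  apply Rle_trans with (Rpower (1 + Rabs (node n a)) 0); [rewrite Rpower_O; lra |].
  apply Rle_Rpower; simpl; lra. }
assert (HXwt : forall j a, (a < K)%nat -> (1 + Rabs (node n a)) ^ j * G a <= P (j + 2)%nat * wt s (node n a)).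
{ intros j a Ha. pose proof (Rabs_pos (node n a)). pose proof (wt_pos s (node n a)).
  apply Rle_trans with ((1 + Rabs (node n a)) ^ j * G a * ((1 + Rabs (node n a)) ^ 2 * wt s (node n a))).
  - rewrite <- (Rmult_1_r ((1 + Rabs (node n a)) ^ j * G a)) at 1. apply Rmult_le_compat_l; [| apply Hwt2].
    apply Rmult_le_pos; [apply pow_le; lra | auto].
  - replace ((1 + Rabs (node n a)) ^ j * G a * ((1 + Rabs (node n a)) ^ 2 * wt s (node n a)))
      with ((1 + Rabs (node n a)) ^ (j + 2) * G a * wt s (node n a)) by (rewrite pow_add; ring).
    apply Rmult_le_compat_r; [lra |]. now apply HP. }
assert (Hsumw : h * fsum K (fun a => wt s (node n a)) <= Cw) by (apply sum_wt_le; exact Hs).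
assert (HPP : 0 <= P 2%nat * P 2%nat * Cw) by (apply Rmult_le_pos; [apply Rmult_le_pos; apply HPp | exact HCw0]).
exists G. split; [exact HG |]. split; [exact HELG |]. split; [| split].
(* Write [|G|_2^2] for [h sum G^2] and [|G|_1] for [h sum G]. The equation multiplied by [G] and
   summed gives [b^2 <= |G|_2^2 |G|_1^2], while coercivity gives [c |G|_2^2 <= b^2]. Dividing by
   [|G|_2^2 > 0] leaves [c <= |G|_1^2]: [b] drops out, whence the lower bound [sqrt c]. *)
- assert (Hkey : b ^ 2 <= (h * fsum K (fun a => G a ^ 2)) * (h * fsum K G) ^ 2).
  { rewrite <- HG2m.
    apply Rle_trans with (h * fsum K (fun a => ((h * fsum K (fun a => G a ^ 2)) * (h * fsum K G)) * G a)).
    - apply Rmult_le_compat_l; [lra |]. apply fsum_le; intros a Ha.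
      replace (m (node n a) * G a ^ 2) with ((m (node n a) * G a) * G a) by ring.
      apply Rmult_le_compat_r; [auto |]. rewrite HELG by exact Ha. apply HT.
    - rewrite fsum_scal. apply Req_le. ring. }
  assert (Hb2 : 0 < b ^ 2) by (apply pow_lt; exact Hb).
  assert (Hpos : 0 < h * fsum K (fun a => G a ^ 2)).
  { destruct (Rle_lt_or_eq_dec _ _ HG20) as [H | H]; [exact H |]. rewrite <- H in Hkey. lra. }
  assert (Hc2 : c <= (h * fsum K G) ^ 2).
  { apply (Rmult_le_reg_l (h * fsum K (fun a => G a ^ 2))); [exact Hpos |]. lra. }
  fold h K. rewrite <- (sqrt_pow2 (h * fsum K G)) by exact HGs0. apply sqrt_le_1; lra || (apply pow2_ge_0) || auto.
- intros j. fold h K.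
  apply Rle_trans with (h * fsum K (fun a => P (j + 2)%nat * wt s (node n a))).
  + apply Rmult_le_compat_l; [lra |]. apply fsum_le; intros a Ha. now apply HXwt.
  + rewrite fsum_scal. pose proof (HPp (j + 2)%nat). nra.
- fold h K. apply Rle_trans with (h * fsum K (fun a => (P 2%nat * P 2%nat) * wt s (node n a))).
  + apply Rmult_le_compat_l; [lra |]. apply fsum_le; intros a Ha.
    replace ((1 + Rabs (node n a)) ^ 2 * G a ^ 2) with (((1 + Rabs (node n a)) ^ 2 * G a) * ((1 + Rabs (node n a)) ^ 0 * G a))
      by (rewrite pow_O; ring).
    rewrite (Rmult_assoc (P 2%nat) (P 2%nat)). pose proof (Rabs_pos (node n a)).
    apply Rmult_le_compat; [apply Rmult_le_pos; [apply pow_le; lra | auto] | apply Rmult_le_pos; [simpl; lra | auto] | now apply HP | now apply (HXwt 0%nat)].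
  + rewrite fsum_scal. pose proof (HPp 2%nat). simpl Nat.add. 
    assert (0 <= P 2%nat * P 2%nat) by (apply Rmult_le_pos; apply HPp).
    assert (0 <= P 2%nat * Cw) by (apply Rmult_le_pos; [apply HPp | exact HCw0]).
    nra.
Qed.

End DiscreteSolutions.

(** * Quantitative calculus *)

Lemma lipschitz_of_derive (f f1 : R -> R) (x y M : R) :
  (forall z, Rabs (z - x) <= Rabs (y - x) -> is_derive f z (f1 z)) ->
  (forall z, Rabs (z - x) <= Rabs (y - x) -> Rabs (f1 z) <= M) ->
  Rabs (f y - f x) <= M * Rabs (y - x).
Proof.
intros Hd Hb.
assert (Hz : forall z, Rmin x y <= z <= Rmax x y -> Rabs (z - x) <= Rabs (y - x)).
{ intros z. unfold Rmin, Rmax, Rabs. destruct (Rle_dec x y); repeat destruct Rcase_abs; lra. }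
destruct (MVT_gen f x y f1) as [z [Hz1 Hz2]].
- intros z Hz'. apply Hd, Hz. lra.
- intros z Hz'. apply derivable_continuous_pt. exists (f1 z). apply is_derive_Reals, Hd, Hz. lra.
- rewrite Hz2, Rabs_mult. apply Rmult_le_compat_r; [apply Rabs_pos |]. apply Hb, Hz, Hz1.
Qed.

(** Two mean value inequalities, which cost a factor [2] against the sharp constant [M / 2]. The
    hypotheses are local, so that powers can be treated away from their singularity at [0]. *)
Lemma taylor_order2 (f f1 f2 : R -> R) (x t M : R) :
  (forall z, Rabs (z - x) <= Rabs t -> is_derive f z (f1 z)) ->
  (forall z, Rabs (z - x) <= Rabs t -> is_derive f1 z (f2 z)) ->
  (forall z, Rabs (z - x) <= Rabs t -> Rabs (f2 z) <= M) ->
  Rabs (f (x + t) - f x - t * f1 x) <= M * t ^ 2.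
Proof.
intros H0 H1 H2.
assert (HM : 0 <= M).
{ eapply Rle_trans; [apply (Rabs_pos (f2 x)) | apply H2]. rewrite Rminus_diag, Rabs_R0. apply Rabs_pos. }
pose proof (lipschitz_of_derive (fun z => f z - (z - x) * f1 x) (fun z => f1 z - f1 x) x (x + t) (M * Rabs t)) as H.
simpl in H. replace (x + t - x) with t in H by ring.
replace (f (x + t) - f x - t * f1 x) with (f (x + t) - t * f1 x - (f x - (x - x) * f1 x)) by ring.
rewrite <- (pow2_abs t). replace (M * Rabs t ^ 2) with (M * Rabs t * Rabs t) by ring.
apply H.
- intros z Hz. apply (is_derive_minus f (fun z => (z - x) * f1 x)); [now apply H0 |].
  auto_derive; [trivial | ring].
- intros z Hz. eapply Rle_trans.
  + apply (lipschitz_of_derive f1 f2 x z M); intros y Hy; [apply H1 | apply H2]; lra.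
  + now apply Rmult_le_compat_l.
Qed.

Lemma second_difference_bound (f f1 f2 : R -> R) (x t M : R) :
  (forall z, Rabs (z - x) <= Rabs t -> is_derive f z (f1 z)) ->
  (forall z, Rabs (z - x) <= Rabs t -> is_derive f1 z (f2 z)) ->
  (forall z, Rabs (z - x) <= Rabs t -> Rabs (f2 z) <= M) ->
  Rabs (f (x + t) + f (x - t) - 2 * f x) <= 2 * M * t ^ 2.
Proof.
intros H0 H1 H2.
pose proof (taylor_order2 f f1 f2 x t M H0 H1 H2) as Hp.
pose proof (taylor_order2 f f1 f2 x (- t) M) as Hm. rewrite Rabs_Ropp in Hm.
specialize (Hm H0 H1 H2). replace ((- t) ^ 2) with (t ^ 2) in Hm by ring.
replace (f (x + t) + f (x - t) - 2 * f x) with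
  ((f (x + t) - f x - t * f1 x) + (f (x + - t) - f x - - t * f1 x)) by (unfold Rminus; ring).
eapply Rle_trans; [apply Rabs_triang | lra].
Qed.

(** The criterion by which limits and parameter integrals are differentiated: a quadratic remainder
    bound, uniform in the parameter, is preserved by limits and by integration. *)
Lemma is_derive_of_quadratic (f : R -> R) (x l C : R) :
  (forall t, Rabs t <= 1 -> Rabs (f (x + t) - f x - t * l) <= C * t ^ 2) -> is_derive f x l.
Proof.
intros H. apply is_derive_Reals. intros e He.
assert (HC : 0 <= C).
{ specialize (H 1 ltac:(rewrite Rabs_R1; lra)). pose proof (Rabs_pos (f (x + 1) - f x - 1 * l)). lra. }
assert (Hd0 : 0 < e / (C + 1)) by (apply Rdiv_lt_0_compat; lra).
assert (Hd : 0 < Rmin 1 (e / (C + 1))) by (apply Rmin_pos; lra).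
exists (mkposreal _ Hd). intros t Ht Ht1. simpl in Ht1.
assert (Ht' : Rabs t < e / (C + 1)) by (eapply Rlt_le_trans; [exact Ht1 | apply Rmin_r]).
assert (Htle : Rabs t <= 1) by (left; eapply Rlt_le_trans; [exact Ht1 | apply Rmin_l]).
replace ((f (x + t) - f x) / t - l) with ((f (x + t) - f x - t * l) / t) by (field; exact Ht).
unfold Rdiv. rewrite Rabs_mult, Rabs_inv.
assert (0 < Rabs t) by now apply Rabs_pos_lt.
apply (Rmult_lt_reg_r (Rabs t)); [assumption |]. rewrite Rmult_assoc, Rinv_l by lra. rewrite Rmult_1_r.
eapply Rle_lt_trans; [now apply H |]. rewrite <- (pow2_abs t).
assert ((C + 1) * Rabs t < e).
{ apply (Rmult_lt_compat_l (C + 1)) in Ht'; [| lra].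
  replace ((C + 1) * (e / (C + 1))) with e in Ht' by (field; lra). exact Ht'. }
nra.
Qed.

(** The derivative is written as a phase shift by [PI / 2], so that cosines with a phase form a
    family closed under differentiation. *)
Lemma cos_taylor (y u : R) : Rabs (cos (y + u) - cos y - u * cos (y + PI / 2)) <= u ^ 2.
Proof.
replace (cos (y + PI / 2)) with (- sin y).
2:{ rewrite cos_plus, cos_PI2, sin_PI2. ring. }
pose proof (taylor_order2 cos (fun z => - sin z) (fun z => - cos z) y u 1) as H.
rewrite <- (Rmult_1_l (u ^ 2)). apply H.
- intros z _. auto_derive; [trivial | ring].
- intros z _. auto_derive; [trivial | ring].
- intros z _. rewrite Rabs_Ropp. apply Rabs_le. apply COS_bound.
Qed.

Lemma cos_abs_le1 (y : R) : Rabs (cos y) <= 1.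
Proof. apply Rabs_le, COS_bound. Qed.

Lemma cos_lipschitz (x y : R) : Rabs (cos y - cos x) <= Rabs (y - x).
Proof.
rewrite <- (Rmult_1_l (Rabs (y - x))).
apply (lipschitz_of_derive cos (fun z => - sin z)).
- intros z _. auto_derive; [trivial | ring].
- intros z _. rewrite Rabs_Ropp. apply Rabs_le, SIN_bound.
Qed.

(** * Integrals along the ultrafilter *)

(** The final inequality is non-strict because only such bounds pass to ultrafilter limits. The
    modulus may depend on the point [x], not on [n]. *)
Definition equicont (f : nat -> R -> R) : Prop :=
  forall x e, 0 < e -> exists d, 0 < d /\ forall n y, Rabs (y - x) < d -> Rabs (f n y - f n x) <= e.

Lemma continuous_of_eps (f : R -> R) (x : R) :
  (forall e, 0 < e -> exists d, 0 < d /\ forall y, Rabs (y - x) < d -> Rabs (f y - f x) <= e) ->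
  continuous f x.
Proof.
intros H P [e He]. destruct (H (e / 2)) as [d [Hd Hd']]; [pose proof (cond_pos e); lra |].
exists (mkposreal d Hd). intros y Hy. apply He.
eapply Rle_lt_trans; [apply (Hd' y Hy) |]. pose proof (cond_pos e). simpl. lra.
Qed.

Lemma continuous_eps (f : R -> R) (x e : R) : continuous f x -> 0 < e ->
  exists d, 0 < d /\ forall y, Rabs (y - x) < d -> Rabs (f y - f x) < e.
Proof.
intros H He. destruct (H (fun y => Rabs (y - f x) < e)) as [d Hd].
{ exists (mkposreal e He). intros y Hy. exact Hy. }
exists d. split; [apply cond_pos | exact Hd].
Qed.

Lemma equicont_continuous (f : nat -> R -> R) (n : nat) (x : R) : equicont f -> continuous (f n) x.
Proof.
intros H. apply continuous_of_eps. intros e He. destruct (H x e He) as [d [Hd Hd']].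
exists d. split; auto.
Qed.

Section UlimIntegral.

Variables (U : (nat -> Prop) -> Prop) (HU : free_ultra U).

Lemma ulim_equicont_continuous (f : nat -> R -> R) (F : R -> R) (x : R) :
  equicont f -> (forall x, ulim U (fun n => f n x) (F x)) -> continuous F x.
Proof.
intros He HF. apply continuous_of_eps. intros e Hpe. destruct (He x e Hpe) as [d [Hd Hd']].
exists d. split; [exact Hd |]. intros y Hy.
apply (ulim_abs_le U HU (fun n => f n y - f n x)).
- intros n. now apply Hd'.
- now apply ulim_minus.
Qed.

(* The limit [J] of the primitives satisfies [J' = F], so no uniform convergence is needed. *)
Lemma ulim_RInt (f : nat -> R -> R) (F : R -> R) (B a b : R) :
  equicont f -> (forall n x, Rabs (f n x) <= B) -> (forall x, ulim U (fun n => f n x) (F x)) ->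
  ulim U (fun n => RInt (f n) a b) (RInt F a b).
Proof.
intros He HB HF.
assert (Hc : forall n x, continuous (f n) x) by (intros; now apply equicont_continuous).
assert (HJ : exists J : R -> R, forall x, ulim U (fun n => RInt (f n) a x) (J x)).
{ apply (choice (fun x l => ulim U (fun n => RInt (f n) a x) l)). intros x.
  apply (ulim_bounded_ex U HU _ (Rabs (x - a) * B)). intros n.
  destruct (Rle_dec a x) as [Hax | Hax].
  - rewrite (Rabs_pos_eq (x - a)) by lra. apply abs_RInt_le_const; auto. now apply ex_RInt_cont.
  - rewrite <- opp_RInt_swap by now apply ex_RInt_cont. unfold opp; simpl. rewrite Rabs_Ropp.
    rewrite (Rabs_left (x - a)) by lra. replace (- (x - a)) with (a - x) by ring.
    apply abs_RInt_le_const; auto; [lra | now apply ex_RInt_cont]. }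
destruct HJ as [J HJ].
assert (Hder : forall x, is_derive J x (F x)).
{ intros x. apply is_derive_Reals. intros e Hpe.
  destruct (He x (e / 2)) as [d [Hd Hd']]; [lra |].
  exists (mkposreal d Hd). intros t Ht Ht'. simpl in Ht'.
  assert (Hq : Rabs (J (x + t) - J x - t * F x) <= Rabs t * (e / 2)).
  { apply (ulim_abs_le U HU (fun n => RInt (f n) a (x + t) - RInt (f n) a x - t * f n x)).
    - intros n. rewrite <- (RInt_Chasles_cont (f n) a x (x + t)) by auto.
      replace (RInt (f n) a x + RInt (f n) x (x + t) - RInt (f n) a x - t * f n x)
        with (RInt (f n) x (x + t) - RInt (fun _ => f n x) x (x + t)).
      2:{ rewrite RInt_const. unfold scal; simpl; unfold mult; simpl. ring. }
      change (RInt (f n) x (x + t) - RInt (fun _ => f n x) x (x + t))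
        with (minus (RInt (f n) x (x + t)) (RInt (fun _ => f n x) x (x + t))).
      assert (Hcm : forall z, continuous (fun y => minus (f n y) (f n x)) z).
      { intros z. apply (continuous_minus (f n) (fun _ => f n x)); [apply Hc | apply continuous_const]. }
      rewrite <- RInt_minus; [| now apply ex_RInt_cont | apply ex_RInt_const].
      destruct (Rle_dec 0 t) as [Ht0 | Ht0].
      + rewrite (Rabs_pos_eq t) by lra. replace (t * (e / 2)) with ((x + t - x) * (e / 2)) by ring.
        apply abs_RInt_le_const; [lra | now apply ex_RInt_cont |].
        intros y Hy. apply Hd'. rewrite Rabs_pos_eq in Ht' by lra. apply Rabs_def1; lra.
      + rewrite <- opp_RInt_swap by now apply ex_RInt_cont. unfold opp; simpl. rewrite Rabs_Ropp.
        rewrite (Rabs_left t) by lra. replace (- t * (e / 2)) with ((x - (x + t)) * (e / 2)) by ring.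
        apply abs_RInt_le_const; [lra | now apply ex_RInt_cont |].
        intros y Hy. apply Hd'. rewrite Rabs_left in Ht' by lra. apply Rabs_def1; lra.
    - apply ulim_minus; [exact HU | now apply ulim_minus | now apply ulim_scal]. }
  replace ((J (x + t) - J x) / t - F x) with ((J (x + t) - J x - t * F x) / t) by (field; exact Ht).
  unfold Rdiv. rewrite Rabs_mult, Rabs_inv.
  assert (0 < Rabs t) by now apply Rabs_pos_lt.
  apply (Rmult_lt_reg_r (Rabs t)); [assumption |]. rewrite Rmult_assoc, Rinv_l by lra. rewrite Rmult_1_r.
  nra. }
assert (HFc : forall x, continuous F x) by (intros; now apply (ulim_equicont_continuous f)).
assert (HJa : J a = 0).
{ apply (ulim_unique U HU (fun n => RInt (f n) a a)); [apply HJ |].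
  apply (ulim_ext U HU (fun _ => 0)); [intros; now rewrite RInt_point | apply ulim_const, HU]. }
replace (RInt F a b) with (J b); [apply HJ |].
symmetry. apply is_RInt_unique.
replace (J b) with (minus (J b) (J a)) by (rewrite HJa; unfold minus, plus, opp; simpl; ring).
apply (is_RInt_derive J F); auto.
Qed.

(** Dominated convergence: on [[-A, A]] the integrals converge by [ulim_RInt], and the truncation
    errors of [f n] and [F] are small uniformly in [n], the majorant being common. *)
Lemma ulim_dominated_integral (s C : R) (f : nat -> R -> R) (F : R -> R) (l : nat -> R) :
  1 < s -> equicont f -> (forall n x, Rabs (f n x) <= C * wt s x) ->
  (forall x, ulim U (fun n => f n x) (F x)) ->
  (forall n, is_RInt_gen (f n) minf pinf (l n)) ->
  exists L, is_RInt_gen F minf pinf L /\ ulim U l L.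
Proof.
intros Hs He HC HF Hl.
assert (Hdf : forall n, dominated s C (f n)).
{ intros n. split; [intros; now apply equicont_continuous | apply HC]. }
assert (HC0 : 0 <= C) by (apply (dominated_const_pos s C (f 0%nat)); apply Hdf).
assert (HdF : dominated s C F).
{ split; [intros x; now apply (ulim_equicont_continuous f) |].
  intros x. now apply (ulim_abs_le U HU (fun n => f n x)). }
assert (Hlt : forall n A, 0 <= A -> Rabs (l n - RInt (f n) (- A) A) <= 2 * C * tail s A).
{ intros n A HA. destruct (dominated_integral s Hs (f n) C (Hdf n)) as [l' [Hl' Ht]].
  replace (l n) with l'; [now apply Ht |].
  rewrite <- (is_RInt_gen_unique (f n) l' Hl'). now apply is_RInt_gen_unique. }
destruct (dominated_integral s Hs F C HdF) as [L [HL HLt]].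
exists L. split; [exact HL |]. intros e Hpe.
destruct (tail_small s Hs (e / (6 * C + 6))) as [A [HA1 HA2]].
{ apply Rdiv_lt_0_compat; lra. }
assert (HA3 : 6 * C * tail s A < e).
{ pose proof (tail_pos s Hs A).
  apply (Rmult_lt_compat_r (6 * C + 6)) in HA2; [| lra].
  unfold Rdiv in HA2. rewrite Rmult_assoc, Rinv_l in HA2 by lra. nra. }
refine (fu_imp U HU _ _ _ (ulim_RInt f F C (- A) A He _ HF (e / 3) ltac:(lra))).
- intros n Hn. specialize (Hlt n A HA1). specialize (HLt A HA1).
  replace (l n - L) with ((l n - RInt (f n) (- A) A) + (RInt (f n) (- A) A - RInt F (- A) A) - (L - RInt F (- A) A)) by ring.
  eapply Rle_lt_trans; [apply Rabs_triang |]. rewrite Rabs_Ropp.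
  eapply Rle_lt_trans; [apply Rplus_le_compat_r, Rabs_triang |]. lra.
- intros n x. eapply Rle_trans; [apply HC |]. pose proof (wt_le1 s Hs x). pose proof (wt_pos s x). nra.
Qed.

End UlimIntegral.

(** * The limit profile *)

(** Equicontinuity is paired with a uniform bound because the bound is what makes the class stable
    under products. *)
Definition bec (f : nat -> R -> R) : Prop :=
  equicont f /\ exists B, forall n x, Rabs (f n x) <= B.

Lemma bec_plus (f g : nat -> R -> R) : bec f -> bec g -> bec (fun n x => f n x + g n x).
Proof.
intros [Hf [B HB]] [Hg [D HD]]. split.
- intros x e He. destruct (Hf x (e / 2) ltac:(lra)) as [d [Hd Hd']].
  destruct (Hg x (e / 2) ltac:(lra)) as [d2 [Hd2 Hd2']].
  exists (Rmin d d2). split; [now apply Rmin_pos |]. intros n y Hy.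
  specialize (Hd' n y (Rlt_le_trans _ _ _ Hy (Rmin_l _ _))).
  specialize (Hd2' n y (Rlt_le_trans _ _ _ Hy (Rmin_r _ _))).
  replace (f n y + g n y - (f n x + g n x)) with ((f n y - f n x) + (g n y - g n x)) by ring.
  eapply Rle_trans; [apply Rabs_triang | lra].
- exists (B + D). intros n x. eapply Rle_trans; [apply Rabs_triang |]. specialize (HB n x). specialize (HD n x). lra.
Qed.

Lemma bec_mult (f g : nat -> R -> R) : bec f -> bec g -> bec (fun n x => f n x * g n x).
Proof.
intros [Hf [B HB]] [Hg [D HD]].
assert (HB0 : 0 <= B) by (eapply Rle_trans; [apply Rabs_pos | apply (HB 0%nat 0)]).
assert (HD0 : 0 <= D) by (eapply Rle_trans; [apply Rabs_pos | apply (HD 0%nat 0)]).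
split.
- intros x e He. pose (q := e / (B + D + 1)).
  assert (Hq : 0 < q) by (apply Rdiv_lt_0_compat; lra).
  assert (Hq2 : (B + D + 1) * q = e) by (unfold q; field; lra).
  destruct (Hf x q Hq) as [d [Hd Hd']]. destruct (Hg x q Hq) as [d2 [Hd2 Hd2']].
  exists (Rmin d d2). split; [now apply Rmin_pos |]. intros n y Hy.
  specialize (Hd' n y (Rlt_le_trans _ _ _ Hy (Rmin_l _ _))).
  specialize (Hd2' n y (Rlt_le_trans _ _ _ Hy (Rmin_r _ _))).
  replace (f n y * g n y - f n x * g n x) with ((f n y - f n x) * g n y + f n x * (g n y - g n x)) by ring.
  eapply Rle_trans; [apply Rabs_triang |]. rewrite !Rabs_mult.
  pose proof (HB n x). pose proof (HD n y).
  pose proof (Rabs_pos (f n y - f n x)). pose proof (Rabs_pos (g n y - g n x)).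
  pose proof (Rabs_pos (f n x)). pose proof (Rabs_pos (g n y)).
  assert (Rabs (f n y - f n x) * Rabs (g n y) <= q * D) by (apply Rmult_le_compat; lra).
  assert (Rabs (f n x) * Rabs (g n y - g n x) <= B * q) by (apply Rmult_le_compat; lra).
  lra.
- exists (B * D). intros n x. rewrite Rabs_mult. apply Rmult_le_compat; auto using Rabs_pos.
Qed.

Lemma bec_fixed (f : R -> R) (B : R) :
  (forall x, continuous f x) -> (forall x, Rabs (f x) <= B) -> bec (fun _ => f).
Proof.
intros Hc HB. split; [| exists B; auto].
intros x e He. destruct (continuous_eps f x e (Hc x) He) as [d [Hd Hd']].
exists d. split; [exact Hd |]. intros _ y Hy. left. now apply Hd'.
Qed.

Lemma bec_const (c : R) : bec (fun _ _ => c).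
Proof. apply (bec_fixed (fun _ => c) (Rabs c)); [intros; apply continuous_const | intros; lra]. Qed.

Lemma bec_lipschitz (f : nat -> R -> R) (B L : R) :
  (forall n x, Rabs (f n x) <= B) -> (forall n x y, Rabs (f n y - f n x) <= L * Rabs (y - x)) -> bec f.
Proof.
intros HB HL. split; [| now exists B].
intros x e He. assert (H0 : 0 <= Rmax L 1) by (eapply Rle_trans; [| apply Rmax_r]; lra).
assert (H1 : 1 <= Rmax L 1) by apply Rmax_r.
exists (e / Rmax L 1). split; [apply Rdiv_lt_0_compat; lra |]. intros n y Hy.
eapply Rle_trans; [apply HL |].
apply Rle_trans with (Rmax L 1 * Rabs (y - x)).
- apply Rmult_le_compat_r; [apply Rabs_pos | apply Rmax_l].
- apply (Rmult_lt_compat_l (Rmax L 1)) in Hy; [| lra].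
  replace (Rmax L 1 * (e / Rmax L 1)) with e in Hy by (field; lra). lra.
Qed.

Lemma bec_ext (f g : nat -> R -> R) : (forall n x, f n x = g n x) -> bec f -> bec g.
Proof.
intros H [Hf [B HB]]. split.
- intros x e He. destruct (Hf x e He) as [d [Hd Hd']]. exists d. split; [exact Hd |].
  intros n y Hy. rewrite <- !H. auto.
- exists B. intros n x. rewrite <- H. auto.
Qed.

Lemma is_RInt_fsum (K : nat) (f : nat -> R -> R) (l : nat -> R) (a b : R) :
  (forall i, (i < K)%nat -> is_RInt (f i) a b (l i)) ->
  is_RInt (fun x => fsum K (fun i => f i x)) a b (fsum K l).
Proof.
induction K as [| K IH]; intros H; simpl.
- evar_last; [apply (@is_RInt_const R_NormedModule) |].
  unfold scal; simpl; unfold mult; simpl. ring.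
- apply (@is_RInt_plus R_NormedModule); [apply IH; intros; apply H; lia | apply H; lia].
Qed.

Lemma cos_minus_PI2 (y : R) : cos (y - PI / 2) = sin y.
Proof. rewrite cos_minus, cos_PI2, sin_PI2. ring. Qed.

(** The two sums are the real and imaginary parts of one exponential sum, so the integrand is a
    squared modulus. Distinct nodes differ by a nonzero multiple of [1 / N], with [N = S n], and the
    cross terms integrate to zero over the period [2 PI N]. *)
Lemma parseval_period (n : nat) (q : nat -> R) (t : R) :
  is_RInt (fun x => fsum (len n) (fun a => q a * cos (node n a * x + t)) ^ 2 +
                    fsum (len n) (fun a => q a * cos (node n a * x + t - PI / 2)) ^ 2)
    (- (PI * INR (S n))) (PI * INR (S n)) (2 * PI * INR (S n) * fsum (len n) (fun a => q a ^ 2)).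
Proof.
pose (K := len n). fold K. pose (N := INR (S n)). fold N.
assert (HN : 0 < N) by (apply lt_0_INR; lia). pose proof PI_RGT_0.
apply (is_RInt_ext (fun x => fsum K (fun a => fsum K (fun b => q a * q b * cos ((node n a - node n b) * x))))).
{ intros x _. rewrite <- !Rsqr_pow2. unfold Rsqr.
  rewrite <- !fsum_scal_r, <- fsum_plus. apply fsum_ext; intros a _.
  rewrite <- !fsum_scal, <- fsum_plus. apply fsum_ext; intros b _.
  rewrite !cos_minus_PI2.
  replace ((node n a - node n b) * x) with ((node n a * x + t) - (node n b * x + t)) by ring.
  rewrite cos_minus. ring. }
replace (2 * PI * N * fsum K (fun a => q a ^ 2)) with
  (fsum K (fun a => fsum K (fun b => indic (b =? a)%nat * (2 * PI * N * q a * q b)))).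
2:{ rewrite <- fsum_scal. apply fsum_ext; intros a Ha.
    rewrite (fsum_delta K a (fun b => 2 * PI * N * q a * q b)).
    apply Nat.ltb_lt in Ha. rewrite Ha. simpl. ring. }
apply (is_RInt_fsum K (fun a x => fsum K (fun b => q a * q b * cos ((node n a - node n b) * x)))); intros a _.
apply (is_RInt_fsum K (fun b x => q a * q b * cos ((node n a - node n b) * x))); intros b _.
destruct (Nat.eqb_spec b a) as [-> | Hne]; simpl indic.
- apply (is_RInt_ext (fun _ => q a * q a)).
  { intros x _. replace ((node n a - node n a) * x) with 0 by ring. rewrite cos_0. symmetry. apply Rmult_1_r. }
  evar_last; [apply (@is_RInt_const R_NormedModule) |].
  unfold scal; simpl; unfold mult; simpl. ring.
- pose (z := (Z.of_nat a - Z.of_nat b)%Z).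
  assert (Hz : IZR z <> 0) by (apply not_0_IZR; unfold z; lia).
  assert (Hnode : node n a - node n b = IZR z / N).
  { unfold node, mesh, z. rewrite minus_IZR, <- !INR_IZR_INZ. unfold Rdiv, N. ring. }
  assert (Hsin : sin (IZR z * PI) = 0) by (apply sin_eq_0_1; now exists z).
  replace (0 * (2 * PI * N * q a * q b)) with
    (minus (q a * q b * (N / IZR z) * sin (IZR z / N * (PI * N)))
           (q a * q b * (N / IZR z) * sin (IZR z / N * - (PI * N)))).
  2:{ replace (IZR z / N * - (PI * N)) with (- (IZR z * PI)) by (field; lra).
      replace (IZR z / N * (PI * N)) with (IZR z * PI) by (field; lra).
      rewrite sin_neg, Hsin. unfold minus, plus, opp; simpl. ring. }
  apply (is_RInt_derive (fun x => q a * q b * (N / IZR z) * sin (IZR z / N * x))).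
  + intros x _. rewrite Hnode. auto_derive; [trivial |]. field. split; lra.
  + intros x _. apply (@ex_derive_continuous R_AbsRing R_NormedModule). auto_derive. trivial.
Qed.

Lemma nonneg_bounded_ex_RInt_gen (g : R -> R) (B : R) :
  (forall x, continuous g x) -> (forall x, 0 <= g x) ->
  (forall A, 0 <= A -> RInt g (- A) A <= B) -> ex_RInt_gen g minf pinf.
Proof.
intros Hc Hg HB.
destruct (completeness (fun v => exists A, 0 <= A /\ v = RInt g (- A) A)) as [l [Hl1 Hl2]].
- exists B. intros v [A [HA ->]]. auto.
- exists (RInt g (- 0) 0), 0. split; [lra | reflexivity].
- exists l. apply is_RInt_gen_window; [intros; now apply ex_RInt_cont |].
  assert (Hpos : forall a b, a <= b -> 0 <= RInt g a b).
  { intros a b Hab. apply RInt_ge_0; auto. now apply ex_RInt_cont. }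
  intros e He.
  assert (Hex : exists A, 0 <= A /\ l - e < RInt g (- A) A).
  { apply NNPP. intros Hn. assert (Hub : is_upper_bound (fun v => exists A, 0 <= A /\ v = RInt g (- A) A) (l - e)).
    { intros v [A [HA ->]]. apply Rnot_lt_le. intros Hlt. apply Hn. now exists A. }
    specialize (Hl2 _ Hub). lra. }
  destruct Hex as [A [HA HAe]]. exists A. intros a b Ha Hb.
  pose (D := Rmax (- a) b). pose proof (Rmax_l (- a) b). pose proof (Rmax_r (- a) b). fold D in H, H0.
  assert (H1 : RInt g (- D) D <= l) by (apply Hl1; exists D; split; [lra | reflexivity]).
  rewrite <- (RInt_Chasles_cont g (- D) a D Hc), <- (RInt_Chasles_cont g a b D Hc) in H1.
  pose proof (Hpos (- D) a ltac:(lra)). pose proof (Hpos b D ltac:(lra)).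
  assert (H4 : RInt g (- A) A <= RInt g a b).
  { rewrite <- (RInt_Chasles_cont g a (- A) b Hc), <- (RInt_Chasles_cont g (- A) A b Hc).
    pose proof (Hpos a (- A) ltac:(lra)). pose proof (Hpos A b ltac:(lra)). lra. }
  apply Rabs_def1; lra.
Qed.

(** The phase [t = 0] gives the real part of the trigonometric polynomial and [t = - PI / 2] its
    imaginary part. The index [j] is the order of the derivative in [x]: each derivative brings a
    factor [node n a] and a phase [PI / 2]. *)
Definition prof (n : nat) (G : nat -> R) (j : nat) (t x : R) : R :=
  mesh n * fsum (len n) (fun a => G a * (node n a ^ j * cos (node n a * x + t + INR j * (PI / 2)))).

(** Values, increments and Taylor remainders of [prof] all have the form of a sum of [G a * k a];
    each costs the moment whose order is the growth of [k]. *)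
Lemma moment_le (n : nat) (G : nat -> R) (Cs : nat -> R) (k : nat -> R) (i : nat) (B : R) :
  (forall i, 0 <= G i) ->
  (forall j, mesh n * fsum (len n) (fun a => (1 + Rabs (node n a)) ^ j * G a) <= Cs j) ->
  0 <= B -> (forall a, Rabs (k a) <= B * (1 + Rabs (node n a)) ^ i) ->
  Rabs (mesh n * fsum (len n) (fun a => G a * k a)) <= B * Cs i.
Proof.
intros HG HC HB Hk. pose proof (mesh_pos n).
rewrite Rabs_mult, Rabs_pos_eq by lra.
apply Rle_trans with (B * (mesh n * fsum (len n) (fun a => (1 + Rabs (node n a)) ^ i * G a))).
- replace (B * (mesh n * fsum (len n) (fun a => (1 + Rabs (node n a)) ^ i * G a)))
    with (mesh n * (B * fsum (len n) (fun a => (1 + Rabs (node n a)) ^ i * G a))) by ring.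
  apply Rmult_le_compat_l; [lra |]. rewrite <- fsum_scal.
  eapply Rle_trans; [apply fsum_abs |]. apply fsum_le; intros a _.
  rewrite Rabs_mult, (Rabs_pos_eq (G a)) by auto.
  replace (B * ((1 + Rabs (node n a)) ^ i * G a)) with (G a * (B * (1 + Rabs (node n a)) ^ i)) by ring.
  apply Rmult_le_compat_l; auto.
- apply Rmult_le_compat_l; auto.
Qed.

Lemma node_pow_le (n a j i : nat) : (j <= i)%nat -> Rabs (node n a ^ j) <= (1 + Rabs (node n a)) ^ i.
Proof.
intros Hji. rewrite <- RPow_abs. pose proof (Rabs_pos (node n a)).
apply Rle_trans with ((1 + Rabs (node n a)) ^ j); [apply pow_incr; lra |].
apply Rle_pow; [lra | exact Hji].
Qed.

Section Profile.

Variables (U : (nat -> Prop) -> Prop) (HU : free_ultra U).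
Variables (Gs : nat -> nat -> R) (Cs : nat -> R).
Hypothesis (HG : forall n i, 0 <= Gs n i).
Hypothesis (HC : forall n j, mesh n * fsum (len n) (fun a => (1 + Rabs (node n a)) ^ j * Gs n a) <= Cs j).
Hypothesis (HC2 : forall n, mesh n * fsum (len n) (fun a => (1 + Rabs (node n a)) ^ 2 * Gs n a ^ 2) <= Cs 0%nat).

Lemma prof_bound (n j : nat) (t x : R) : Rabs (prof n (Gs n) j t x) <= Cs j.
Proof.
rewrite <- (Rmult_1_l (Cs j)). apply (moment_le n (Gs n) Cs); auto; [lra |].
intros a. rewrite Rabs_mult, Rmult_1_l.
rewrite <- (Rmult_1_r ((1 + Rabs (node n a)) ^ j)).
apply Rmult_le_compat; auto using Rabs_pos, cos_abs_le1, node_pow_le.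
Qed.

Lemma prof_lipschitz (n j : nat) (t x y : R) :
  Rabs (prof n (Gs n) j t y - prof n (Gs n) j t x) <= Cs (S j) * Rabs (y - x).
Proof.
unfold prof. rewrite <- Rmult_minus_distr_l, <- fsum_minus, (Rmult_comm (Cs (S j))).
rewrite (fsum_ext _ _ (fun a => Gs n a * (node n a ^ j * (cos (node n a * y + t + INR j * (PI / 2)) -
  cos (node n a * x + t + INR j * (PI / 2)))))) by (intros; ring).
apply (moment_le n (Gs n) Cs); auto using Rabs_pos.
intros a. rewrite Rabs_mult.
apply Rle_trans with ((1 + Rabs (node n a)) ^ j * (Rabs (node n a) * Rabs (y - x))).
- apply Rmult_le_compat; auto using Rabs_pos, node_pow_le.
  eapply Rle_trans; [apply cos_lipschitz |]. rewrite <- Rabs_mult. right. f_equal. ring.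
- simpl. pose proof (Rabs_pos (node n a)). pose proof (Rabs_pos (y - x)).
  assert (0 <= (1 + Rabs (node n a)) ^ j) by (apply pow_le; lra).
  assert (0 <= (1 + Rabs (node n a)) ^ j * Rabs (y - x)) by (apply Rmult_le_pos; lra). nra.
Qed.

Lemma prof_taylor (n j : nat) (t x u : R) :
  Rabs (prof n (Gs n) j t (x + u) - prof n (Gs n) j t x - u * prof n (Gs n) (S j) t x) <= Cs (S (S j)) * u ^ 2.
Proof.
unfold prof.
replace (u * (mesh n * fsum (len n) (fun a => Gs n a * (node n a ^ S j * cos (node n a * x + t + INR (S j) * (PI / 2))))))
 with (mesh n * fsum (len n) (fun a => u * (Gs n a * (node n a ^ S j * cos (node n a * x + t + INR (S j) * (PI / 2))))))
 by (rewrite fsum_scal; ring).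
rewrite <- !Rmult_minus_distr_l, <- !fsum_minus, (Rmult_comm (Cs (S (S j)))).
rewrite (fsum_ext _ _ (fun a => Gs n a * (node n a ^ j *
  (cos ((node n a * x + t + INR j * (PI / 2)) + node n a * u) - cos (node n a * x + t + INR j * (PI / 2))
    - node n a * u * cos (node n a * x + t + INR j * (PI / 2) + PI / 2))))).
2:{ intros a _. rewrite S_INR.
    replace (node n a * x + t + (INR j + 1) * (PI / 2)) with (node n a * x + t + INR j * (PI / 2) + PI / 2) by ring.
    replace (node n a * (x + u) + t + INR j * (PI / 2)) with (node n a * x + t + INR j * (PI / 2) + node n a * u) by ring.
    simpl. ring. }
apply (moment_le n (Gs n) Cs); auto using pow2_ge_0.
intros a. rewrite Rabs_mult.
apply Rle_trans with ((1 + Rabs (node n a)) ^ j * (node n a * u) ^ 2).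
- apply Rmult_le_compat; auto using Rabs_pos, node_pow_le, cos_taylor.
- rewrite Rpow_mult_distr, <- (pow2_abs (node n a)). simpl.
  pose proof (Rabs_pos (node n a)).
  assert (0 <= (1 + Rabs (node n a)) ^ j) by (apply pow_le; lra).
  replace (u * (u * 1) * ((1 + Rabs (node n a)) * ((1 + Rabs (node n a)) * (1 + Rabs (node n a)) ^ j)))
    with ((1 + Rabs (node n a)) ^ j * ((1 + Rabs (node n a)) * (1 + Rabs (node n a)) * (u * u))) by ring.
  apply Rmult_le_compat_l; [assumption |]. pose proof (Rle_0_sqr u) as Hu. unfold Rsqr in Hu. nra.
Qed.

Lemma prof_bec (j : nat) (t : R) : bec (fun n => prof n (Gs n) j t).
Proof.
apply (bec_lipschitz _ (Cs j) (Cs (S j))); [intros; apply prof_bound | intros; apply prof_lipschitz].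
Qed.

Lemma prof_limit : exists P : nat -> R -> R -> R,
  forall j t x, ulim U (fun n => prof n (Gs n) j t x) (P j t x).
Proof.
destruct (choice (fun (p : nat * R * R) l => ulim U (fun n => prof n (Gs n) (fst (fst p)) (snd (fst p)) (snd p)) l)) as [P HP].
- intros p. apply (ulim_bounded_ex U HU _ (Cs (fst (fst p)))). intros n. apply prof_bound.
- exists (fun j t x => P (j, t, x)). intros j t x. apply (HP (j, t, x)).
Qed.

Variable P : nat -> R -> R -> R.
Hypothesis HP : forall j t x, ulim U (fun n => prof n (Gs n) j t x) (P j t x).

Lemma profile_derive (j : nat) (t x : R) : is_derive (P j t) x (P (S j) t x).
Proof.
apply (is_derive_of_quadratic _ _ _ (Cs (S (S j)))). intros u _.
apply (ulim_abs_le U HU (fun n => prof n (Gs n) j t (x + u) - prof n (Gs n) j t x - u * prof n (Gs n) (S j) t x)).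
- intros n. apply prof_taylor.
- apply ulim_minus; [exact HU | apply ulim_minus; auto | apply ulim_scal; auto].
Qed.

Lemma profile_Derive_n (n j : nat) (t x : R) :
  Derive_n (P j t) n x = P (n + j)%nat t x /\ ex_derive_n (P j t) n x.
Proof.
revert x. induction n as [| n IH]; intros x; [split; [reflexivity | exact I] |]. split.
- simpl. rewrite (Derive_ext _ (P (n + j)%nat t)) by (intros; apply IH).
  apply is_derive_unique, profile_derive.
- simpl. apply (ex_derive_ext (P (n + j)%nat t)); [intros; symmetry; apply IH |].
  exists (P (S (n + j)) t x). apply profile_derive.
Qed.

(** Once [n] is large, [[-A, A]] lies in one period, on which Parseval gives [2 PI] times a discrete
    [l^2] moment. The bound survives the limit in [n] and is independent of [A]. The range of [j] is
    that of the weight in [HC2]. *)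
Lemma profile_L2 (j : nat) : (j <= 1)%nat ->
  ex_RInt_gen (fun x => P j 0 x ^ 2 + P j (- (PI / 2)) x ^ 2) minf pinf.
Proof.
intros Hj.
assert (Hc : forall x, continuous (fun x => P j 0 x ^ 2 + P j (- (PI / 2)) x ^ 2) x).
{ intros x. apply (@ex_derive_continuous R_AbsRing R_NormedModule).
  apply (ex_derive_plus (fun x => P j 0 x ^ 2) (fun x => P j (- (PI / 2)) x ^ 2));
    apply ex_derive_pow; [exists (P (S j) 0 x) | exists (P (S j) (- (PI / 2)) x)]; apply profile_derive. }
apply (nonneg_bounded_ex_RInt_gen _ (2 * PI * Cs 0%nat) Hc).
{ intros x. pose proof (pow2_ge_0 (P j 0 x)). pose proof (pow2_ge_0 (P j (- (PI / 2)) x)). lra. }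
intros A HA.
pose (fn := fun n x => prof n (Gs n) j 0 x ^ 2 + prof n (Gs n) j (- (PI / 2)) x ^ 2).
assert (Hbec : bec fn).
{ unfold fn. simpl. apply bec_plus; (apply bec_mult; [apply prof_bec |]; apply bec_mult; [apply prof_bec | apply bec_const]). }
destruct Hbec as [Heq [B HB]].
apply (ulim_le U HU (fun n => RInt (fn n) (- A) A) (fun _ => 2 * PI * Cs 0%nat)); [| | apply ulim_const, HU].
- destruct (INR_unbounded A) as [N HN].
  refine (fu_imp U HU _ _ _ (fu_ev U HU N)). intros n Hn.
  pose proof PI_RGT_0. assert (HPI : 1 < PI) by (pose proof PI2_1; lra).
  assert (Hle : A <= PI * INR (S n)).
  { assert (INR N <= INR (S n)) by (apply le_INR; lia). pose proof (pos_INR (S n)). nra. }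
  assert (Hcn : forall x, continuous (fn n) x) by (intros; now apply equicont_continuous).
  assert (Hpos : forall a b, a <= b -> 0 <= RInt (fn n) a b).
  { intros a b Hab. apply RInt_ge_0; auto; [now apply ex_RInt_cont |].
    intros x _. unfold fn. pose proof (pow2_ge_0 (prof n (Gs n) j 0 x)).
    pose proof (pow2_ge_0 (prof n (Gs n) j (- (PI / 2)) x)). lra. }
  apply Rle_trans with (RInt (fn n) (- (PI * INR (S n))) (PI * INR (S n))).
  { rewrite <- (RInt_Chasles_cont (fn n) (- (PI * INR (S n))) (- A) (PI * INR (S n)) Hcn).
    rewrite <- (RInt_Chasles_cont (fn n) (- A) A (PI * INR (S n)) Hcn).
    pose proof (Hpos (- (PI * INR (S n))) (- A) ltac:(lra)). pose proof (Hpos A (PI * INR (S n)) Hle). lra. }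
  rewrite (is_RInt_unique (fn n) _ _ (2 * PI * INR (S n) * fsum (len n) (fun a => (mesh n * (Gs n a * node n a ^ j)) ^ 2))).
  2:{ refine (is_RInt_ext _ _ _ _ _ _ (parseval_period n (fun a => mesh n * (Gs n a * node n a ^ j)) (INR j * (PI / 2)))).
      intros x _. unfold fn, prof. rewrite <- !fsum_scal. f_equal; f_equal; apply fsum_ext; intros a _.
      - rewrite Rplus_0_r. ring.
      - replace (node n a * x + - (PI / 2) + INR j * (PI / 2)) with (node n a * x + INR j * (PI / 2) - PI / 2) by ring. ring. }
  replace (2 * PI * INR (S n) * fsum (len n) (fun a => (mesh n * (Gs n a * node n a ^ j)) ^ 2))
    with (2 * PI * ((mesh n * INR (S n)) * (mesh n * fsum (len n) (fun a => (Gs n a * node n a ^ j) ^ 2)))).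
  2:{ rewrite (fsum_ext _ (fun a => (mesh n * (Gs n a * node n a ^ j)) ^ 2)
        (fun a => mesh n ^ 2 * (Gs n a * node n a ^ j) ^ 2)) by (intros; ring).
      rewrite fsum_scal. ring. }
  rewrite mesh_mult. apply Rmult_le_compat_l; [lra |]. rewrite Rmult_1_l.
  eapply Rle_trans; [| apply (HC2 n)]. apply Rmult_le_compat_l; [left; apply mesh_pos |].
  apply fsum_le; intros a _. rewrite Rpow_mult_distr, Rmult_comm.
  apply Rmult_le_compat_r; [apply pow2_ge_0 |]. rewrite <- (pow2_abs (node n a ^ j)).
  apply pow_incr. split; [apply Rabs_pos |]. rewrite <- (pow_1 (1 + Rabs (node n a))). now apply node_pow_le.
- apply (ulim_RInt U HU fn _ B); auto. intros x. unfold fn. simpl.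
  apply ulim_plus; [exact HU | |]; (apply ulim_mult; [exact HU | auto |]; apply ulim_mult; [exact HU | auto | apply ulim_const, HU]).
Qed.

End Profile.

(** * The symbol *)

Lemma rpow_of_pos (x s : R) : 0 < x -> rpow x s = Rpower x s.
Proof. intros H. unfold rpow. destruct (Rle_dec x 0); [lra | reflexivity]. Qed.

Lemma rpow_0 (s : R) : rpow 0 s = 0.
Proof. unfold rpow. destruct (Rle_dec 0 0); [reflexivity | lra]. Qed.

Lemma rpow_nonneg (x s : R) : 0 <= rpow x s.
Proof. unfold rpow. destruct (Rle_dec x 0); [lra | left; apply exp_pos]. Qed.

Lemma rpow_le (x y s : R) : 0 <= s -> x <= y -> rpow x s <= rpow y s.
Proof.
intros Hs Hxy. destruct (Rle_lt_dec x 0) as [Hx | Hx].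
- unfold rpow at 1. destruct (Rle_dec x 0); [apply rpow_nonneg | lra].
- rewrite !rpow_of_pos by lra. apply Rle_Rpower_l; lra.
Qed.

Lemma is_derive_Rpower_base (s z : R) : 0 < z ->
  is_derive (fun z => Rpower z s) z (s * Rpower z (s - 1)).
Proof.
intros Hz. unfold Rpower. auto_derive; [exact Hz |].
replace ((s - 1) * ln z) with (s * ln z + - ln z) by ring. rewrite exp_plus, exp_Ropp, exp_ln by exact Hz. field. lra.
Qed.

Section PowerEstimates.

Variables (s : R) (Hs : 1 < s < 2).

(** For [1 < s < 2] the derivative [s z^(s-1)] is at most [2 (1 + z)]. The endpoint [0] is treated
    apart, since [rpow] and [Rpower] agree only at positive arguments. *)
Lemma rpow_lipschitz (x y : R) : 0 <= y <= x -> Rabs (rpow x s - rpow y s) <= 4 * (1 + x) * (x - y).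
Proof.
intros [Hy Hyx].
assert (Haux : forall z, 0 < z -> Rpower z (s - 1) <= 1 + z).
{ intros z Hz. destruct (Rle_dec z 1) as [H1 | H1].
  - apply Rle_trans with (Rpower 1 (s - 1)); [apply Rle_Rpower_l; lra |]. unfold Rpower. rewrite ln_1, Rmult_0_r, exp_0. lra.
  - apply Rle_trans with (Rpower z 1); [apply Rle_Rpower; lra |]. rewrite Rpower_1; lra. }
destruct (Rle_lt_or_eq_dec 0 y Hy) as [Hy' | <-].
- rewrite !rpow_of_pos by lra. rewrite Rabs_minus_sym.
  replace (x - y) with (Rabs (y - x)) by (rewrite Rabs_minus_sym, Rabs_pos_eq; lra).
  apply (lipschitz_of_derive (fun z => Rpower z s) (fun z => s * Rpower z (s - 1))).
  + intros z Hz. apply is_derive_Rpower_base. rewrite (Rabs_minus_sym y), (Rabs_pos_eq (x - y)) in Hz by lra.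
    apply Rabs_le_between in Hz. lra.
  + intros z Hz. rewrite (Rabs_minus_sym y), (Rabs_pos_eq (x - y)) in Hz by lra.
    apply Rabs_le_between in Hz. rewrite Rabs_pos_eq.
    * pose proof (Haux z ltac:(lra)). assert (0 < Rpower z (s - 1)) by apply exp_pos. nra.
    * apply Rmult_le_pos; [lra | left; apply exp_pos].
- rewrite rpow_0, !Rminus_0_r, Rabs_pos_eq by apply rpow_nonneg.
  destruct (Rle_lt_or_eq_dec 0 x Hyx) as [Hx | <-]; [| rewrite rpow_0; lra].
  rewrite rpow_of_pos by exact Hx. replace s with ((s - 1) + 1) by ring.
  rewrite Rpower_plus, Rpower_1 by exact Hx. pose proof (Haux x Hx). nra.
Qed.

Lemma rpow_abs_lipschitz (t d : R) : Rabs d <= 1 ->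
  Rabs (rpow (Rabs (t + d)) s - rpow (Rabs t) s) <= 8 * (1 + Rabs t) * Rabs d.
Proof.
intros Hd. pose proof (Rabs_pos t). pose proof (Rabs_pos (t + d)). pose proof (Rabs_pos d).
assert (H2 : Rabs (t + d) <= Rabs t + Rabs d) by apply Rabs_triang.
assert (H3 : Rabs t <= Rabs (t + d) + Rabs d).
{ pose proof (Rabs_triang (t + d) (- d)) as H3. rewrite Rabs_Ropp in H3.
  replace (t + d + - d) with t in H3 by ring. exact H3. }
destruct (Rle_dec (Rabs t) (Rabs (t + d))) as [Hle | Hle].
- eapply Rle_trans; [apply rpow_lipschitz; lra |]. nra.
- rewrite Rabs_minus_sym. eapply Rle_trans; [apply rpow_lipschitz; lra |]. nra.
Qed.

(** For [0 <= t <= 2 d] the three values are at most [(3 d)^s <= 9 d^s], which gives [18]. For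
    [t > 2 d] all points stay above [d], where the second derivative [s (s - 1) z^(s-2)] is at most
    [2 d^(s-2)]. Negative [t] follows by symmetry. *)
Lemma rpow_abs_second_difference (t d : R) : 0 < d ->
  Rabs (rpow (Rabs (t + d)) s + rpow (Rabs (t - d)) s - 2 * rpow (Rabs t) s) <= 18 * Rpower d s.
Proof.
intros Hd.
assert (Hdp : 0 < Rpower d s) by apply exp_pos.
assert (Hmain : forall t, 0 <= t ->
  Rabs (rpow (Rabs (t + d)) s + rpow (Rabs (t - d)) s - 2 * rpow (Rabs t) s) <= 18 * Rpower d s).
2:{ destruct (Rle_dec 0 t) as [Ht | Ht]; [now apply Hmain |].
    specialize (Hmain (- t) ltac:(lra)).
    replace (- t + d) with (- (t - d)) in Hmain by ring. replace (- t - d) with (- (t + d)) in Hmain by ring.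
    rewrite !Rabs_Ropp in Hmain. rewrite (Rplus_comm (rpow (Rabs (t + d)) s)). exact Hmain. }
clear t. intros t Ht.
destruct (Rle_lt_dec t (2 * d)) as [Hle | Hlt].
- assert (H3 : forall y, Rabs y <= 3 * d -> 0 <= rpow (Rabs y) s <= 9 * Rpower d s).
  { intros y Hy. split; [apply rpow_nonneg |].
    apply Rle_trans with (rpow (3 * d) s); [apply rpow_le; lra |].
    rewrite rpow_of_pos, <- Rpower_mult_distr by lra. apply Rmult_le_compat_r; [lra |].
    apply Rle_trans with (Rpower 3 2); [apply Rle_Rpower; lra |].
    replace 2 with (INR 2) by (simpl; ring). rewrite Rpower_pow by lra. lra. }
  destruct (H3 (t + d)); [apply Rabs_le; lra |].
  destruct (H3 (t - d)); [apply Rabs_le; lra |].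
  destruct (H3 t); [apply Rabs_le; lra |].
  apply Rabs_le. lra.
- rewrite (Rabs_pos_eq (t + d)), (Rabs_pos_eq (t - d)), (Rabs_pos_eq t) by lra.
  rewrite !rpow_of_pos by lra.
  apply Rle_trans with (2 * (2 * Rpower d (s - 2)) * d ^ 2).
  + apply (second_difference_bound (fun z => Rpower z s) (fun z => s * Rpower z (s - 1))
      (fun z => s * ((s - 1) * Rpower z (s - 1 - 1)))).
    * intros z Hz. rewrite (Rabs_pos_eq d) in Hz by lra. apply Rabs_le_between in Hz.
      apply is_derive_Rpower_base. lra.
    * intros z Hz. rewrite (Rabs_pos_eq d) in Hz by lra. apply Rabs_le_between in Hz.
      apply (is_derive_scal (fun z => Rpower z (s - 1))). apply is_derive_Rpower_base. lra.
    * intros z Hz. rewrite (Rabs_pos_eq d) in Hz by lra. apply Rabs_le_between in Hz.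
      assert (Hpz : 0 < Rpower z (s - 1 - 1)) by apply exp_pos.
      assert (Hpd : Rpower z (s - 1 - 1) <= Rpower d (s - 2)).
      { replace (s - 1 - 1) with (- (2 - s)) by ring. replace (s - 2) with (- (2 - s)) by ring.
        rewrite !Rpower_Ropp. apply Rinv_le_contravar; [apply exp_pos |]. apply Rle_Rpower_l; lra. }
      rewrite Rabs_pos_eq by (repeat apply Rmult_le_pos; lra).
      rewrite <- Rmult_assoc. apply Rmult_le_compat; [nra | lra | nra | exact Hpd].
  + replace (d ^ 2) with (Rpower d 2).
    2:{ replace 2 with (INR 2) at 1 by (simpl; ring). apply Rpower_pow. exact Hd. }
    replace (2 * (2 * Rpower d (s - 2)) * Rpower d 2) with (4 * (Rpower d (s - 2) * Rpower d 2)) by ring.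
    rewrite <- Rpower_plus. replace (s - 2 + 2) with s by ring. lra.
Qed.

End PowerEstimates.

Definition jb (x : R) : R := 1 + Rabs x.

Lemma jb_ge1 (x : R) : 1 <= jb x.
Proof. unfold jb. pose proof (Rabs_pos x). lra. Qed.

Lemma jb_shift (x y : R) : Rabs (y - x) <= 1 -> jb x <= 2 * jb y.
Proof.
intros H. unfold jb. pose proof (Rabs_triang y (x - y)) as H1.
replace (y + (x - y)) with x in H1 by ring. rewrite (Rabs_minus_sym x y) in H1.
pose proof (Rabs_pos y). lra.
Qed.

Lemma inv_jb2_le_wt (s x : R) : s <= 2 -> / jb x ^ 2 <= wt s x.
Proof.
intros Hs. pose proof (jb_ge1 x). unfold wt. fold (jb x). rewrite Rpower_Ropp.
apply Rinv_le_contravar; [apply exp_pos |]. rewrite <- Rpower_pow by lra.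
apply Rle_Rpower; [lra | simpl; lra].
Qed.

(** What remains of a symbol of order at most two in spite of the kink: second differences are of
    order [d^s] rather than [d^2], and this exponent becomes the decay rate of [Pk]. *)
Record symbol_like (s : R) (p : R -> R) (C : R) : Prop := {
  sl_size : forall x, Rabs (p x) <= C * jb x ^ 2;
  sl_diff : forall x d, Rabs d <= 1 -> Rabs (p (x + d) - p x) <= C * jb x * Rabs d;
  sl_diff2 : forall x d, 0 < d -> Rabs (p (x + d) + p (x - d) - 2 * p x) <= C * Rpower d s }.

(** The affine part of [p_sym] disappears from second differences; the rest is a translate of the
    power of order [2 sigma]. *)
Lemma p_sym_symbol_like (sigma k : R) : 1 / 2 < sigma < 1 ->
  exists C, symbol_like (2 * sigma) (p_sym sigma k) C.
Proof.
intros Hsig. pose (s := 2 * sigma). assert (Hs : 1 < s < 2) by (unfold s; lra).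
pose (A := rpow (Rabs k) s). pose (B := 2 * sigma * rpow (Rabs k) (s - 2) * k).
assert (Hp : forall x, p_sym sigma k x = rpow (Rabs (x + k)) s - A - B * x) by reflexivity.
assert (HA : 0 <= A) by apply rpow_nonneg.
pose proof (Rabs_pos k) as Hk. pose proof (Rabs_pos B) as HB.
exists (8 * (1 + Rabs k) ^ 2 + A + Rabs B + 18). constructor; intros x.
- pose proof (Rabs_pos x) as Hx. pose proof (jb_ge1 x) as Hj.
  rewrite Hp.
  assert (H1 : rpow (Rabs (x + k)) s <= 4 * (1 + Rabs k) ^ 2 * jb x ^ 2).
  { pose proof (rpow_lipschitz s Hs (Rabs (x + k)) 0 ltac:(split; [lra | apply Rabs_pos])) as H.
    rewrite rpow_0, !Rminus_0_r, Rabs_pos_eq in H by apply rpow_nonneg.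
    assert (H2 : 1 + Rabs (x + k) <= (1 + Rabs k) * jb x).
    { pose proof (Rabs_triang x k). unfold jb. nra. }
    pose proof (Rabs_pos (x + k)).
    apply Rle_trans with (4 * ((1 + Rabs k) * jb x * ((1 + Rabs k) * jb x))); [| right; ring].
    eapply Rle_trans; [exact H |]. rewrite Rmult_assoc. apply Rmult_le_compat_l; [lra |].
    apply Rmult_le_compat; lra. }
  pose proof (rpow_nonneg (Rabs (x + k)) s).
  assert (HBx : Rabs (B * x) <= Rabs B * jb x ^ 2).
  { rewrite Rabs_mult. apply Rmult_le_compat_l; [lra |]. unfold jb in *. nra. }
  unfold Rminus. eapply Rle_trans; [apply Rabs_triang |]. rewrite Rabs_Ropp.
  eapply Rle_trans; [apply Rplus_le_compat_r, Rabs_triang |]. rewrite Rabs_Ropp.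
  rewrite (Rabs_pos_eq (rpow _ _)), (Rabs_pos_eq A) by lra.
  assert (1 <= jb x ^ 2) by nra. pose proof (pow2_ge_0 (1 + Rabs k)).
  assert (0 <= (1 + Rabs k) ^ 2 * jb x ^ 2) by (apply Rmult_le_pos; lra).
  nra.
- intros d Hd. rewrite !Hp.
  replace (rpow (Rabs (x + d + k)) s - A - B * (x + d) - (rpow (Rabs (x + k)) s - A - B * x))
    with (rpow (Rabs ((x + k) + d)) s - rpow (Rabs (x + k)) s + - (B * d)).
  2:{ replace (x + k + d) with (x + d + k) by ring. ring. }
  eapply Rle_trans; [apply Rabs_triang |]. rewrite Rabs_Ropp, (Rabs_mult B).
  pose proof (rpow_abs_lipschitz s Hs (x + k) d Hd) as H.
  pose proof (jb_ge1 x) as Hj. pose proof (Rabs_pos d).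
  assert (H2 : 1 + Rabs (x + k) <= (1 + Rabs k) ^ 2 * jb x).
  { pose proof (Rabs_triang x k). pose proof (Rabs_pos x). unfold jb in *. nra. }
  assert (H3 : 8 * (1 + Rabs (x + k)) * Rabs d <= 8 * ((1 + Rabs k) ^ 2 * jb x) * Rabs d).
  { apply Rmult_le_compat_r; lra. }
  assert (H4 : Rabs B * Rabs d <= Rabs B * jb x * Rabs d).
  { apply Rmult_le_compat_r; [lra |]. nra. }
  assert (0 <= jb x * Rabs d) by (apply Rmult_le_pos; lra).
  nra.
- intros d Hd. rewrite !Hp.
  replace (rpow (Rabs (x + d + k)) s - A - B * (x + d) + (rpow (Rabs (x - d + k)) s - A - B * (x - d))
     - 2 * (rpow (Rabs (x + k)) s - A - B * x))
    with (rpow (Rabs ((x + k) + d)) s + rpow (Rabs ((x + k) - d)) s - 2 * rpow (Rabs (x + k)) s).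
  2:{ replace (x + k + d) with (x + d + k) by ring. replace (x + k - d) with (x - d + k) by ring. ring. }
  eapply Rle_trans; [apply rpow_abs_second_difference; [exact Hs | exact Hd] |].
  fold s. assert (0 < Rpower d s) by apply exp_pos. pose proof (pow2_ge_0 (1 + Rabs k)). nra.
Qed.

(** * Fourier integrals *)

(** [am_size] asks for one power of [jb] beyond integrability, which pays for a derivative in [x] of
    the oscillatory integral; [am_diff2] pays for its decay. *)
Record amplitude (s : R) (h : R -> R) (C : R) : Prop := {
  am_cont : forall x, continuous h x;
  am_size : forall x, Rabs (h x) * jb x <= C * wt s x;
  am_diff2 : forall x d, 0 < d <= 1 -> Rabs (h (x + d) + h (x - d) - 2 * h x) <= C * Rpower d s * wt s x }.

Lemma amplitude_plus (s : R) (h g : R -> R) (C D : R) :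
  amplitude s h C -> amplitude s g D -> amplitude s (fun x => h x + g x) (C + D).
Proof.
intros [H1 H2 H3] [G1 G2 G3]. constructor.
- intros x. now apply (continuous_plus h g).
- intros x. specialize (H2 x). specialize (G2 x). pose proof (Rabs_triang (h x) (g x)). pose proof (jb_ge1 x). nra.
- intros x d Hd. specialize (H3 x d Hd). specialize (G3 x d Hd).
  replace (h (x + d) + g (x + d) + (h (x - d) + g (x - d)) - 2 * (h x + g x))
    with ((h (x + d) + h (x - d) - 2 * h x) + (g (x + d) + g (x - d) - 2 * g x)) by ring.
  eapply Rle_trans; [apply Rabs_triang | lra].
Qed.

Lemma amplitude_opp (s : R) (h : R -> R) (C : R) : amplitude s h C -> amplitude s (fun x => - h x) C.
Proof.
intros [H1 H2 H3]. constructor.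
- intros x. now apply (continuous_opp h).
- intros x. rewrite Rabs_Ropp. auto.
- intros x d Hd. replace (- h (x + d) + - h (x - d) - 2 * - h x) with (- (h (x + d) + h (x - d) - 2 * h x)) by ring.
  rewrite Rabs_Ropp. auto.
Qed.

(** The exponent [5] adds up [2] for the growth of [p], [1] for the factor [jb] in [am_size], and
    [2] to dominate [wt s] for [s < 2]. *)
Lemma symbol_times_rapid (s : R) (p u u1 u2 : R -> R) (C D : R) : 1 < s < 2 ->
  symbol_like s p C ->
  (forall x, is_derive u x (u1 x)) -> (forall x, is_derive u1 x (u2 x)) ->
  (forall x, Rabs (u x) * jb x ^ 5 <= D) -> (forall x, Rabs (u1 x) * jb x ^ 5 <= D) ->
  (forall x, Rabs (u2 x) * jb x ^ 5 <= D) ->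
  exists E, amplitude s (fun x => p x * u x) E.
Proof.
intros Hs [P0 P1 P2] Hu1 Hu2 B0 B1 B2.
assert (HC : 0 <= C).
{ specialize (P0 0). pose proof (Rabs_pos (p 0)). unfold jb in P0. rewrite Rabs_R0 in P0. lra. }
assert (HD : 0 <= D).
{ specialize (B0 0). pose proof (Rabs_pos (u 0)). unfold jb in B0. rewrite Rabs_R0 in B0. lra. }
assert (Hdiv : forall y x, Rabs y * jb x ^ 5 <= D -> Rabs y <= D * / jb x ^ 5).
{ intros y x H. pose proof (jb_ge1 x). assert (0 < jb x ^ 5) by (apply pow_lt; lra).
  apply (Rmult_le_reg_r (jb x ^ 5)); [lra |]. rewrite Rmult_assoc, Rinv_l by lra. lra. }
(* A displacement of at most [1] changes [jb] by a factor at most [2], whence [32 = 2 ^ 5]. *)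
assert (Hloc : forall (v : R -> R) x z, (forall x, Rabs (v x) * jb x ^ 5 <= D) -> Rabs (z - x) <= 1 ->
  Rabs (v z) <= 32 * D * / jb x ^ 5).
{ intros v x z Hv Hz. eapply Rle_trans; [apply Hdiv, Hv |].
  pose proof (jb_ge1 x). pose proof (jb_ge1 z). pose proof (jb_shift x z Hz).
  replace (32 * D * / jb x ^ 5) with (D * / (jb x / 2) ^ 5) by (field; lra).
  apply Rmult_le_compat_l; [lra |]. apply Rinv_le_contravar; [apply pow_lt; lra |]. apply pow_incr. lra. }
assert (Hj : forall x i, (i <= 3)%nat -> jb x ^ i * / jb x ^ 5 <= wt s x).
{ intros x i Hi. pose proof (jb_ge1 x). eapply Rle_trans; [| apply (inv_jb2_le_wt s); lra].
  assert (0 < jb x ^ 2) by (apply pow_lt; lra). assert (0 < jb x ^ 5) by (apply pow_lt; lra).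
  apply Rle_trans with (jb x ^ 3 * / jb x ^ 5).
  - apply Rmult_le_compat_r; [left; now apply Rinv_0_lt_compat |]. apply Rle_pow; auto; lra.
  - right. field. lra. }
assert (Hulip : forall x d, Rabs d <= 1 -> Rabs (u (x + d) - u x) <= 32 * D * / jb x ^ 5 * Rabs d).
{ intros x d Hd. replace (Rabs d) with (Rabs (x + d - x)) by (f_equal; ring).
  apply (lipschitz_of_derive u u1); auto. intros z Hz. apply Hloc; auto.
  replace (x + d - x) with d in Hz by ring. lra. }
assert (Hu2d : forall x d, 0 < d <= 1 -> Rabs (u (x + d) + u (x - d) - 2 * u x) <= 2 * (32 * D * / jb x ^ 5) * d ^ 2).
{ intros x d Hd. apply (second_difference_bound u u1 u2); auto. intros z Hz. apply Hloc; auto.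
  rewrite (Rabs_pos_eq d) in Hz by lra. lra. }
exists (200 * C * D + C * D). constructor.
- intros x. apply (continuous_mult p u).
  + apply continuous_of_eps. intros e He.
    assert (Hq : 0 < C * jb x + 1) by (pose proof (jb_ge1 x); nra).
    assert (Hq1 : 0 < e / (C * jb x + 1)) by (apply Rdiv_lt_0_compat; lra).
    exists (Rmin 1 (e / (C * jb x + 1))). split; [apply Rmin_pos; lra |]. intros y Hy.
    assert (Hy1 : Rabs (y - x) <= 1) by (left; eapply Rlt_le_trans; [exact Hy | apply Rmin_l]).
    assert (Hy2 : Rabs (y - x) < e / (C * jb x + 1)) by (eapply Rlt_le_trans; [exact Hy | apply Rmin_r]).
    specialize (P1 x (y - x) Hy1). replace (x + (y - x)) with y in P1 by ring.
    apply (Rmult_lt_compat_l (C * jb x + 1)) in Hy2; [| lra].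
    replace ((C * jb x + 1) * (e / (C * jb x + 1))) with e in Hy2 by (field; lra).
    pose proof (Rabs_pos (y - x)). lra.
  + apply (@ex_derive_continuous R_AbsRing R_NormedModule). exists (u1 x). apply Hu1.
- intros x. rewrite Rabs_mult. pose proof (jb_ge1 x). pose proof (Hdiv (u x) x (B0 x)) as Hux.
  assert (0 < / jb x ^ 5) by (apply Rinv_0_lt_compat, pow_lt; lra).
  apply Rle_trans with (C * jb x ^ 2 * (D * / jb x ^ 5) * jb x).
  + apply Rmult_le_compat_r; [lra |]. apply Rmult_le_compat; auto using Rabs_pos.
  + replace (C * jb x ^ 2 * (D * / jb x ^ 5) * jb x) with (C * D * (jb x ^ 3 * / jb x ^ 5)) by ring.
    pose proof (Hj x 3%nat ltac:(lia)) as H3. assert (0 <= C * D) by (apply Rmult_le_pos; lra).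
    assert (C * D * (jb x ^ 3 * / jb x ^ 5) <= C * D * wt s x) by (apply Rmult_le_compat_l; lra).
    pose proof (wt_pos s x). assert (0 <= C * D * wt s x) by (apply Rmult_le_pos; lra). lra.
- intros x d Hd. pose proof (jb_ge1 x) as Hjx.
  pose (r := / jb x ^ 5).
  assert (Hr : 0 < r) by (apply Rinv_0_lt_compat, pow_lt; lra).
  assert (Hds : d ^ 2 <= Rpower d s).
  { rewrite <- Rpower_pow by lra. replace (INR 2) with 2 by (simpl; ring). unfold Rpower. 
    destruct (Req_dec d 1) as [-> | Hd1]; [rewrite ln_1, !Rmult_0_r; lra |].
    assert (ln d < 0) by (rewrite <- ln_1; apply ln_increasing; lra).
    left. apply exp_increasing. nra. }
  assert (Hds0 : 0 < d ^ 2) by (apply pow_lt; lra).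
  assert (Hda : Rabs d <= 1) by (rewrite Rabs_pos_eq; lra).
  assert (Hdm : Rabs (- d) <= 1) by (rewrite Rabs_Ropp; lra).
  (* Leibniz rule for second differences. Its four terms have the constants [1], [64], [32] and
     [32], all covered by [201]. *)
  replace (p (x + d) * u (x + d) + p (x - d) * u (x - d) - 2 * (p x * u x)) with
    (u x * (p (x + d) + p (x - d) - 2 * p x) + p x * (u (x + d) + u (x - d) - 2 * u x)
     + (p (x + d) - p x) * (u (x + d) - u x) + (p (x + - d) - p x) * (u (x + - d) - u x)).
  2:{ replace (x + - d) with (x - d) by ring. ring. }
  pose proof (Hdiv (u x) x (B0 x)) as E0. fold r in E0.
  pose proof (Hulip x d Hda) as E1. pose proof (Hulip x (- d) Hdm) as E2. fold r in E1, E2.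
  pose proof (Hu2d x d Hd) as E3. fold r in E3.
  pose proof (P0 x) as F0. pose proof (P1 x d Hda) as F1. pose proof (P1 x (- d) Hdm) as F2.
  pose proof (P2 x d ltac:(lra)) as F3. rewrite Rabs_Ropp in E2, F2. rewrite (Rabs_pos_eq d) in * by lra.
  assert (T1 : Rabs (u x * (p (x + d) + p (x - d) - 2 * p x)) <= C * D * Rpower d s * (jb x ^ 0 * r)).
  { rewrite Rabs_mult. apply Rle_trans with ((D * r) * (C * Rpower d s)); [| right; simpl; ring].
    apply Rmult_le_compat; auto using Rabs_pos. }
  assert (T2 : Rabs (p x * (u (x + d) + u (x - d) - 2 * u x)) <= 64 * (C * D) * d ^ 2 * (jb x ^ 2 * r)).
  { rewrite Rabs_mult. apply Rle_trans with ((C * jb x ^ 2) * (2 * (32 * D * r) * d ^ 2)); [| right; ring].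
    apply Rmult_le_compat; auto using Rabs_pos. }
  assert (T3 : Rabs ((p (x + d) - p x) * (u (x + d) - u x)) <= 32 * (C * D) * d ^ 2 * (jb x ^ 1 * r)).
  { rewrite Rabs_mult. apply Rle_trans with ((C * jb x * d) * (32 * D * r * d)); [| right; ring].
    apply Rmult_le_compat; auto using Rabs_pos. }
  assert (T4 : Rabs ((p (x + - d) - p x) * (u (x + - d) - u x)) <= 32 * (C * D) * d ^ 2 * (jb x ^ 1 * r)).
  { rewrite Rabs_mult. apply Rle_trans with ((C * jb x * d) * (32 * D * r * d)); [| right; ring].
    apply Rmult_le_compat; auto using Rabs_pos. }
  assert (HCD : 0 <= C * D) by (apply Rmult_le_pos; lra).
  assert (Hstep : forall q i, 0 <= q -> (i <= 3)%nat -> q * (C * D) * d ^ 2 * (jb x ^ i * r) <= q * (C * D) * Rpower d s * wt s x).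
  { intros q i Hq Hi. pose proof (Hj x i Hi) as Hw. fold r in Hw.
    apply Rmult_le_compat; auto.
    - repeat apply Rmult_le_pos; lra.
    - apply Rmult_le_pos; [apply pow_le; lra | lra].
    - apply Rmult_le_compat_l; [apply Rmult_le_pos; lra | exact Hds]. }
  pose proof (Hstep 64 2%nat ltac:(lra) ltac:(lia)). pose proof (Hstep 32 1%nat ltac:(lra) ltac:(lia)).
  assert (T1' : C * D * Rpower d s * (jb x ^ 0 * r) <= C * D * Rpower d s * wt s x).
  { apply Rmult_le_compat_l; [apply Rmult_le_pos; lra |]. apply (Hj x 0%nat). lia. }
  assert (Hpos : 0 <= C * D * Rpower d s * wt s x).
  { pose proof (wt_pos s x). apply Rmult_le_pos; [apply Rmult_le_pos |]; lra. }
  eapply Rle_trans; [apply Rabs_triang |].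
  eapply Rle_trans; [apply Rplus_le_compat_r, Rabs_triang |].
  eapply Rle_trans; [apply Rplus_le_compat_r, Rplus_le_compat_r, Rabs_triang |].
  replace ((200 * C * D + C * D) * Rpower d s * wt s x) with (201 * (C * D * Rpower d s * wt s x)) by ring.
  lra.
Qed.

(** * Fourier transforms of real test functions *)

Definition real_test (f : R -> R) (M : R) : Prop :=
  (forall n x, ex_derive_n f n x) /\ (forall x, M < Rabs x -> f x = 0).

Lemma real_test_ex_derive (f : R -> R) (M x : R) : real_test f M -> ex_derive f x.
Proof. intros [H _]. apply (H 1%nat x). Qed.

Lemma real_test_continuous (f : R -> R) (M x : R) : real_test f M -> continuous f x.
Proof.
intros H. apply (@ex_derive_continuous R_AbsRing R_NormedModule). now apply (real_test_ex_derive f M).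
Qed.

Lemma real_test_Derive (f : R -> R) (M : R) : real_test f M -> real_test (Derive f) M.
Proof.
intros [H1 H2]. split.
- intros [| n] x; [exact I |]. simpl.
  apply (ex_derive_ext (Derive_n f (n + 1))).
  + intros t. rewrite <- (Derive_n_comp f n 1 t). reflexivity.
  + replace (n + 1)%nat with (S n) by lia. apply (H1 (S (S n)) x).
- intros x Hx. rewrite (Derive_ext_loc f (fun _ => 0)); [apply Derive_const |].
  assert (Hd : 0 < Rabs x - M) by lra.
  exists (mkposreal _ Hd). intros y Hy. apply H2.
  unfold ball in Hy; simpl in Hy; unfold AbsRing_ball, minus, plus, opp, abs in Hy; simpl in Hy.
  pose proof (Rabs_triang y (x - y)) as Ht. replace (y + (x - y)) with x in Ht by ring.
  rewrite (Rabs_minus_sym x y) in Ht. unfold Rminus in Ht. lra.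
Qed.

(** Differentiating a Fourier transform multiplies the function by [x], so the class must be stable
    under this operation; the Leibniz formula at every order gives it. *)
Lemma real_test_mul_id (f : R -> R) (M : R) : real_test f M -> real_test (fun x => x * f x) M.
Proof.
intros [H1 H2]. split; [| intros x Hx; rewrite H2 by exact Hx; ring].
assert (G : forall n x, Derive_n (fun x => x * f x) n x = x * Derive_n f n x + INR n * Derive_n f (pred n) x).
{ induction n as [| n IH]; intros x; [simpl; ring |].
  change (Derive_n (fun x => x * f x) (S n) x) with (Derive (Derive_n (fun x => x * f x) n) x).
  rewrite (Derive_ext _ (fun x => x * Derive_n f n x + INR n * Derive_n f (pred n) x)) by exact IH.
  apply is_derive_unique.
  assert (D1 : is_derive (Derive_n f n) x (Derive_n f (S n) x)) by (apply Derive_correct, (H1 (S n) x)).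
  assert (D2 : is_derive (fun x => INR n * Derive_n f (pred n) x) x (INR n * Derive_n f n x)).
  { destruct n as [| n]; [| apply is_derive_scal, Derive_correct, (H1 (S n) x)].
    simpl. apply (is_derive_ext (fun _ => 0)); [intros; symmetry; apply Rmult_0_l |]. rewrite Rmult_0_l. apply @is_derive_const. }
  replace (x * Derive_n f (S n) x + INR (S n) * Derive_n f (Nat.pred (S n)) x)
    with ((1 * Derive_n f n x + x * Derive_n f (S n) x) + INR n * Derive_n f n x).
  - apply (is_derive_plus (fun x => x * Derive_n f n x)); [| exact D2].
    apply (is_derive_mult (fun x => x) (Derive_n f n)); [apply (@is_derive_id R_AbsRing) | exact D1 | intros; apply Rmult_comm].
  - rewrite S_INR. simpl Nat.pred. ring. }
intros [| n] x; [exact I |]. simpl.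
apply (ex_derive_ext (fun x => x * Derive_n f n x + INR n * Derive_n f (pred n) x)); [intros; symmetry; apply G |].
apply (ex_derive_plus (fun x => x * Derive_n f n x)).
- apply (ex_derive_mult (fun x => x)); [apply ex_derive_id | apply (H1 (S n) x)].
- destruct n as [| n].
  + apply (ex_derive_ext (fun _ => 0)); [intros; symmetry; apply Rmult_0_l | apply ex_derive_const].
  + apply ex_derive_scal, (H1 (S n) x).
Qed.

(** A cosine with a phase stands for the complex exponential. The window reaches [M + 1] because
    [real_test] makes [f] vanish where [M < Rabs x], so that the boundary terms of an integration by
    parts are zero. *)
Definition four (f : R -> R) (M t xi : R) : R :=
  RInt (fun x => cos (x * xi + t) * f x) (- (M + 1)) (M + 1).

Lemma continuous_cos_affine (a t x : R) : continuous (fun x => cos (x * a + t)) x.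
Proof. apply (@ex_derive_continuous R_AbsRing R_NormedModule). auto_derive. trivial. Qed.

Lemma continuous_cos_affine_mult (f : R -> R) (a t x : R) :
  continuous f x -> continuous (fun x => cos (x * a + t) * f x) x.
Proof. intros H. apply (continuous_mult (fun x => cos (x * a + t)) f); [apply continuous_cos_affine | exact H]. Qed.

Lemma four_bounded (f : R -> R) (M : R) : 0 <= M -> real_test f M ->
  exists C, forall t xi, Rabs (four f M t xi) <= C.
Proof.
intros HM Hf. assert (Hc : forall x, continuous f x) by (intros; now apply (real_test_continuous f M)).
assert (Hca : forall x, continuous (fun x => Rabs (f x)) x).
{ intros x. apply (continuous_comp f Rabs); [apply Hc | apply continuous_Rabs]. }
exists (RInt (fun x => Rabs (f x)) (- (M + 1)) (M + 1)). intros t xi. unfold four.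
apply (norm_RInt_le (fun x => cos (x * xi + t) * f x) (fun x => Rabs (f x)) (- (M + 1)) (M + 1)).
- lra.
- intros x _. change (norm (cos (x * xi + t) * f x)) with (Rabs (cos (x * xi + t) * f x)).
  rewrite Rabs_mult. pose proof (cos_abs_le1 (x * xi + t)). pose proof (Rabs_pos (f x)). nra.
- apply (@RInt_correct R_CompleteNormedModule), ex_RInt_cont. intros x. now apply continuous_cos_affine_mult.
- apply (@RInt_correct R_CompleteNormedModule), ex_RInt_cont, Hca.
Qed.

Lemma four_by_parts (f : R -> R) (M t xi : R) : 0 <= M -> real_test f M ->
  xi * four f M t xi = four (Derive f) M (t + PI / 2) xi.
Proof.
intros HM Hf. assert (Hc : forall x, continuous f x) by (intros; now apply (real_test_continuous f M)).
assert (Hc' : forall x, continuous (Derive f) x)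
  by (intros; now apply (real_test_continuous (Derive f) M), real_test_Derive).
assert (Hcos : forall x, cos (x * xi + (t + PI / 2)) = - sin (x * xi + t)).
{ intros x. replace (x * xi + (t + PI / 2)) with ((x * xi + t) + PI / 2) by ring.
  rewrite cos_plus, cos_PI2, sin_PI2. ring. }
assert (H : is_RInt (fun x => xi * (cos (x * xi + t) * f x) - cos (x * xi + (t + PI / 2)) * Derive f x)
  (- (M + 1)) (M + 1) 0).
{ assert (Hz : f (M + 1) = 0 /\ f (- (M + 1)) = 0).
  { destruct Hf as [_ Hf]. split; apply Hf; [| rewrite Rabs_Ropp]; rewrite Rabs_pos_eq; lra. }
  destruct Hz as [Hz1 Hz2].
  evar_last.
  - apply (is_RInt_derive (fun x => sin (x * xi + t) * f x)).
    + intros x _. rewrite Hcos.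
      evar_last; [apply (is_derive_mult (fun x => sin (x * xi + t)) f x (xi * cos (x * xi + t)) (Derive f x)) |].
      * auto_derive; [trivial | ring].
      * apply Derive_correct. now apply (real_test_ex_derive f M).
      * intros; apply Rmult_comm.
      * unfold plus, mult; simpl. ring.
    + intros x _. apply (continuous_minus (fun x => xi * (cos (x * xi + t) * f x)) (fun x => cos (x * xi + (t + PI / 2)) * Derive f x)).
      * apply (continuous_scal_r xi (fun x => cos (x * xi + t) * f x)). now apply continuous_cos_affine_mult.
      * now apply continuous_cos_affine_mult.
  - rewrite Hz1, Hz2. unfold minus, plus, opp; simpl. ring. }
apply (@is_RInt_unique R_CompleteNormedModule) in H.
assert (H' : RInt (fun x => xi * (cos (x * xi + t) * f x) - cos (x * xi + (t + PI / 2)) * Derive f x)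
  (- (M + 1)) (M + 1) = xi * four f M t xi - four (Derive f) M (t + PI / 2) xi).
{ unfold four.
  rewrite (RInt_minus (fun x => xi * (cos (x * xi + t) * f x)) (fun x => cos (x * xi + (t + PI / 2)) * Derive f x)).
  - rewrite (RInt_scal (fun x => cos (x * xi + t) * f x)); [reflexivity |].
    apply ex_RInt_cont. intros x. now apply continuous_cos_affine_mult.
  - apply ex_RInt_cont. intros x. apply (continuous_scal_r xi (fun x => cos (x * xi + t) * f x)).
    now apply continuous_cos_affine_mult.
  - apply ex_RInt_cont. intros x. now apply continuous_cos_affine_mult. }
lra.
Qed.

(** Differentiation under the integral sign: [cos_taylor] inside the integral leaves a remainder of
    [u ^ 2] times the integral of [x ^ 2 * Rabs (f x)]. *)
Lemma four_derive (f : R -> R) (M t xi : R) : 0 <= M -> real_test f M ->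
  is_derive (four f M t) xi (four (fun x => x * f x) M (t + PI / 2) xi).
Proof.
intros HM Hf. assert (Hc : forall x, continuous f x) by (intros; now apply (real_test_continuous f M)).
assert (Hcx : forall x, continuous (fun x => x * f x) x)
  by (intros; now apply (real_test_continuous _ M), real_test_mul_id).
assert (Hca : forall x, continuous (fun x => x ^ 2 * Rabs (f x)) x).
{ intros x. apply (continuous_mult (fun x => x ^ 2) (fun x => Rabs (f x))).
  - apply (@ex_derive_continuous R_AbsRing R_NormedModule). auto_derive. trivial.
  - apply (continuous_comp f Rabs); [apply Hc | apply continuous_Rabs]. }
apply (is_derive_of_quadratic _ _ _ (RInt (fun x => x ^ 2 * Rabs (f x)) (- (M + 1)) (M + 1))).
intros u _. unfold four.
pose (I1 := fun x => cos (x * (xi + u) + t) * f x). pose (I2 := fun x => cos (x * xi + t) * f x).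
pose (I3 := fun x => cos (x * xi + (t + PI / 2)) * (x * f x)).
assert (C1 : forall x, continuous I1 x) by (intros; now apply continuous_cos_affine_mult).
assert (C2 : forall x, continuous I2 x) by (intros; now apply continuous_cos_affine_mult).
assert (C3 : forall x, continuous I3 x).
{ intros x. apply (continuous_cos_affine_mult (fun x => x * f x)), Hcx. }
assert (C12 : forall x, continuous (fun x => minus (I1 x) (I2 x)) x) by (intros; now apply (continuous_minus I1 I2)).
assert (C3' : forall x, continuous (fun x => scal u (I3 x)) x) by (intros; now apply (continuous_scal_r u I3)).
fold I1 I2 I3.
replace (RInt I1 (- (M + 1)) (M + 1) - RInt I2 (- (M + 1)) (M + 1) - u * RInt I3 (- (M + 1)) (M + 1))
  with (RInt (fun x => minus (minus (I1 x) (I2 x)) (scal u (I3 x))) (- (M + 1)) (M + 1)).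
2:{ rewrite (RInt_minus (fun x => minus (I1 x) (I2 x)) (fun x => scal u (I3 x))) by (now apply ex_RInt_cont).
    rewrite (RInt_minus I1 I2) by (now apply ex_RInt_cont).
    rewrite (RInt_scal I3) by (now apply ex_RInt_cont). reflexivity. }
rewrite Rmult_comm.
change (u ^ 2 * RInt (fun x => x ^ 2 * Rabs (f x)) (- (M + 1)) (M + 1))
  with (scal (u ^ 2) (RInt (fun x => x ^ 2 * Rabs (f x)) (- (M + 1)) (M + 1))).
rewrite <- RInt_scal by (now apply ex_RInt_cont).
apply (norm_RInt_le (fun x => minus (minus (I1 x) (I2 x)) (scal u (I3 x)))
  (fun x => scal (u ^ 2) (x ^ 2 * Rabs (f x))) (- (M + 1)) (M + 1)).
- lra.
- intros x _.
  change (Rabs (I1 x - I2 x - u * I3 x) <= u ^ 2 * (x ^ 2 * Rabs (f x))). unfold I1, I2, I3.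
  replace (cos (x * (xi + u) + t) * f x - cos (x * xi + t) * f x - u * (cos (x * xi + (t + PI / 2)) * (x * f x)))
    with ((cos ((x * xi + t) + x * u) - cos (x * xi + t) - (x * u) * cos (x * xi + t + PI / 2)) * f x).
  2:{ replace (x * (xi + u) + t) with (x * xi + t + x * u) by ring.
      replace (x * xi + (t + PI / 2)) with (x * xi + t + PI / 2) by ring. ring. }
  rewrite Rabs_mult. pose proof (cos_taylor (x * xi + t) (x * u)). pose proof (Rabs_pos (f x)).
  replace (u ^ 2 * (x ^ 2 * Rabs (f x))) with ((x * u) ^ 2 * Rabs (f x)) by ring.
  now apply Rmult_le_compat_r.
- apply (@RInt_correct R_CompleteNormedModule), ex_RInt_cont. intros x.
  apply (continuous_minus (fun x => minus (I1 x) (I2 x)) (fun x => scal u (I3 x))); auto.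
- apply (@RInt_correct R_CompleteNormedModule), ex_RInt_cont. intros x.
  apply (continuous_scal_r (u ^ 2) (fun x => x ^ 2 * Rabs (f x))), Hca.
Qed.

(** Five integrations by parts bound [xi ^ 5] times the transform; [(1 + y) ^ 5 <= 32 (1 + y ^ 5)]
    converts this into a weight [jb ^ 5]. *)
Lemma four_rapid (f : R -> R) (M : R) : 0 <= M -> real_test f M ->
  exists C, forall t xi, Rabs (four f M t xi) * jb xi ^ 5 <= C.
Proof.
intros HM Hf.
assert (Hj : forall j (f : R -> R), real_test f M -> exists C, forall t xi, Rabs (xi ^ j * four f M t xi) <= C).
{ induction j as [| j IH]; intros g Hg.
  - destruct (four_bounded g M HM Hg) as [C HC]. exists C. intros. simpl. rewrite Rmult_1_l. auto.
  - destruct (IH (Derive g) (real_test_Derive g M Hg)) as [C HC]. exists C. intros t xi.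
    replace (xi ^ S j * four g M t xi) with (xi ^ j * (xi * four g M t xi)) by (simpl; ring).
    rewrite four_by_parts; auto. }
destruct (Hj 0%nat f Hf) as [C0 HC0]. destruct (Hj 5%nat f Hf) as [C5 HC5].
exists (32 * (C0 + C5)). intros t xi.
specialize (HC0 t xi). specialize (HC5 t xi). rewrite Rabs_mult in HC0, HC5. rewrite <- !RPow_abs in *.
rewrite pow_O, Rmult_1_l in HC0.
assert (Hjb : jb xi ^ 5 <= 32 * (1 + Rabs xi ^ 5)).
{ unfold jb. pose proof (Rabs_pos xi). assert (0 <= Rabs xi ^ 5) by (apply pow_le; lra).
  destruct (Rle_dec (Rabs xi) 1) as [H1 | H1].
  - apply Rle_trans with (2 ^ 5); [apply pow_incr; lra | lra].
  - apply Rle_trans with ((2 * Rabs xi) ^ 5); [apply pow_incr; lra |]. rewrite Rpow_mult_distr. lra. }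
pose proof (Rabs_pos (four f M t xi)).
apply Rle_trans with (Rabs (four f M t xi) * (32 * (1 + Rabs xi ^ 5))); [now apply Rmult_le_compat_l |].
replace (Rabs (four f M t xi) * (32 * (1 + Rabs xi ^ 5)))
  with (32 * (Rabs (four f M t xi) + Rabs xi ^ 5 * Rabs (four f M t xi))) by ring. lra.
Qed.

Lemma symbol_times_four (s : R) (p : R -> R) (C : R) (f : R -> R) (M t : R) : 1 < s < 2 ->
  symbol_like s p C -> 0 <= M -> real_test f M ->
  exists E, amplitude s (fun x => p x * four f M t x) E.
Proof.
intros Hs Hp HM Hf.
pose proof (real_test_mul_id f M Hf) as Hf1. pose proof (real_test_mul_id _ M Hf1) as Hf2.
destruct (four_rapid f M HM Hf) as [D0 B0]. destruct (four_rapid _ M HM Hf1) as [D1 B1].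
destruct (four_rapid _ M HM Hf2) as [D2 B2].
apply (symbol_times_rapid s p (four f M t) (four (fun x => x * f x) M (t + PI / 2))
  (four (fun x => x * (x * f x)) M (t + PI / 2 + PI / 2)) C (Rmax D0 (Rmax D1 D2))); auto.
- intros x. now apply four_derive.
- intros x. now apply (four_derive (fun x => x * f x)).
- intros x. eapply Rle_trans; [apply B0 | apply Rmax_l].
- intros x. eapply Rle_trans; [apply B1 |]. eapply Rle_trans; [apply Rmax_l | apply Rmax_r].
- intros x. eapply Rle_trans; [apply B2 |]. eapply Rle_trans; [apply Rmax_r | apply Rmax_r].
Qed.

(** * Oscillatory integrals of amplitudes: decay and regularity *)

Definition osc (h : R -> R) (t x : R) : R :=
  RInt_gen (V := R_CompleteNormedModule) (fun xi => cos (xi * x + t) * h xi) minf pinf.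

Lemma is_RInt_gen_shift (f : R -> R) (l d : R) : (forall x, continuous f x) ->
  is_RInt_gen f minf pinf l -> is_RInt_gen (fun x => f (x + d)) minf pinf l.
Proof.
intros Hc H. 
assert (Hc' : forall x, continuous (fun x => f (x + d)) x).
{ intros x. apply (continuous_comp (fun x => x + d) f); [| apply Hc].
  apply (continuous_plus (fun x : R => x) (fun _ => d)); [apply continuous_id | apply continuous_const]. }
apply is_RInt_gen_window; [intros; now apply ex_RInt_cont |].
intros e He. destruct (is_RInt_gen_window_inv f l e H He) as [A [HA HA']].
exists (A + Rabs d). intros a b Ha Hb.
assert (Hd1 : d <= Rabs d) by apply Rle_abs. assert (Hd2 : - d <= Rabs d) by (rewrite <- Rabs_Ropp; apply Rle_abs).
replace (RInt (fun x => f (x + d)) a b) with (RInt f (a + d) (b + d)); [apply HA'; lra |].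
replace (a + d) with (1 * a + d) by ring. replace (b + d) with (1 * b + d) by ring.
rewrite <- (RInt_comp_lin f 1 d a b); [| apply ex_RInt_cont; auto].
apply RInt_ext. intros x _. unfold scal; simpl; unfold mult; simpl. rewrite !Rmult_1_l. reflexivity.
Qed.

Lemma is_RInt_gen_limit (f : R -> R) (l e : R) : is_RInt_gen f minf pinf l -> 0 < e ->
  exists A, 0 <= A /\ forall B, A < B -> Rabs (RInt f (- B) B - l) < e.
Proof.
intros H He. destruct (is_RInt_gen_window_inv f l e H He) as [A [HA HA']].
exists A. split; [exact HA |]. intros B HB. apply HA'; lra.
Qed.

Lemma is_RInt_gen_odd (f : R -> R) (l : R) : (forall x, continuous f x) ->
  (forall x, f (- x) = - f x) -> is_RInt_gen f minf pinf l -> l = 0.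
Proof.
intros Hc Hodd H. apply NNPP. intros Hl.
destruct (is_RInt_gen_limit f l (Rabs l) H (Rabs_pos_lt _ Hl)) as [A [HA HA']].
specialize (HA' (A + 1) ltac:(lra)).
assert (Hz : RInt f (- (A + 1)) (A + 1) = 0).
{ assert (H1 : RInt f (- (A + 1)) (A + 1) = - RInt f (- (A + 1)) (A + 1)); [| lra].
  rewrite RInt_opp_var at 1 by exact Hc. rewrite Ropp_involutive.
  rewrite (RInt_ext _ (fun x => opp (f x))) by (intros; apply Hodd).
  rewrite (RInt_opp f) by (now apply ex_RInt_cont). reflexivity. }
rewrite Hz, Rminus_0_l, Rabs_Ropp in HA'. lra.
Qed.

Lemma atan_near_PI2 (e : R) : 0 < e -> exists A, 0 <= A /\ forall x, A < x -> PI / 2 - e < atan x.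
Proof.
intros He. pose proof PI_RGT_0. pose (q := Rmin (e / 2) (PI / 4)).
assert (Hq : 0 < q) by (apply Rmin_pos; lra).
assert (Hq1 : q <= e / 2) by apply Rmin_l. assert (Hq2 : q <= PI / 4) by apply Rmin_r.
exists (Rmax 0 (tan (PI / 2 - q))). split; [apply Rmax_l |]. intros x Hx.
assert (Hx' : tan (PI / 2 - q) < x) by (eapply Rle_lt_trans; [apply Rmax_r | exact Hx]).
apply atan_increasing in Hx'. rewrite atan_tan in Hx' by lra. lra.
Qed.

Lemma is_RInt_gen_poisson (e y : R) : 0 < e ->
  is_RInt_gen (fun x => e / (e ^ 2 + (x - y) ^ 2)) minf pinf PI.
Proof.
intros He.
assert (Hpos : forall x, 0 < e ^ 2 + (x - y) ^ 2) by (intros x; pose proof (pow2_ge_0 (x - y)); nra).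
assert (Hc : forall x, continuous (fun x => e / (e ^ 2 + (x - y) ^ 2)) x).
{ intros x. apply (@ex_derive_continuous R_AbsRing R_NormedModule). auto_derive.
  specialize (Hpos x). simpl in Hpos. lra. }
apply is_RInt_gen_window; [intros; now apply ex_RInt_cont |].
intros q Hq. destruct (atan_near_PI2 (q / 2) ltac:(lra)) as [A [HA HA']].
exists (e * A + Rabs y). intros a b Ha Hb.
assert (HR : RInt (fun x => e / (e ^ 2 + (x - y) ^ 2)) a b = atan ((b - y) / e) - atan ((a - y) / e)).
{ apply is_RInt_unique. apply (is_RInt_derive (fun x => atan ((x - y) / e))).
  - intros x _. auto_derive; [trivial |]. unfold Rsqr. specialize (Hpos x). simpl in Hpos. field.
    repeat split; try lra.
  - intros x _. apply Hc. }
rewrite HR.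
assert (Hy1 : y <= Rabs y) by apply Rle_abs. assert (Hy2 : - y <= Rabs y) by (rewrite <- Rabs_Ropp; apply Rle_abs).
assert (H1 : PI / 2 - q / 2 < atan ((b - y) / e)).
{ apply HA'. apply (Rmult_lt_reg_r e); [exact He |]. unfold Rdiv. rewrite Rmult_assoc, Rinv_l by lra. lra. }
assert (H2 : PI / 2 - q / 2 < atan (- ((a - y) / e))).
{ apply HA'. apply (Rmult_lt_reg_r e); [exact He |].
  replace (- ((a - y) / e) * e) with (y - a) by (field; lra). lra. }
rewrite atan_opp in H2. pose proof (atan_bound ((b - y) / e)). pose proof (atan_bound ((a - y) / e)).
apply Rabs_def1; lra.
Qed.

Section Oscillatory.

Variables (s : R) (Hs : 1 < s < 2) (h : R -> R) (C : R).
Hypothesis (Hh : amplitude s h C).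

Let Hs1 : 1 < s := proj1 Hs.

Lemma am_const_nonneg : 0 <= C.
Proof.
pose proof (am_size s h C Hh 0) as H. pose proof (Rabs_pos (h 0)). pose proof (wt_pos s 0). pose proof (jb_ge1 0).
assert (0 <= Rabs (h 0) * jb 0) by (apply Rmult_le_pos; lra). nra.
Qed.

Lemma am_le (x : R) : Rabs (h x) <= C * wt s x.
Proof.
pose proof (am_size s h C Hh x). pose proof (jb_ge1 x). pose proof (Rabs_pos (h x)). nra.
Qed.

Lemma osc_dominated (t x : R) : dominated s C (fun xi => cos (xi * x + t) * h xi).
Proof.
split.
- intros xi. apply continuous_cos_affine_mult, (am_cont s h C Hh).
- intros xi. rewrite Rabs_mult. pose proof (cos_abs_le1 (xi * x + t)). pose proof (am_le xi).
  pose proof (Rabs_pos (h xi)). nra.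
Qed.

Lemma is_RInt_gen_ex_value (f : R -> R) (l : R) : is_RInt_gen f minf pinf l ->
  is_RInt_gen f minf pinf (RInt_gen (V := R_CompleteNormedModule) f minf pinf).
Proof. intros H. rewrite (is_RInt_gen_unique f l H). exact H. Qed.

Lemma osc_correct (t x : R) : is_RInt_gen (fun xi => cos (xi * x + t) * h xi) minf pinf (osc h t x).
Proof.
destruct (dominated_integral s Hs1 _ C (osc_dominated t x)) as [l [Hl _]]. now apply (is_RInt_gen_ex_value _ l).
Qed.

Lemma wt_integral : exists Iw, is_RInt_gen (wt s) minf pinf Iw /\ 0 <= Iw.
Proof.
assert (Hd : dominated s 1 (wt s)).
{ split; [apply continuous_wt |]. intros x. rewrite Rabs_pos_eq by (left; apply wt_pos). lra. }
destruct (dominated_integral s Hs1 _ 1 Hd) as [Iw [HI _]]. exists Iw. split; [exact HI |].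
apply (is_RInt_gen_le (fun _ => 0) (wt s)).
- intros; apply ex_RInt_const.
- intros; apply ex_RInt_cont, continuous_wt.
- intros x. left. apply wt_pos.
- apply is_RInt_gen_window; [intros; apply ex_RInt_const |]. intros e He. exists 0. intros a b _ _.
  rewrite RInt_const. unfold scal; simpl; unfold mult; simpl. rewrite Rmult_0_r, Rminus_0_r, Rabs_R0. exact He.
- exact HI.
Qed.

Lemma integral_wt_bound (f : R -> R) (l B Iw : R) : is_RInt_gen (wt s) minf pinf Iw ->
  (forall x, continuous f x) -> (forall x, Rabs (f x) <= B * wt s x) ->
  is_RInt_gen f minf pinf l -> Rabs l <= B * Iw.
Proof.
intros HI Hc HB Hl. apply (is_RInt_gen_abs_le f (fun x => B * wt s x) l (B * Iw)); auto.
- intros x. apply (continuous_scal_r B (wt s)), continuous_wt.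
- apply (is_RInt_gen_scal (wt s) B Iw HI).
Qed.

Lemma osc_decay : exists D, forall t x, Rabs (osc h t x) <= D * wt s x.
Proof.
destruct wt_integral as [Iw [HI HI0]]. pose proof am_const_nonneg as HC.
pose proof PI_RGT_0 as HPI. assert (HPI1 : 1 < PI) by (pose proof PI2_1; lra).
exists (C * Iw * Rpower (1 + PI) s + C * Rpower PI s * Iw * Rpower 2 s). intros t x.
assert (T1 : 0 <= C * Iw * Rpower (1 + PI) s).
{ apply Rmult_le_pos; [apply Rmult_le_pos; lra | left; apply exp_pos]. }
assert (T2 : 0 <= C * Rpower PI s * Iw * Rpower 2 s).
{ apply Rmult_le_pos; [| left; apply exp_pos]. apply Rmult_le_pos; [| lra].
  apply Rmult_le_pos; [lra | left; apply exp_pos]. }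
pose proof (wt_pos s x) as Hw. pose proof (Rabs_pos x) as Hx0.
(* Below [PI] the trivial bound suffices, [wt s] being bounded below there. Above it, [PI / Rabs x]
   is at most [1], the range covered by [am_diff2]. *)
destruct (Rlt_le_dec (Rabs x) PI) as [Hx | Hx].
- assert (H1 : Rabs (osc h t x) <= C * Iw).
  { destruct (osc_dominated t x) as [Hc Hd]. apply (integral_wt_bound _ _ C Iw HI Hc Hd), osc_correct. }
  assert (H2 : 1 <= Rpower (1 + PI) s * wt s x).
  { unfold wt. rewrite Rpower_Ropp. apply (Rmult_le_reg_r (Rpower (1 + Rabs x) s)); [apply exp_pos |].
    rewrite Rmult_assoc, Rinv_l by (apply Rgt_not_eq, exp_pos). rewrite Rmult_1_l, Rmult_1_r.
    apply Rle_Rpower_l; lra. }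
  assert (0 <= C * Iw) by (apply Rmult_le_pos; lra).
  assert (C * Iw * 1 <= C * Iw * (Rpower (1 + PI) s * wt s x)) by (apply Rmult_le_compat_l; lra).
  assert (0 <= C * Rpower PI s * Iw * Rpower 2 s * wt s x) by (apply Rmult_le_pos; lra). lra.
- pose (d := PI / Rabs x).
  assert (Hd0 : 0 < d) by (apply Rdiv_lt_0_compat; lra).
  assert (Hd1 : d <= 1).
  { unfold d. apply (Rmult_le_reg_r (Rabs x)); [lra |]. unfold Rdiv. rewrite Rmult_assoc, Rinv_l by lra. lra. }
  (* [d] is half a period of the phase, so shifting by [d] turns the integral into one of second differences. *)
  assert (Hcos : forall xi, cos ((xi + d) * x + t) = - cos (xi * x + t) /\ cos ((xi - d) * x + t) = - cos (xi * x + t)).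
  { intros xi.
    assert (Hdx : d * x = PI \/ d * x = - PI).
    { unfold d. unfold Rabs in *. destruct (Rcase_abs x); [right; field; lra | left; field; lra]. }
    replace ((xi + d) * x + t) with ((xi * x + t) + d * x) by ring.
    replace ((xi - d) * x + t) with ((xi * x + t) - d * x) by ring.
    destruct Hdx as [-> | ->]; rewrite cos_plus, cos_minus, ?sin_neg, ?cos_neg, sin_PI, cos_PI; split; ring. }
  assert (Hc : forall xi, continuous h xi) by apply (am_cont s h C Hh).
  assert (Hosc := osc_correct t x). destruct (osc_dominated t x) as [Hcc _].
  pose proof (is_RInt_gen_shift _ _ d Hcc Hosc) as P1.
  pose proof (is_RInt_gen_shift _ _ (- d) Hcc Hosc) as P2.
  simpl in P1, P2.
  (* Each shift reverses the sign of the cosine, so the two shifted terms give [- 2 osc] together,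
     and the central term gives [- 2 osc] again. *)
  assert (P3 : is_RInt_gen (fun xi => cos (xi * x + t) * (h (xi + d) + h (xi - d) - 2 * h xi)) minf pinf
     (- 4 * osc h t x)).
  { pose proof (is_RInt_gen_plus _ _ _ _ P1 P2) as P4.
    pose proof (is_RInt_gen_scal _ 2 _ Hosc) as P5.
    pose proof (is_RInt_gen_plus _ _ _ _ P4 P5) as P6.
    pose proof (is_RInt_gen_scal _ (- 1) _ P6) as P7.
    evar_last.
    - refine (is_RInt_gen_ext _ _ _ _ P7).
      apply filter_forall. intros ab xi _. destruct (Hcos xi) as [E1 E2].
      unfold scal, plus; simpl; unfold mult; simpl.
      rewrite E1. replace (xi + - d) with (xi - d) by ring. rewrite E2. ring.
    - unfold scal, plus; simpl; unfold mult; simpl. ring. }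
  assert (Hb : Rabs (-4 * osc h t x) <= C * Rpower d s * Iw).
  { apply (integral_wt_bound _ _ _ Iw HI) with (3 := P3).
    - intros xi. apply (continuous_cos_affine_mult (fun xi => h (xi + d) + h (xi - d) - 2 * h xi)).
      apply (continuous_minus (fun xi => h (xi + d) + h (xi - d)) (fun xi => 2 * h xi)).
      + apply (continuous_plus (fun xi => h (xi + d)) (fun xi => h (xi - d))).
        * apply (continuous_comp (fun xi => xi + d) h); [| apply Hc].
          apply (continuous_plus (fun x : R => x) (fun _ => d)); [apply continuous_id | apply continuous_const].
        * apply (continuous_comp (fun xi => xi - d) h); [| apply Hc].
          apply (continuous_minus (fun x : R => x) (fun _ => d)); [apply continuous_id | apply continuous_const].
      + apply (continuous_scal_r 2 h), Hc.
    - intros xi. rewrite Rabs_mult. pose proof (cos_abs_le1 (xi * x + t)).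
      pose proof (am_diff2 s h C Hh xi d ltac:(lra)). pose proof (Rabs_pos (h (xi + d) + h (xi - d) - 2 * h xi)). nra. }
  rewrite Rabs_mult in Hb. replace (Rabs (-4)) with 4 in Hb by (unfold Rabs; destruct Rcase_abs; lra).
  assert (Hdw : Rpower d s <= Rpower PI s * (Rpower 2 s * wt s x)).
  { unfold wt. rewrite Rpower_Ropp. apply (Rmult_le_reg_r (Rpower (1 + Rabs x) s)); [apply exp_pos |].
    replace (Rpower PI s * (Rpower 2 s * / Rpower (1 + Rabs x) s) * Rpower (1 + Rabs x) s)
      with (Rpower PI s * Rpower 2 s) by (field; apply Rgt_not_eq, exp_pos).
    rewrite !Rpower_mult_distr by lra. apply Rle_Rpower_l; [lra |].
    unfold d. split; [apply Rmult_lt_0_compat; [apply Rdiv_lt_0_compat; lra | lra] |].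
    replace (PI / Rabs x * (1 + Rabs x)) with (PI * ((1 + Rabs x) / Rabs x)) by (field; lra).
    apply Rmult_le_compat_l; [lra |]. apply (Rmult_le_reg_r (Rabs x)); [lra |].
    unfold Rdiv. rewrite Rmult_assoc, Rinv_l by lra. lra. }
  assert (0 <= C * Iw) by (apply Rmult_le_pos; lra).
  assert (C * Rpower d s * Iw <= C * Iw * (Rpower PI s * (Rpower 2 s * wt s x))).
  { replace (C * Rpower d s * Iw) with (C * Iw * Rpower d s) by ring. now apply Rmult_le_compat_l. }
  assert (0 <= C * Iw * Rpower (1 + PI) s * wt s x) by (apply Rmult_le_pos; lra).
  pose proof (Rabs_pos (osc h t x)). lra.
Qed.

(** The phase moves by at most [1 + Rabs xi] times the displacement of [x] and [t]; [am_size]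
    absorbs this factor. *)
Lemma osc_lipschitz : exists L, forall t t' x y,
  Rabs (osc h t' y - osc h t x) <= L * (Rabs (y - x) + Rabs (t' - t)).
Proof.
destruct wt_integral as [Iw [HI HI0]]. pose proof am_const_nonneg as HC.
exists (C * Iw). intros t t' x y.
pose proof (osc_correct t' y) as P1. pose proof (osc_correct t x) as P2.
pose proof (is_RInt_gen_minus _ _ _ _ P1 P2) as P3.
replace (C * Iw * (Rabs (y - x) + Rabs (t' - t))) with (C * (Rabs (y - x) + Rabs (t' - t)) * Iw) by ring.
apply (integral_wt_bound _ _ _ Iw HI) with (3 := P3).
- intros xi. apply (continuous_minus (fun xi => cos (xi * y + t') * h xi) (fun xi => cos (xi * x + t) * h xi));
    apply continuous_cos_affine_mult, (am_cont s h C Hh).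
- intros xi. unfold minus, plus, opp; simpl.
  replace (cos (xi * y + t') * h xi + - (cos (xi * x + t) * h xi)) with
    ((cos (xi * y + t') - cos (xi * x + t)) * h xi) by ring.
  rewrite Rabs_mult. pose proof (cos_lipschitz (xi * x + t) (xi * y + t')) as Hl.
  pose proof (am_size s h C Hh xi) as Hsz. pose proof (Rabs_pos (h xi)). unfold jb in Hsz.
  assert (Hl2 : Rabs (xi * y + t' - (xi * x + t)) <= (1 + Rabs xi) * (Rabs (y - x) + Rabs (t' - t))).
  { replace (xi * y + t' - (xi * x + t)) with (xi * (y - x) + (t' - t)) by ring.
    eapply Rle_trans; [apply Rabs_triang |]. rewrite Rabs_mult.
    pose proof (Rabs_pos xi). pose proof (Rabs_pos (y - x)). pose proof (Rabs_pos (t' - t)). nra. }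
  apply Rle_trans with ((1 + Rabs xi) * (Rabs (y - x) + Rabs (t' - t)) * Rabs (h xi)).
  + apply Rmult_le_compat_r; lra.
  + replace ((1 + Rabs xi) * (Rabs (y - x) + Rabs (t' - t)) * Rabs (h xi)) with
      ((Rabs (h xi) * (1 + Rabs xi)) * (Rabs (y - x) + Rabs (t' - t))) by ring.
    replace (C * (Rabs (y - x) + Rabs (t' - t)) * wt s xi) with ((C * wt s xi) * (Rabs (y - x) + Rabs (t' - t))) by ring.
    apply Rmult_le_compat_r; [| exact Hsz].
    pose proof (Rabs_pos (y - x)). pose proof (Rabs_pos (t' - t)). lra.
Qed.

End Oscillatory.

(** * Fourier inversion *)

Lemma osc_eq (h F : R -> R) (t x l : R) : (forall xi, F xi = cos (xi * x + t) * h xi) ->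
  is_RInt_gen F minf pinf l -> osc h t x = l.
Proof.
intros HF Hl. apply is_RInt_gen_unique. refine (is_RInt_gen_ext F _ _ _ Hl).
apply filter_forall. intros ab xi _. apply HF.
Qed.

Lemma continuous_of_lipschitz (f : R -> R) (L x : R) :
  (forall y, Rabs (f y - f x) <= L * Rabs (y - x)) -> continuous f x.
Proof.
intros H. apply continuous_of_eps. intros e He.
assert (H1 : 1 <= Rmax L 1) by apply Rmax_r.
exists (e / Rmax L 1). split; [apply Rdiv_lt_0_compat; lra |]. intros y Hy.
eapply Rle_trans; [apply H |].
apply Rle_trans with (Rmax L 1 * Rabs (y - x)); [apply Rmult_le_compat_r; [apply Rabs_pos | apply Rmax_l] |].
apply (Rmult_lt_compat_l (Rmax L 1)) in Hy; [| lra].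
replace (Rmax L 1 * (e / Rmax L 1)) with e in Hy by (field; lra). lra.
Qed.

(* [abel_kernel e A y] is the integral of [exp (- e x) cos (x y)] over [0 <= x <= A]. *)
Definition abel_kernel (e A y : R) : R :=
  (e + exp (- (e * A)) * (y * sin (A * y) - e * cos (A * y))) / (e ^ 2 + y ^ 2).

Section Inversion.

Variables (s : R) (Hs : 1 < s < 2) (h : R -> R) (C eta : R).
Hypothesis (Hh : amplitude s h C).

Let Hs1 : 1 < s := proj1 Hs.
Let Hc : forall x, continuous h x := am_cont s h C Hh.
Let HC : 0 <= C := am_const_nonneg s h C Hh.

(** The oscillatory integral modulated by the frequency [eta]: its integrand is
    [cos (x * (xi - eta) + t) * h xi]. Integrating it in [x] is Fourier inversion at [eta]. *)
Definition modosc (t x : R) : R := osc h (t - x * eta) x.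

Lemma modosc_dominated : exists D, forall t, dominated s D (modosc t).
Proof.
destruct (osc_decay s Hs h C Hh) as [D HD]. destruct (osc_lipschitz s Hs h C Hh) as [L HL].
exists D. intros t. split; [| intros x; apply HD].
intros x. apply (continuous_of_lipschitz _ (L * (1 + Rabs eta))). intros y. unfold modosc.
eapply Rle_trans; [apply HL |]. right.
replace (t - y * eta - (t - x * eta)) with (- ((y - x) * eta)) by ring.
rewrite Rabs_Ropp, Rabs_mult. ring.
Qed.

Lemma modosc_correct (t x : R) :
  is_RInt_gen (fun xi => cos (x * (xi - eta) + t) * h xi) minf pinf (modosc t x).
Proof.
refine (is_RInt_gen_ext _ _ _ _ (osc_correct s Hs h C Hh (t - x * eta) x)).
apply filter_forall. intros ab xi _. f_equal. f_equal. ring.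
Qed.

Lemma modosc_decompose (t x : R) : modosc t x = cos t * modosc 0 x + sin t * modosc (PI / 2) x.
Proof.
pose proof (is_RInt_gen_plus _ _ _ _ (is_RInt_gen_scal _ (cos t) _ (modosc_correct 0 x))
  (is_RInt_gen_scal _ (sin t) _ (modosc_correct (PI / 2) x))) as P.
refine (osc_eq _ _ _ _ _ _ P). intros xi. unfold scal, plus; simpl; unfold mult; simpl.
replace (xi * x + (t - x * eta)) with (x * (xi - eta) + t) by ring.
rewrite (cos_plus _ (PI / 2)), cos_PI2, sin_PI2, Rplus_0_r, cos_plus. ring.
Qed.

Lemma modosc_even (x : R) : modosc 0 (- x) = modosc 0 x.
Proof.
refine (osc_eq _ _ _ _ _ _ (modosc_correct 0 x)). intros xi. f_equal.
rewrite <- cos_neg. f_equal. ring.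
Qed.

Lemma modosc_odd (x : R) : modosc (PI / 2) (- x) = - modosc (PI / 2) x.
Proof.
pose proof (is_RInt_gen_opp _ _ (modosc_correct (PI / 2) x)) as P.
refine (osc_eq _ _ _ _ _ _ P). intros xi. unfold opp; simpl.
replace (xi * - x + (PI / 2 - - x * eta)) with (- (x * (xi - eta)) + PI / 2) by ring.
rewrite !cos_plus, cos_PI2, sin_PI2, sin_neg. ring.
Qed.

Lemma jb_minus_le (xi : R) : 1 + Rabs (xi - eta) <= (1 + Rabs eta) * jb xi.
Proof.
unfold jb. pose proof (Rabs_triang xi (- eta)) as H. rewrite Rabs_Ropp in H. unfold Rminus.
pose proof (Rabs_pos xi). pose proof (Rabs_pos eta). nra.
Qed.

(** Kernels of linear growth are admissible since [am_size] gains one power. The bound is linear in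
    [B], so a kernel of size [t ^ 2] contributes a remainder of size [t ^ 2]. *)
Lemma weighted_integral (k : R -> R) (B Iw : R) : 0 <= B -> is_RInt_gen (wt s) minf pinf Iw ->
  (forall y, continuous k y) -> (forall y, Rabs (k y) <= B * (1 + Rabs y)) ->
  exists l, is_RInt_gen (fun xi => k (xi - eta) * h xi) minf pinf l /\
    Rabs l <= B * (1 + Rabs eta) * C * Iw.
Proof.
intros HB HI Hk Hkb.
assert (Hcc : forall xi, continuous (fun xi => k (xi - eta) * h xi) xi).
{ intros xi. apply (continuous_mult (fun xi => k (xi - eta)) h); [| apply Hc].
  apply (continuous_comp (fun xi => xi - eta) k); [| apply Hk].
  apply (continuous_minus (fun x : R => x) (fun _ => eta)); [apply continuous_id | apply continuous_const]. }
assert (Hb : forall xi, Rabs (k (xi - eta) * h xi) <= (B * (1 + Rabs eta) * C) * wt s xi).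
{ intros xi. rewrite Rabs_mult. pose proof (jb_minus_le xi). pose proof (am_size s h C Hh xi) as H2.
  pose proof (Rabs_pos (h xi)). pose proof (Rabs_pos eta).
  apply Rle_trans with (B * ((1 + Rabs eta) * jb xi) * Rabs (h xi)).
  - apply Rmult_le_compat_r; [lra |]. eapply Rle_trans; [apply Hkb |]. apply Rmult_le_compat_l; lra.
  - replace (B * ((1 + Rabs eta) * jb xi) * Rabs (h xi)) with (B * (1 + Rabs eta) * (Rabs (h xi) * jb xi)) by ring.
    replace (B * (1 + Rabs eta) * C * wt s xi) with (B * (1 + Rabs eta) * (C * wt s xi)) by ring.
    apply Rmult_le_compat_l; [apply Rmult_le_pos; lra | exact H2]. }
destruct (dominated_integral s Hs1 _ _ (conj Hcc Hb)) as [l [Hl _]].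
exists l. split; [exact Hl |]. now apply (integral_wt_bound s (fun xi => k (xi - eta) * h xi)).
Qed.

Lemma weighted_value (k : R -> R) (B : R) : 0 <= B ->
  (forall y, continuous k y) -> (forall y, Rabs (k y) <= B * (1 + Rabs y)) ->
  exists l, is_RInt_gen (fun xi => k (xi - eta) * h xi) minf pinf l.
Proof.
intros HB Hk Hkb. destruct (wt_integral s Hs) as [Iw [HI _]].
destruct (weighted_integral k B Iw HB HI Hk Hkb) as [l [Hl _]]. now exists l.
Qed.

Lemma weighted_bound (k : R -> R) (B Iw l : R) : 0 <= B -> is_RInt_gen (wt s) minf pinf Iw ->
  (forall y, continuous k y) -> (forall y, Rabs (k y) <= B * (1 + Rabs y)) ->
  is_RInt_gen (fun xi => k (xi - eta) * h xi) minf pinf l ->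
  Rabs l <= B * (1 + Rabs eta) * C * Iw.
Proof.
intros HB HI Hk Hkb Hl. destruct (weighted_integral k B Iw HB HI Hk Hkb) as [l' [Hl' Hb]].
rewrite <- (is_RInt_gen_unique _ l Hl). rewrite (is_RInt_gen_unique _ l' Hl'). exact Hb.
Qed.

(** * Abel summation of the inversion integral *)

Section Abel.

Variables (e : R) (He : 0 < e).

Lemma abel_denom_pos (y : R) : 0 < e ^ 2 + y ^ 2.
Proof. pose proof (pow2_ge_0 y). nra. Qed.

Lemma abel_kernel_continuous (A y : R) : continuous (abel_kernel e A) y.
Proof.
apply (@ex_derive_continuous R_AbsRing R_NormedModule). unfold abel_kernel. auto_derive.
pose proof (abel_denom_pos y) as H. simpl in H. lra.
Qed.

Lemma abel_kernel_derive (A y : R) :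
  is_derive (fun A => abel_kernel e A y) A (exp (- (e * A)) * cos (A * y)).
Proof.
pose proof (abel_denom_pos y) as H. unfold abel_kernel. auto_derive; [trivial |].
field. simpl in H. lra.
Qed.

Lemma abel_numerator_bound (A y : R) :
  Rabs (y * sin (A * y) - e * cos (A * y)) <= e + Rabs y.
Proof.
unfold Rminus. eapply Rle_trans; [apply Rabs_triang |]. rewrite Rabs_Ropp, !Rabs_mult, (Rabs_pos_eq e) by lra.
pose proof (cos_abs_le1 (A * y)). assert (Rabs (sin (A * y)) <= 1) by apply Rabs_le, SIN_bound.
pose proof (Rabs_pos y). nra.
Qed.

Lemma abel_kernel_growth (A : R) : exists B, 0 <= B /\ forall y, Rabs (abel_kernel e A y) <= B * (1 + Rabs y).
Proof.
pose (E := exp (- (e * A))). assert (HE : 0 < E) by apply exp_pos.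
exists ((e + E * (e + 1)) / e ^ 2).
assert (He2 : 0 < e ^ 2) by (apply pow_lt; lra).
split; [left; apply Rdiv_lt_0_compat; [nra | lra] |].
intros y. unfold abel_kernel. fold E. unfold Rdiv. rewrite Rabs_mult.
pose proof (abel_denom_pos y) as Hd. rewrite (Rabs_pos_eq (/ _)) by (left; now apply Rinv_0_lt_compat).
replace ((e + E * (e + 1)) * / e ^ 2 * (1 + Rabs y)) with ((e + E * (e + 1)) * (1 + Rabs y) * / e ^ 2) by ring.
pose proof (Rabs_pos y). apply Rmult_le_compat.
- apply Rabs_pos.
- left. now apply Rinv_0_lt_compat.
- eapply Rle_trans; [apply Rabs_triang |]. rewrite Rabs_mult, (Rabs_pos_eq e), (Rabs_pos_eq E) by lra.
  pose proof (abel_numerator_bound A y).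
  assert (E * Rabs (y * sin (A * y) - e * cos (A * y)) <= E * (e + Rabs y)) by (apply Rmult_le_compat_l; lra).
  assert (0 <= E * e * Rabs y) by (apply Rmult_le_pos; [apply Rmult_le_pos |]; lra).
  assert (0 <= e * Rabs y) by (apply Rmult_le_pos; lra). nra.
- apply Rinv_le_contravar; [lra |]. pose proof (pow2_ge_0 y). lra.
Qed.

Definition abel_integral (A : R) : R :=
  RInt_gen (V := R_CompleteNormedModule) (fun xi => abel_kernel e A (xi - eta) * h xi) minf pinf.

Lemma abel_integral_correct (A : R) :
  is_RInt_gen (fun xi => abel_kernel e A (xi - eta) * h xi) minf pinf (abel_integral A).
Proof.
destruct (abel_kernel_growth A) as [B [HB HB']].
destruct (weighted_value (abel_kernel e A) B HB (abel_kernel_continuous A) HB') as [l Hl].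
now apply (is_RInt_gen_ex_value _ l).
Qed.

(* Differentiating in the upper limit replaces an exchange of integrals. *)
Lemma abel_integral_derive (A : R) : is_derive abel_integral A (exp (- (e * A)) * modosc 0 A).
Proof.
destruct (wt_integral s Hs) as [Iw [HI _]].
pose (E := exp (e * (Rabs A + 1))). assert (HE : 0 < E) by apply exp_pos.
apply (is_derive_of_quadratic _ _ _ (E * (e + 1) * (1 + Rabs eta) * C * Iw)). intros t Ht.
pose proof (is_RInt_gen_minus _ _ _ _ (is_RInt_gen_minus _ _ _ _ (abel_integral_correct (A + t)) (abel_integral_correct A))
  (is_RInt_gen_scal _ (t * exp (- (e * A))) _ (modosc_correct 0 A))) as P.
replace (E * (e + 1) * (1 + Rabs eta) * C * Iw * t ^ 2) with
  (E * (e + 1) * t ^ 2 * (1 + Rabs eta) * C * Iw) by ring.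
pose (k := fun y => abel_kernel e (A + t) y - abel_kernel e A y - t * (exp (- (e * A)) * cos (A * y))).
apply (weighted_bound k _ Iw).
- apply Rmult_le_pos; [apply Rmult_le_pos; lra | apply pow2_ge_0].
- exact HI.
- intros y. apply (continuous_minus (fun y => abel_kernel e (A + t) y - abel_kernel e A y)).
  + apply (continuous_minus (abel_kernel e (A + t)) (abel_kernel e A)); apply abel_kernel_continuous.
  + apply (@ex_derive_continuous R_AbsRing R_NormedModule). auto_derive. trivial.
- intros y. unfold k.
  replace (E * (e + 1) * t ^ 2 * (1 + Rabs y)) with (E * (e + 1) * (1 + Rabs y) * t ^ 2) by ring.
  apply (taylor_order2 (fun A => abel_kernel e A y) (fun A => exp (- (e * A)) * cos (A * y))
    (fun A => exp (- (e * A)) * (- (e * cos (A * y)) - y * sin (A * y)))).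
  + intros z _. apply abel_kernel_derive.
  + intros z _. auto_derive; [trivial | ring].
  + intros z Hz. rewrite Rabs_mult, Rabs_pos_eq by (left; apply exp_pos).
    assert (Hexp : exp (- (e * z)) <= E).
    { unfold E. assert (Hzz : - z <= Rabs A + 1).
      { pose proof (Rabs_triang (- A) (A - z)) as H1. replace (- A + (A - z)) with (- z) in H1 by ring.
        rewrite (Rabs_Ropp A), (Rabs_minus_sym A z) in H1. pose proof (Rle_abs (- z)). lra. }
      destruct (Req_dec (- (e * z)) (e * (Rabs A + 1))) as [-> | Hne]; [lra |].
      left. apply exp_increasing. nra. }
    assert (Hnum : Rabs (- (e * cos (z * y)) - y * sin (z * y)) <= (e + 1) * (1 + Rabs y)).
    { unfold Rminus. eapply Rle_trans; [apply Rabs_triang |]. rewrite !Rabs_Ropp, !Rabs_mult, (Rabs_pos_eq e) by lra.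
      pose proof (cos_abs_le1 (z * y)). assert (Rabs (sin (z * y)) <= 1) by apply Rabs_le, SIN_bound.
      pose proof (Rabs_pos y). nra. }
    rewrite (Rmult_assoc E). apply Rmult_le_compat; auto; [left; apply exp_pos | apply Rabs_pos].
- evar_last.
  + refine (is_RInt_gen_ext _ _ _ _ P). apply filter_forall. intros ab xi _.
    unfold k, minus, plus, opp, scal; simpl; unfold mult; simpl. rewrite Rplus_0_r. ring.
  + unfold minus, plus, opp, scal; simpl; unfold mult; simpl. ring.
Qed.

Lemma abel_integral_0 : abel_integral 0 = 0.
Proof.
assert (H : is_RInt_gen (fun xi => abel_kernel e 0 (xi - eta) * h xi) minf pinf 0).
{ pose proof (is_RInt_gen_scal _ 0 _ (modosc_correct 0 0)) as P. evar_last.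
  - refine (is_RInt_gen_ext _ _ _ _ P). apply filter_forall. intros ab xi _.
    unfold scal; simpl; unfold mult; simpl. unfold abel_kernel.
    rewrite !Rmult_0_r, !Rmult_0_l, Ropp_0, exp_0, sin_0, cos_0. unfold Rdiv. ring.
  - unfold scal; simpl; unfold mult; simpl. ring. }
now apply is_RInt_gen_unique.
Qed.

Lemma abel_continuous (x : R) : continuous (fun x => exp (- (e * x)) * modosc 0 x) x.
Proof.
destruct modosc_dominated as [D HD].
apply (continuous_mult (fun x => exp (- (e * x))) (modosc 0)); [| apply HD].
apply (@ex_derive_continuous R_AbsRing R_NormedModule). auto_derive. trivial.
Qed.

Lemma abel_RInt (A : R) : RInt (fun x => exp (- (e * x)) * modosc 0 x) 0 A = abel_integral A.
Proof.
apply is_RInt_unique. replace (abel_integral A) with (minus (abel_integral A) (abel_integral 0)).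
2:{ rewrite abel_integral_0. unfold minus, plus, opp; simpl. ring. }
apply (is_RInt_derive abel_integral (fun x => exp (- (e * x)) * modosc 0 x)).
- intros x _. apply abel_integral_derive.
- intros x _. apply abel_continuous.
Qed.

Lemma poisson_le (y : R) : 0 <= e / (e ^ 2 + y ^ 2) <= / e.
Proof.
pose proof (abel_denom_pos y). split; [left; apply Rdiv_lt_0_compat; lra |].
apply (Rmult_le_reg_r (e ^ 2 + y ^ 2)); [lra |]. unfold Rdiv. rewrite Rmult_assoc, Rinv_l by lra.
replace (/ e * (e ^ 2 + y ^ 2)) with (e + / e * y ^ 2) by (field; lra).
assert (0 <= / e * y ^ 2) by (apply Rmult_le_pos; [left; now apply Rinv_0_lt_compat | apply pow2_ge_0]). lra.
Qed.

Lemma poisson_continuous (y : R) : continuous (fun y => e / (e ^ 2 + y ^ 2)) y.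
Proof.
apply (@ex_derive_continuous R_AbsRing R_NormedModule). auto_derive.
pose proof (abel_denom_pos y) as H. simpl in H. lra.
Qed.

Lemma poisson_integral_ex : exists l, is_RInt_gen (fun xi => e / (e ^ 2 + (xi - eta) ^ 2) * h xi) minf pinf l.
Proof.
apply (weighted_value (fun y => e / (e ^ 2 + y ^ 2)) (/ e)).
- left. now apply Rinv_0_lt_compat.
- apply poisson_continuous.
- intros y. destruct (poisson_le y). rewrite Rabs_pos_eq by assumption. pose proof (Rabs_pos y).
  assert (0 < / e) by now apply Rinv_0_lt_compat. nra.
Qed.

(** As [A] grows, [abel_kernel e A] tends to the Poisson kernel [e / (e ^ 2 + y ^ 2)]; the
    difference carries the factor [exp (- (e * A))] and grows at most linearly in [y]. *)
Lemma abel_integral_limit (l : R) : is_RInt_gen (fun xi => e / (e ^ 2 + (xi - eta) ^ 2) * h xi) minf pinf l ->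
  exists B, forall A, 0 <= A -> Rabs (abel_integral A - l) <= B * exp (- (e * A)).
Proof.
intros Hl. destruct (wt_integral s Hs) as [Iw [HI _]].
exists ((e + 1) / e ^ 2 * (1 + Rabs eta) * C * Iw). intros A HA.
pose (E := exp (- (e * A))). assert (HE : 0 < E) by apply exp_pos. fold E.
assert (He2 : 0 < e ^ 2) by (apply pow_lt; lra).
pose proof (is_RInt_gen_minus _ _ _ _ (abel_integral_correct A) Hl) as P.
replace ((e + 1) / e ^ 2 * (1 + Rabs eta) * C * Iw * E) with ((e + 1) / e ^ 2 * E * (1 + Rabs eta) * C * Iw) by ring.
pose (k := fun y => E * (y * sin (A * y) - e * cos (A * y)) / (e ^ 2 + y ^ 2)).
apply (weighted_bound k _ Iw).
- apply Rmult_le_pos; [left; apply Rdiv_lt_0_compat; lra | lra].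
- exact HI.
- intros y. unfold k. apply (@ex_derive_continuous R_AbsRing R_NormedModule). auto_derive.
  pose proof (abel_denom_pos y) as H. simpl in H. lra.
- intros y. unfold k, Rdiv. pose proof (abel_denom_pos y) as Hd. rewrite !Rabs_mult, (Rabs_pos_eq E) by lra.
  rewrite (Rabs_pos_eq (/ _)) by (left; now apply Rinv_0_lt_compat).
  replace ((e + 1) * / e ^ 2 * E * (1 + Rabs y)) with (E * ((e + 1) * (1 + Rabs y)) * / e ^ 2) by ring.
  pose proof (abel_numerator_bound A y). pose proof (Rabs_pos y).
  apply Rmult_le_compat.
  + apply Rmult_le_pos; [lra | apply Rabs_pos].
  + left. now apply Rinv_0_lt_compat.
  + apply Rmult_le_compat_l; [lra |]. nra.
  + apply Rinv_le_contravar; [lra |]. pose proof (pow2_ge_0 y). lra.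
- refine (is_RInt_gen_ext _ _ _ _ P). apply filter_forall. intros ab xi _.
  unfold k, abel_kernel, minus, plus, opp; simpl. fold E. pose proof (abel_denom_pos (xi - eta)) as Hd.
  simpl in Hd. field. lra.
Qed.

(** The damped integral over the whole half line is the Poisson mean [l]. Its part beyond [A] is
    bounded by the tail of the undamped majorant, hence uniformly in [e]; this is what allows [A] to
    be fixed before [e] tends to zero. *)
Lemma abel_tail (D l A : R) : dominated s D (modosc 0) -> 0 <= A ->
  is_RInt_gen (fun xi => e / (e ^ 2 + (xi - eta) ^ 2) * h xi) minf pinf l ->
  Rabs (RInt (fun x => exp (- (e * x)) * modosc 0 x) 0 A - l) <= D * tail s A.
Proof.
intros HD HA Hl. pose (J := fun x : R => exp (- (e * x)) * modosc 0 x). fold J. destruct (abel_integral_limit l Hl) as [B HB].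
apply Rnot_lt_le. intros Hlt.
pose (g := Rabs (RInt J 0 A - l) - D * tail s A).
assert (Hg : 0 < g) by (unfold g; lra).
assert (HX : exists X, A <= X /\ B * exp (- (e * X)) < g).
(* By [1 + e * X <= exp (e * X)], taking [X >= Rabs B / (g * e)] makes [B * exp (- (e * X))] smaller
   than the gap [g]. *)
{ exists (Rmax A (Rabs B / (g * e))). split; [apply Rmax_l |].
  pose (X := Rmax A (Rabs B / (g * e))). fold X.
  assert (HXge : Rabs B / (g * e) <= X) by apply Rmax_r.
  assert (HX0 : 0 <= X) by (eapply Rle_trans; [exact HA | apply Rmax_l]).
  assert (Hexp : 1 + e * X <= exp (e * X)) by apply exp_ineq1_le.
  rewrite exp_Ropp. apply Rle_lt_trans with (Rabs B * / exp (e * X)).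
  { apply Rmult_le_compat_r; [left; apply Rinv_0_lt_compat, exp_pos | apply Rle_abs]. }
  apply (Rmult_lt_reg_r (exp (e * X))); [apply exp_pos |].
  rewrite Rmult_assoc, Rinv_l by (apply Rgt_not_eq, exp_pos).
  assert (HBX : Rabs B <= X * (g * e)).
  { apply (Rmult_le_compat_r (g * e)) in HXge; [| apply Rmult_le_pos; lra].
    unfold Rdiv in HXge. rewrite Rmult_assoc, Rinv_l in HXge; [lra |].
    apply Rgt_not_eq, Rmult_lt_0_compat; lra. }
  assert (g * (1 + e * X) <= g * exp (e * X)) by (apply Rmult_le_compat_l; lra). lra. }
destruct HX as [X [HAX HBX]].
specialize (HB X ltac:(lra)). rewrite <- abel_RInt in HB. fold J in HB.
rewrite <- (RInt_Chasles_cont J 0 A X abel_continuous) in HB.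
assert (Htail : Rabs (RInt J A X) <= D * tail s A).
{ apply Rle_trans with (D * RInt (wt s) A X).
  - change (D * RInt (wt s) A X) with (scal D (RInt (wt s) A X)).
    rewrite <- RInt_scal by (apply ex_RInt_cont, continuous_wt).
    apply (norm_RInt_le J (fun x => scal D (wt s x)) A X); auto.
    + intros x Hx. destruct HD as [_ HD]. specialize (HD x).
      change (Rabs (exp (- (e * x)) * modosc 0 x) <= D * wt s x).
      rewrite Rabs_mult, Rabs_pos_eq by (left; apply exp_pos).
      assert (exp (- (e * x)) <= 1).
      { rewrite <- exp_0. destruct (Req_dec (- (e * x)) 0) as [-> | Hne]; [lra |].
        left. apply exp_increasing. nra. }
      assert (0 < exp (- (e * x))) by apply exp_pos. pose proof (Rabs_pos (modosc 0 x)). nra.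
    + apply (@RInt_correct R_CompleteNormedModule), ex_RInt_cont, abel_continuous.
    + apply (@RInt_correct R_CompleteNormedModule), ex_RInt_cont. intros x.
      apply (continuous_scal_r D (wt s)), continuous_wt.
  - apply Rmult_le_compat_l; [apply (dominated_const_pos s D _ HD) |]. apply RInt_wt_tail; lra. }
pose proof (Rabs_triang (RInt J 0 A + RInt J A X - l)
  (- RInt J A X)) as Ht.
rewrite Rabs_Ropp in Ht.
replace (RInt J 0 A + RInt J A X - l
  + - RInt J A X) with (RInt J 0 A - l) in Ht by ring.
unfold g in HBX. lra.
Qed.

End Abel.

(** The Poisson kernels are an approximate identity of mass [PI]. Within [d] of [eta] the continuity
    of [h] is used; farther away the kernel of width [e] is at most [e (1 + 1 / d ^ 2)] times the
    kernel of width [1]. Both regions are thus covered by Poisson kernels, whose integrals are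
    known. *)
Lemma poisson_approximation (q : R) : 0 < q -> exists e0, 0 < e0 /\ forall e l, 0 < e < e0 ->
  is_RInt_gen (fun xi => e / (e ^ 2 + (xi - eta) ^ 2) * h xi) minf pinf l -> Rabs (l - PI * h eta) <= q.
Proof.
intros Hq. pose proof PI_RGT_0 as HPI.
pose (z := q / (2 * PI)). assert (Hz : 0 < z) by (apply Rdiv_lt_0_compat; lra).
destruct (continuous_eps h eta z (Hc eta) Hz) as [d [Hd Hd']].
pose (M := 2 * C * (1 + / d ^ 2)).
assert (Hid : 0 < / d ^ 2) by (apply Rinv_0_lt_compat, pow_lt; lra).
assert (HM : 0 <= M) by (unfold M; apply Rmult_le_pos; lra).
exists (q / (2 * PI * (M + 1))). split; [apply Rdiv_lt_0_compat; [lra | apply Rmult_lt_0_compat; lra] |].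
intros e l [He He'] Hl.
assert (HeM : e * M * PI <= q / 2).
{ apply (Rmult_lt_compat_r (2 * PI * (M + 1))) in He'; [| apply Rmult_lt_0_compat; lra].
  replace (q / (2 * PI * (M + 1)) * (2 * PI * (M + 1))) with q in He' by (field; lra).
  assert (0 <= e * PI) by (apply Rmult_le_pos; lra). nra. }
pose proof (is_RInt_gen_poisson e eta He) as Pe. pose proof (is_RInt_gen_poisson 1 eta Rlt_0_1) as P1.
pose proof (is_RInt_gen_minus _ _ _ _ Hl (is_RInt_gen_scal _ (h eta) _ Pe)) as Pm.
pose proof (is_RInt_gen_plus _ _ _ _ (is_RInt_gen_scal _ z _ Pe) (is_RInt_gen_scal _ (e * M) _ P1)) as Pb.
assert (Hbound : Rabs (minus l (scal (h eta) PI)) <= plus (scal z PI) (scal (e * M) PI)).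
{ assert (Hcp : forall b x, 0 < b -> continuous (fun x => b / (b ^ 2 + (x - eta) ^ 2)) x).
  { intros b x Hb. apply (@ex_derive_continuous R_AbsRing R_NormedModule). auto_derive.
    pose proof (abel_denom_pos b Hb (x - eta)) as H. simpl in H. lra. }
  refine (is_RInt_gen_abs_le _ _ _ _ _ _ _ Pm Pb).
  - intros x. apply (continuous_minus (fun x => e / (e ^ 2 + (x - eta) ^ 2) * h x)).
    + apply (continuous_mult (fun x => e / (e ^ 2 + (x - eta) ^ 2)) h); [now apply Hcp | apply Hc].
    + apply (continuous_scal_r (h eta) (fun x => e / (e ^ 2 + (x - eta) ^ 2))). now apply Hcp.
  - intros x. apply (continuous_plus (fun x => scal z (e / (e ^ 2 + (x - eta) ^ 2)))).
    + apply (continuous_scal_r z (fun x => e / (e ^ 2 + (x - eta) ^ 2))). now apply Hcp.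
    + apply (continuous_scal_r (e * M) (fun x => 1 / (1 ^ 2 + (x - eta) ^ 2))). apply Hcp. lra.
  - intros x. change (Rabs (e / (e ^ 2 + (x - eta) ^ 2) * h x - h eta * (e / (e ^ 2 + (x - eta) ^ 2)))
      <= z * (e / (e ^ 2 + (x - eta) ^ 2)) + e * M * (1 / (1 ^ 2 + (x - eta) ^ 2))).
    replace (e / (e ^ 2 + (x - eta) ^ 2) * h x - h eta * (e / (e ^ 2 + (x - eta) ^ 2)))
      with (e / (e ^ 2 + (x - eta) ^ 2) * (h x - h eta)) by ring.
    destruct (poisson_le e He (x - eta)) as [Hp0 _].
    pose proof (abel_denom_pos e He (x - eta)) as Hde. pose proof (abel_denom_pos 1 Rlt_0_1 (x - eta)) as Hd1.
    assert (Hq1 : 0 < 1 / (1 ^ 2 + (x - eta) ^ 2)) by (apply Rdiv_lt_0_compat; lra).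
    rewrite Rabs_mult, (Rabs_pos_eq (e / _)) by exact Hp0.
    destruct (Rlt_le_dec (Rabs (x - eta)) d) as [Hx | Hx].
    + specialize (Hd' x Hx). assert (0 <= e * M) by (apply Rmult_le_pos; lra).
      assert (0 <= e * M * (1 / (1 ^ 2 + (x - eta) ^ 2))) by (apply Rmult_le_pos; lra).
      pose proof (Rabs_pos (h x - h eta)).
      assert (e / (e ^ 2 + (x - eta) ^ 2) * Rabs (h x - h eta) <= e / (e ^ 2 + (x - eta) ^ 2) * z)
        by (apply Rmult_le_compat_l; lra). lra.
    + assert (H2C : Rabs (h x - h eta) <= 2 * C).
      { assert (Hle : forall y, Rabs (h y) <= C).
        { intros y. eapply Rle_trans; [apply (am_le s h C Hh) |]. pose proof (wt_le1 s Hs1 y). pose proof (wt_pos s y). nra. }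
        unfold Rminus. eapply Rle_trans; [apply Rabs_triang |]. rewrite Rabs_Ropp.
        pose proof (Hle x). pose proof (Hle eta). lra. }
      assert (Hsq : d ^ 2 <= (x - eta) ^ 2).
      { rewrite <- (pow2_abs (x - eta)). apply pow_incr. lra. }
      assert (Hdp : 0 < d ^ 2) by (apply pow_lt; lra).
      assert (Hk : / (e ^ 2 + (x - eta) ^ 2) <= (1 + / d ^ 2) * (1 / (1 ^ 2 + (x - eta) ^ 2))).
      { apply (Rmult_le_reg_r ((e ^ 2 + (x - eta) ^ 2) * (1 ^ 2 + (x - eta) ^ 2))); [now apply Rmult_lt_0_compat |].
        replace (/ (e ^ 2 + (x - eta) ^ 2) * ((e ^ 2 + (x - eta) ^ 2) * (1 ^ 2 + (x - eta) ^ 2)))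
          with (1 + (x - eta) ^ 2) by (field; simpl in *; lra).
        replace ((1 + / d ^ 2) * (1 / (1 ^ 2 + (x - eta) ^ 2)) * ((e ^ 2 + (x - eta) ^ 2) * (1 ^ 2 + (x - eta) ^ 2)))
          with ((1 + / d ^ 2) * (e ^ 2 + (x - eta) ^ 2)).
        2:{ field. simpl in *. split; lra. }
        assert (1 <= / d ^ 2 * (x - eta) ^ 2).
        { apply (Rmult_le_reg_l (d ^ 2)); [lra |]. rewrite <- Rmult_assoc, Rinv_r by lra. lra. }
        pose proof (pow2_ge_0 e).
        assert (0 <= (1 + / d ^ 2) * e ^ 2) by (apply Rmult_le_pos; lra). lra. }
      assert (0 <= z * (e / (e ^ 2 + (x - eta) ^ 2))) by (apply Rmult_le_pos; lra).
      apply Rle_trans with (e * M * (1 / (1 ^ 2 + (x - eta) ^ 2))); [| lra].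
      unfold M. replace (e * (2 * C * (1 + / d ^ 2)) * (1 / (1 ^ 2 + (x - eta) ^ 2)))
        with (e * ((1 + / d ^ 2) * (1 / (1 ^ 2 + (x - eta) ^ 2))) * (2 * C)) by ring.
      apply Rmult_le_compat; [exact Hp0 | apply Rabs_pos | | exact H2C].
      unfold Rdiv at 1. apply Rmult_le_compat_l; lra. }
change (Rabs (l - h eta * PI) <= z * PI + e * M * PI) in Hbound.
rewrite (Rmult_comm PI). assert (z * PI = q / 2) by (unfold z; field; lra). lra.
Qed.

(** The half-line integral is compared with its Abel damped version, a Poisson mean close to
    [PI * h eta], and evenness doubles it. The cut [A] is fixed first, then [e] is taken small in
    terms of [A]. *)
Lemma modosc_integral_even : is_RInt_gen (modosc 0) minf pinf (2 * PI * h eta).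
Proof.
destruct modosc_dominated as [D HD]. specialize (HD 0).
destruct (dominated_integral s Hs1 (modosc 0) D HD) as [l [Hl Hlt]].
replace (2 * PI * h eta) with l; [exact Hl |].
pose proof (dominated_const_pos s D _ HD) as HD0. destruct HD as [HDc HDb].
apply NNPP. intros Hne.
pose (g := Rabs (l - 2 * PI * h eta)). assert (Hg : 0 < g) by (apply Rabs_pos_lt; lra).
destruct (tail_small s Hs1 (g / (16 * (D + 1)))) as [A [HA1 HA2]].
{ apply Rdiv_lt_0_compat; lra. }
assert (HA3 : 4 * D * tail s A <= g / 4).
{ pose proof (tail_pos s Hs1 A).
  apply (Rmult_lt_compat_r (16 * (D + 1))) in HA2; [| lra].
  replace (g / (16 * (D + 1)) * (16 * (D + 1))) with g in HA2 by (field; lra). nra. }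
destruct (poisson_approximation (g / 16) ltac:(lra)) as [e0 [He0 Hpa]].
(* On [[0, A]] damping changes the integrand by at most [e * A * D], hence the integral by
   [e * D * A ^ 2]; the second argument of [Rmin] makes this at most [g / 16]. *)
pose (e := Rmin (e0 / 2) (g / (16 * (D + 1) * (A + 1) ^ 2))).
assert (Hden : 0 < 16 * (D + 1) * (A + 1) ^ 2).
{ apply Rmult_lt_0_compat; [lra | apply pow_lt; lra]. }
assert (He : 0 < e) by (apply Rmin_pos; [lra | apply Rdiv_lt_0_compat; lra]).
assert (Hee0 : e <= e0 / 2) by apply Rmin_l.
assert (HeA : e * (D * A ^ 2) <= g / 16).
{ assert (H : e <= g / (16 * (D + 1) * (A + 1) ^ 2)) by apply Rmin_r.
  apply (Rmult_le_compat_r (16 * (D + 1) * (A + 1) ^ 2)) in H; [| lra].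
  replace (g / (16 * (D + 1) * (A + 1) ^ 2) * (16 * (D + 1) * (A + 1) ^ 2)) with g in H by (field; split; lra).
  assert (HDA : D * A ^ 2 <= (D + 1) * (A + 1) ^ 2).
  { apply Rmult_le_compat; [lra | apply pow2_ge_0 | lra | apply pow_incr; lra]. }
  assert (e * (D * A ^ 2) <= e * ((D + 1) * (A + 1) ^ 2)) by (apply Rmult_le_compat_l; lra). lra. }
destruct (poisson_integral_ex e He) as [lp Hlp].
specialize (Hpa e lp ltac:(lra) Hlp).
pose proof (abel_tail e He D lp A (conj HDc HDb) HA1 Hlp) as Hat.
specialize (Hlt A HA1).
assert (Hsym : RInt (modosc 0) (- A) A = 2 * RInt (modosc 0) 0 A).
{ rewrite <- (RInt_Chasles_cont _ (- A) 0 A HDc).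
  rewrite (RInt_opp_var _ (- A) 0) by exact HDc. rewrite Ropp_involutive, Ropp_0.
  rewrite (RInt_ext (fun x => modosc 0 (- x)) (modosc 0)) by (intros; apply modosc_even).
  apply Rplus_diag. }
assert (Hdiff : Rabs (RInt (modosc 0) 0 A - RInt (fun x => exp (- (e * x)) * modosc 0 x) 0 A) <= e * (D * A ^ 2)).
{ change (RInt (modosc 0) 0 A - RInt (fun x => exp (- (e * x)) * modosc 0 x) 0 A) with
    (minus (RInt (modosc 0) 0 A) (RInt (fun x => exp (- (e * x)) * modosc 0 x) 0 A)).
  pose proof (abel_continuous e) as Hac.
  rewrite <- RInt_minus by (now apply ex_RInt_cont).
  replace (e * (D * A ^ 2)) with ((A - 0) * (e * A * D)) by ring.
  apply abs_RInt_le_const; [exact HA1 | |].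
  - apply ex_RInt_cont. intros x.
    apply (continuous_minus (modosc 0) (fun x => exp (- (e * x)) * modosc 0 x)); auto.
  - intros x Hx. change (Rabs (modosc 0 x - exp (- (e * x)) * modosc 0 x) <= e * A * D).
    replace (modosc 0 x - exp (- (e * x)) * modosc 0 x) with ((1 - exp (- (e * x))) * modosc 0 x) by ring.
    rewrite Rabs_mult.
    assert (Hex1 : 1 + - (e * x) <= exp (- (e * x))) by apply exp_ineq1_le.
    assert (Hex2 : exp (- (e * x)) <= 1).
    { rewrite <- exp_0. destruct (Req_dec (- (e * x)) 0) as [-> | Hn]; [lra |]. left. apply exp_increasing. nra. }
    rewrite Rabs_pos_eq by lra.
    assert (e * x <= e * A) by (apply Rmult_le_compat_l; lra).
    apply Rmult_le_compat; [lra | apply Rabs_pos | lra |].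
    eapply Rle_trans; [apply HDb |]. pose proof (wt_le1 s Hs1 x). pose proof (wt_pos s x). nra. }
assert (Hfin : g <= g / 2); [| lra].
unfold g at 1. rewrite Hsym in Hlt.
replace (l - 2 * PI * h eta) with
  ((l - 2 * RInt (modosc 0) 0 A) + 2 * ((RInt (modosc 0) 0 A - RInt (fun x => exp (- (e * x)) * modosc 0 x) 0 A)
    + (RInt (fun x => exp (- (e * x)) * modosc 0 x) 0 A - lp) + (lp - PI * h eta))) by ring.
eapply Rle_trans; [apply Rabs_triang |]. rewrite Rabs_mult, (Rabs_pos_eq 2) by lra.
assert (Htri : Rabs ((RInt (modosc 0) 0 A - RInt (fun x => exp (- (e * x)) * modosc 0 x) 0 A)
    + (RInt (fun x => exp (- (e * x)) * modosc 0 x) 0 A - lp) + (lp - PI * h eta))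
  <= e * (D * A ^ 2) + D * tail s A + g / 16).
{ eapply Rle_trans; [apply Rabs_triang |]. eapply Rle_trans; [apply Rplus_le_compat_r, Rabs_triang |]. lra. }
lra.
Qed.

(** Only the even part contributes: the coefficient of [sin t] is the odd function
    [modosc (PI / 2)], whose integral is zero. *)
Lemma modosc_integral (t : R) : is_RInt_gen (modosc t) minf pinf (2 * PI * cos t * h eta).
Proof.
destruct modosc_dominated as [D HD].
destruct (dominated_integral s Hs1 (modosc (PI / 2)) D (HD (PI / 2))) as [l [Hl _]].
assert (Hl0 : l = 0) by (apply (is_RInt_gen_odd (modosc (PI / 2)) l); [apply HD | apply modosc_odd | exact Hl]).
subst l.
pose proof (is_RInt_gen_plus _ _ _ _ (is_RInt_gen_scal _ (cos t) _ modosc_integral_even)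
  (is_RInt_gen_scal _ (sin t) _ Hl)) as P.
evar_last.
- refine (is_RInt_gen_ext _ _ _ _ P). apply filter_forall. intros ab x _. symmetry. apply modosc_decompose.
- unfold plus, scal; simpl; unfold mult; simpl. ring.
Qed.

End Inversion.

(** * Complex integrals and the operator on test functions *)

Lemma is_RInt_gen_pair (f : R -> C) (l : C) :
  is_RInt_gen (fun x => fst (f x)) minf pinf (fst l) ->
  is_RInt_gen (fun x => snd (f x)) minf pinf (snd l) ->
  is_RInt_gen (V := C_R_NormedModule) f minf pinf l.
Proof.
intros H1 H2 P [e He].
destruct (H1 (fun y => ball (fst l) e y)) as [P1 Q1 HP1 HQ1 H1'].
{ exists e. auto. }
destruct (H2 (fun y => ball (snd l) e y)) as [P2 Q2 HP2 HQ2 H2'].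
{ exists e. auto. }
exists (fun a => P1 a /\ P2 a) (fun b => Q1 b /\ Q2 b).
- now apply filter_and.
- now apply filter_and.
- intros a b [Ha1 Ha2] [Hb1 Hb2].
  destruct (H1' a b Ha1 Hb1) as [y1 [Hy1 Hb1']]. destruct (H2' a b Ha2 Hb2) as [y2 [Hy2 Hb2']].
  exists (y1, y2). split.
  + apply (is_RInt_fct_extend_pair f a b y1 y2); assumption.
  + apply He. split; assumption.
Qed.

Lemma is_RInt_gen_components (f : R -> C) (l : C) :
  is_RInt_gen (V := C_R_NormedModule) f minf pinf l ->
  is_RInt_gen (fun x => fst (f x)) minf pinf (fst l) /\
  is_RInt_gen (fun x => snd (f x)) minf pinf (snd l).
Proof.
intros H. split; intros P [e He].
- destruct (H (fun z => P (fst z))) as [P1 Q1 HP1 HQ1 H'].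
  { exists e. intros z [Hz _]. now apply He. }
  exists P1 Q1; auto. intros a b Ha Hb. destruct (H' a b Ha Hb) as [y [Hy Hy']].
  exists (fst y). split; [now apply (is_RInt_fct_extend_fst f) | exact Hy'].
- destruct (H (fun z => P (snd z))) as [P1 Q1 HP1 HQ1 H'].
  { exists e. intros z [_ Hz]. now apply He. }
  exists P1 Q1; auto. intros a b Ha Hb. destruct (H' a b Ha Hb) as [y [Hy Hy']].
  exists (snd y). split; [now apply (is_RInt_fct_extend_snd f) | exact Hy'].
Qed.

Lemma is_RInt_gen_Rlin (f g : R -> R) (a b lf lg : R) :
  is_RInt_gen f minf pinf lf -> is_RInt_gen g minf pinf lg ->
  is_RInt_gen (fun x => a * f x + b * g x) minf pinf (a * lf + b * lg).
Proof.
intros Hf Hg.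
exact (is_RInt_gen_plus _ _ _ _ (is_RInt_gen_scal _ a _ Hf) (is_RInt_gen_scal _ b _ Hg)).
Qed.

Lemma is_RInt_gen_ext_all (f g : R -> R) (l l' : R) : (forall x, f x = g x) -> l = l' ->
  is_RInt_gen f minf pinf l -> is_RInt_gen g minf pinf l'.
Proof.
intros H <- Hf. refine (is_RInt_gen_ext _ _ _ _ Hf). apply filter_forall. intros ab x _. apply H.
Qed.

Lemma is_RInt_gen_Cscal (f : R -> C) (l c : C) :
  is_RInt_gen (V := C_R_NormedModule) f minf pinf l ->
  is_RInt_gen (V := C_R_NormedModule) (fun x => (c * f x)%C) minf pinf (c * l)%C.
Proof.
intros H. destruct (is_RInt_gen_components f l H) as [H1 H2]. apply is_RInt_gen_pair.
- refine (is_RInt_gen_ext_all _ _ _ _ _ _ (is_RInt_gen_Rlin _ _ (fst c) (- snd c) _ _ H1 H2)).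
  + intros x. simpl. ring.
  + simpl. ring.
- refine (is_RInt_gen_ext_all _ _ _ _ _ _ (is_RInt_gen_Rlin _ _ (fst c) (snd c) _ _ H2 H1)).
  + intros x. simpl. ring.
  + simpl. ring.
Qed.

Lemma is_RInt_gen_Cplus (f g : R -> C) (l l' : C) :
  is_RInt_gen (V := C_R_NormedModule) f minf pinf l ->
  is_RInt_gen (V := C_R_NormedModule) g minf pinf l' ->
  is_RInt_gen (V := C_R_NormedModule) (fun x => (f x + g x)%C) minf pinf (l + l')%C.
Proof. intros Hf Hg. exact (is_RInt_gen_plus _ _ _ _ Hf Hg). Qed.

Lemma is_RInt_gen_Cext (f g : R -> C) (l l' : C) : (forall x, f x = g x) -> l = l' ->
  is_RInt_gen (V := C_R_NormedModule) f minf pinf l ->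
  is_RInt_gen (V := C_R_NormedModule) g minf pinf l'.
Proof.
intros H <- Hf. refine (is_RInt_gen_ext _ _ _ _ Hf). apply filter_forall. intros ab x _. apply H.
Qed.

Lemma is_RInt_gen_compact (f : R -> R) (M : R) : 0 <= M -> (forall x, continuous f x) ->
  (forall x, M < Rabs x -> f x = 0) -> is_RInt_gen f minf pinf (RInt f (- (M + 1)) (M + 1)).
Proof.
intros HM Hc Hz. apply is_RInt_gen_window; [intros; now apply ex_RInt_cont |].
intros e He. exists (M + 1). intros a b Ha Hb.
assert (Z : forall u v, u <= v -> (forall x, u < x < v -> M < Rabs x) -> RInt f u v = 0).
{ intros u v Huv Hx. rewrite (RInt_ext f (fun _ => 0)).
  - rewrite RInt_const. unfold scal; simpl; unfold mult; simpl. ring.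
  - intros x Hx'. rewrite Rmin_left, Rmax_right in Hx' by lra. apply Hz. auto. }
rewrite <- (RInt_Chasles_cont f a (- (M + 1)) b Hc), <- (RInt_Chasles_cont f (- (M + 1)) (M + 1) b Hc).
rewrite (Z a (- (M + 1))), (Z (M + 1) b); try lra.
- rewrite Rplus_0_l, Rplus_0_r, Rminus_diag, Rabs_R0. exact He.
- intros x Hx. rewrite Rabs_pos_eq; lra.
- intros x Hx. rewrite Rabs_left; lra.
Qed.

Lemma osc_phase (s : R) (h : R -> R) (C t x : R) : 1 < s < 2 -> amplitude s h C ->
  osc h t x = cos t * osc h 0 x + sin t * osc h (PI / 2) x.
Proof.
intros Hs Hh.
refine (osc_eq h _ t x _ _ (is_RInt_gen_Rlin _ _ (cos t) (sin t) _ _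
  (osc_correct s Hs h C Hh 0 x) (osc_correct s Hs h C Hh (PI / 2) x))).
intros xi. simpl. rewrite Rplus_0_r, (cos_plus _ (PI / 2)), cos_PI2, sin_PI2, cos_plus. ring.
Qed.

Lemma test_components (phi : R -> C) : test_fun phi ->
  exists M, 0 <= M /\ real_test (reF phi) M /\ real_test (imF phi) M.
Proof.
intros [Hsm [M HM]]. exists (Rmax 0 M). split; [apply Rmax_l |].
split; split; try (intros n x; apply (Hsm n x)); intros x Hx; unfold reF, imF; rewrite HM; auto;
  eapply Rle_lt_trans; [apply Rmax_r | exact Hx | apply Rmax_r | exact Hx].
Qed.

Definition four_re (phi : R -> C) (M xi : R) : R :=
  four (reF phi) M 0 xi + four (imF phi) M (- (PI / 2)) xi.
Definition four_im (phi : R -> C) (M xi : R) : R :=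
  four (imF phi) M 0 xi + - four (reF phi) M (- (PI / 2)) xi.

Lemma cos_minus_PI2' (y : R) : cos (y + - (PI / 2)) = sin y.
Proof. exact (cos_minus_PI2 y). Qed.

Lemma four_correct (f : R -> R) (M t xi : R) : 0 <= M -> real_test f M ->
  is_RInt_gen (fun x => cos (x * xi + t) * f x) minf pinf (four f M t xi).
Proof.
intros HM Hf. apply is_RInt_gen_compact; auto.
- intros x. now apply continuous_cos_affine_mult, (real_test_continuous f M).
- intros x Hx. destruct Hf as [_ Hf]. rewrite Hf by exact Hx. ring.
Qed.

Lemma fourier_test (phi : R -> C) (M xi : R) : 0 <= M -> real_test (reF phi) M -> real_test (imF phi) M ->
  is_RInt_gen (V := C_R_NormedModule) (fun x => (cis (- (x * xi)) * phi x)%C) minf pinf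
    (four_re phi M xi, four_im phi M xi).
Proof.
intros HM Hr Hi. apply is_RInt_gen_pair.
- refine (is_RInt_gen_ext_all _ _ _ _ _ _ (is_RInt_gen_Rlin _ _ 1 1 _ _
    (four_correct (reF phi) M 0 xi HM Hr) (four_correct (imF phi) M (- (PI / 2)) xi HM Hi))).
  + intros x. rewrite cos_minus_PI2', Rplus_0_r. unfold reF, imF. simpl. rewrite cos_neg, sin_neg. ring.
  + simpl. unfold four_re. ring.
- refine (is_RInt_gen_ext_all _ _ _ _ _ _ (is_RInt_gen_Rlin _ _ 1 (-1) _ _
    (four_correct (imF phi) M 0 xi HM Hi) (four_correct (reF phi) M (- (PI / 2)) xi HM Hr))).
  + intros x. rewrite cos_minus_PI2', Rplus_0_r. unfold reF, imF. simpl. rewrite cos_neg, sin_neg. ring.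
  + simpl. unfold four_im. ring.
Qed.

Lemma fourier_eq (phi : R -> C) (M xi : R) : 0 <= M -> real_test (reF phi) M -> real_test (imF phi) M ->
  fourier phi xi = (four_re phi M xi, four_im phi M xi).
Proof.
intros HM Hr Hi. unfold fourier.
apply (@is_RInt_gen_unique C_R_CompleteNormedModule minf pinf _ _ _ _).
now apply fourier_test.
Qed.

Lemma test_pairing (phi : R -> C) (eta : R) : test_fun phi ->
  is_RInt_gen (V := C_R_NormedModule) (fun x => (cis (eta * x) * Cconj (phi x))%C) minf pinf
    (Cconj (fourier phi eta)).
Proof.
intros Hphi. destruct (test_components phi Hphi) as [M [HM [Hr Hi]]].
rewrite (fourier_eq phi M eta HM Hr Hi).
destruct (is_RInt_gen_components _ _ (fourier_test phi M eta HM Hr Hi)) as [H1 H2].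
apply is_RInt_gen_pair.
- refine (is_RInt_gen_ext_all _ _ _ _ _ _ H1); [| reflexivity].
  intros x. simpl. rewrite cos_neg, sin_neg, (Rmult_comm x eta). ring.
- refine (is_RInt_gen_ext_all _ _ _ _ _ _ (is_RInt_gen_opp _ _ H2)); [| reflexivity].
  intros x. unfold opp; simpl. rewrite cos_neg, sin_neg, (Rmult_comm x eta). ring.
Qed.

(** One power of decay suffices to make the modes beyond the cut-off contribute a multiple of the
    mesh. *)
Lemma fourier_decay (phi : R -> C) : test_fun phi ->
  exists D, 0 <= D /\ forall xi, Rabs (fst (fourier phi xi)) * jb xi <= D /\ Rabs (snd (fourier phi xi)) * jb xi <= D.
Proof.
intros Hphi. destruct (test_components phi Hphi) as [M [HM [Hr Hi]]].
destruct (four_rapid _ M HM Hr) as [D1 H1]. destruct (four_rapid _ M HM Hi) as [D2 H2].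
assert (Hjb : forall xi y D, Rabs y * jb xi ^ 5 <= D -> Rabs y * jb xi <= D).
{ intros xi y D H. pose proof (jb_ge1 xi). eapply Rle_trans; [| exact H]. apply Rmult_le_compat_l; [apply Rabs_pos |].
  rewrite <- (pow_1 (jb xi)) at 1. apply Rle_pow; [lra | lia]. }
assert (HD1 : 0 <= D1) by (eapply Rle_trans; [| apply (H1 0 0)]; apply Rmult_le_pos; [apply Rabs_pos | apply pow_le; pose proof (jb_ge1 0); lra]).
assert (HD2 : 0 <= D2) by (eapply Rle_trans; [| apply (H2 0 0)]; apply Rmult_le_pos; [apply Rabs_pos | apply pow_le; pose proof (jb_ge1 0); lra]).
exists (D1 + D2). split; [lra |]. intros xi. rewrite (fourier_eq phi M xi HM Hr Hi). simpl. unfold four_re, four_im.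
pose proof (jb_ge1 xi).
split.
- pose proof (Hjb _ _ _ (H1 0 xi)). pose proof (Hjb _ _ _ (H2 (- (PI / 2)) xi)).
  pose proof (Rabs_triang (four (reF phi) M 0 xi) (four (imF phi) M (- (PI / 2)) xi)). nra.
- pose proof (Hjb _ _ _ (H2 0 xi)). pose proof (Hjb _ _ _ (H1 (- (PI / 2)) xi)).
  pose proof (Rabs_triang (four (imF phi) M 0 xi) (- four (reF phi) M (- (PI / 2)) xi)) as Ht.
  rewrite Rabs_Ropp in Ht. nra.
Qed.

Definition cdominated (s : R) (f : R -> C) : Prop :=
  (exists D, dominated s D (fun x => fst (f x))) /\ (exists D, dominated s D (fun x => snd (f x))).

Lemma test_cdominated (s : R) (phi : R -> C) : 1 < s -> test_fun phi -> cdominated s phi.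
Proof.
intros Hs Hphi. destruct (test_components phi Hphi) as [M [HM [Hr Hi]]].
assert (G : forall f, real_test f M -> exists D, dominated s D f).
{ intros f Hf. assert (Hc : forall x, continuous f x) by (intros; now apply (real_test_continuous f M)).
  destruct (continuity_ab_maj (fun x => Rabs (f x)) (- M) M) as [x0 [Hx0 _]]; [lra | |].
  - intros x _. apply continuity_pt_filterlim. apply (continuous_comp f Rabs); [apply Hc | apply continuous_Rabs].
  - exists (Rabs (f x0) * Rpower (1 + M) s). split; [exact Hc |]. intros x.
    assert (0 < Rpower (1 + M) s) by apply exp_pos. pose proof (wt_pos s x). pose proof (Rabs_pos (f x0)).
    destruct (Rle_lt_dec (Rabs x) M) as [Hx | Hx].
    + assert (Hw : 1 <= Rpower (1 + M) s * wt s x).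
      { unfold wt. rewrite Rpower_Ropp. apply (Rmult_le_reg_r (Rpower (1 + Rabs x) s)); [apply exp_pos |].
        rewrite Rmult_assoc, Rinv_l by (apply Rgt_not_eq, exp_pos). rewrite Rmult_1_l, Rmult_1_r.
        pose proof (Rabs_pos x). apply Rle_Rpower_l; lra. }
      pose proof (Hx0 x (proj1 (Rabs_le_between x M) Hx)) as Hle. simpl in Hle.
      rewrite Rmult_assoc. nra.
    + destruct Hf as [_ Hf]. rewrite Hf by exact Hx. rewrite Rabs_R0.
      apply Rmult_le_pos; [apply Rmult_le_pos; lra | lra]. }
split; [apply (G _ Hr) | apply (G _ Hi)].
Qed.

Section PkTest.

Variables (sigma k : R) (Hsigma : 1 / 2 < sigma < 1) (phi : R -> C) (Hphi : test_fun phi).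

(** Decay, continuity and inversion for [Pk] are reduced to the real integrals [osc]: multiplied by
    the symbol, the components of the transform are amplitudes. *)
Lemma Pk_components : exists (hr hi : R -> R) (C1 C2 : R),
  amplitude (2 * sigma) hr C1 /\ amplitude (2 * sigma) hi C2 /\
  (forall xi, (RtoC (p_sym sigma k xi) * fourier phi xi)%C = (hr xi, hi xi)) /\
  (forall x, Pk sigma k phi x =
    (/ (2 * PI) * (osc hr 0 x + osc hi (PI / 2) x), / (2 * PI) * (osc hi 0 x + osc hr (- (PI / 2)) x))).
Proof.
destruct (test_components phi Hphi) as [M [HM [Hr Hi]]].
assert (Hs : 1 < 2 * sigma < 2) by lra.
destruct (p_sym_symbol_like sigma k Hsigma) as [Cp Hp].
pose (p := p_sym sigma k). fold p in Hp.
destruct (symbol_times_four _ p Cp (reF phi) M 0 Hs Hp HM Hr) as [E1 A1].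
destruct (symbol_times_four _ p Cp (imF phi) M (- (PI / 2)) Hs Hp HM Hi) as [E2 A2].
destruct (symbol_times_four _ p Cp (imF phi) M 0 Hs Hp HM Hi) as [E3 A3].
destruct (symbol_times_four _ p Cp (reF phi) M (- (PI / 2)) Hs Hp HM Hr) as [E4 A4].
pose (hr := fun xi => p xi * four (reF phi) M 0 xi + p xi * four (imF phi) M (- (PI / 2)) xi).
pose (hi := fun xi => p xi * four (imF phi) M 0 xi + - (p xi * four (reF phi) M (- (PI / 2)) xi)).
assert (Hhr : amplitude (2 * sigma) hr (E1 + E2)).
{ apply (amplitude_plus _ (fun xi => p xi * four (reF phi) M 0 xi) (fun xi => p xi * four (imF phi) M (- (PI / 2)) xi)); assumption. }
assert (Hhi : amplitude (2 * sigma) hi (E3 + E4)).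
{ apply (amplitude_plus _ (fun xi => p xi * four (imF phi) M 0 xi)
    (fun xi => - (p xi * four (reF phi) M (- (PI / 2)) xi))); [assumption |].
  now apply (amplitude_opp _ (fun xi => p xi * four (reF phi) M (- (PI / 2)) xi)). }
assert (Hmul : forall xi, (RtoC (p_sym sigma k xi) * fourier phi xi)%C = (hr xi, hi xi)).
{ intros xi. rewrite (fourier_eq phi M xi HM Hr Hi). unfold four_re, four_im, hr, hi, p.
  apply injective_projections; simpl; ring. }
exists hr, hi, (E1 + E2), (E3 + E4). split; [exact Hhr |]. split; [exact Hhi |]. split; [exact Hmul |].
intros x. unfold Pk.
assert (HI : is_RInt_gen (V := C_R_NormedModule)
  (fun xi => (cis (x * xi) * RtoC (p_sym sigma k xi) * fourier phi xi)%C) minf pinf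
  (osc hr 0 x + osc hi (PI / 2) x, osc hi 0 x + osc hr (- (PI / 2)) x)).
{ assert (Hint : forall xi, (cis (x * xi) * RtoC (p_sym sigma k xi) * fourier phi xi)%C =
    (cos (x * xi) * hr xi - sin (x * xi) * hi xi, cos (x * xi) * hi xi + sin (x * xi) * hr xi)).
  { intros xi. rewrite <- Cmult_assoc, Hmul. unfold cis, Cmult. simpl. reflexivity. }
  apply is_RInt_gen_pair.
  - refine (is_RInt_gen_ext_all _ _ _ _ _ _ (is_RInt_gen_Rlin _ _ 1 1 _ _
      (osc_correct _ Hs hr _ Hhr 0 x) (osc_correct _ Hs hi _ Hhi (PI / 2) x))).
    + intros xi. rewrite Hint. simpl. rewrite (Rmult_comm xi x), Rplus_0_r, cos_plus, cos_PI2, sin_PI2. ring.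
    + simpl. ring.
  - refine (is_RInt_gen_ext_all _ _ _ _ _ _ (is_RInt_gen_Rlin _ _ 1 1 _ _
      (osc_correct _ Hs hi _ Hhi 0 x) (osc_correct _ Hs hr _ Hhr (- (PI / 2)) x))).
    + intros xi. rewrite Hint, cos_minus_PI2'. simpl. rewrite (Rmult_comm xi x), Rplus_0_r. ring.
    + simpl. ring. }
rewrite (@is_RInt_gen_unique C_R_CompleteNormedModule minf pinf _ _ _ _ HI).
apply injective_projections; simpl; ring.
Qed.

(** Integrability of [Pk phi] gives a meaning to its pairing with bounded functions without decay,
    and supplies the majorant for the passage to the limit. *)
Lemma Pk_cdominated : cdominated (2 * sigma) (Pk sigma k phi).
Proof.
destruct Pk_components as [hr [hi [C1 [C2 [Hr [Hi [_ HP]]]]]]].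
assert (Hs : 1 < 2 * sigma < 2) by lra. pose proof PI_RGT_0.
assert (HiPI : 0 < / (2 * PI)) by (apply Rinv_0_lt_compat; lra).
destruct (osc_decay _ Hs hr C1 Hr) as [D1 HD1]. destruct (osc_decay _ Hs hi C2 Hi) as [D2 HD2].
destruct (osc_lipschitz _ Hs hr C1 Hr) as [L1 HL1]. destruct (osc_lipschitz _ Hs hi C2 Hi) as [L2' HL2].
assert (G : forall t1 t2 (f : R -> R), (forall x, f x = / (2 * PI) * (osc hr t1 x + osc hi t2 x)) ->
  exists D, dominated (2 * sigma) D f).
{ intros t1 t2 f Hf. exists (/ (2 * PI) * (D1 + D2)). split.
  - intros x. apply (continuous_of_lipschitz f (/ (2 * PI) * (L1 + L2'))). intros y. rewrite !Hf.
    rewrite <- Rmult_minus_distr_l, Rabs_mult, (Rabs_pos_eq (/ _)) by lra. rewrite (Rmult_assoc (/ (2 * PI))).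
    apply Rmult_le_compat_l; [lra |].
    specialize (HL1 t1 t1 x y). specialize (HL2 t2 t2 x y).
    rewrite Rminus_diag, Rabs_R0, Rplus_0_r in HL1. rewrite Rminus_diag, Rabs_R0, Rplus_0_r in HL2.
    replace (osc hr t1 y + osc hi t2 y - (osc hr t1 x + osc hi t2 x)) with
      ((osc hr t1 y - osc hr t1 x) + (osc hi t2 y - osc hi t2 x)) by ring.
    eapply Rle_trans; [apply Rabs_triang |]. lra.
  - intros x. rewrite Hf, Rabs_mult, (Rabs_pos_eq (/ _)), Rmult_assoc by lra. apply Rmult_le_compat_l; [lra |].
    eapply Rle_trans; [apply Rabs_triang |]. specialize (HD1 t1 x). specialize (HD2 t2 x). lra. }
split.
- apply (G 0 (PI / 2)). intros x. now rewrite HP.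
- apply (G (- (PI / 2)) 0). intros x. rewrite HP. simpl. ring.
Qed.

(** Exponentials are generalised eigenfunctions of the multiplier. Fourier inversion evaluates the
    transform of [Pk phi] at [eta], where [2 * PI] cancels the normalisation. *)
Lemma Pk_pairing (eta : R) :
  is_RInt_gen (V := C_R_NormedModule) (fun x => (cis (eta * x) * Cconj (Pk sigma k phi x))%C) minf pinf
    (RtoC (p_sym sigma k eta) * Cconj (fourier phi eta))%C.
Proof.
destruct Pk_components as [hr [hi [C1 [C2 [Hr [Hi [Hmul HP]]]]]]].
assert (Hs : 1 < 2 * sigma < 2) by lra. pose proof PI_RGT_0.
assert (Hval : (RtoC (p_sym sigma k eta) * Cconj (fourier phi eta))%C = (hr eta, - hi eta)).
{ specialize (Hmul eta). destruct (fourier phi eta) as [u v].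
  pose proof (f_equal fst Hmul) as M1. pose proof (f_equal snd Hmul) as M2. simpl in M1, M2.
  apply injective_projections; simpl; lra. }
rewrite Hval.
assert (Hneg : forall h C x, amplitude (2 * sigma) h C -> osc h (- (PI / 2)) x = - osc h (PI / 2) x).
{ intros h C x Hh. rewrite (osc_phase _ h C (- (PI / 2)) x Hs Hh), cos_neg, sin_neg, cos_PI2, sin_PI2. ring. }
assert (Hmod : forall h C t x, amplitude (2 * sigma) h C ->
  modosc h eta t x = cos (t - x * eta) * osc h 0 x + sin (t - x * eta) * osc h (PI / 2) x).
{ intros h C t x Hh. unfold modosc. apply (osc_phase _ h C _ x Hs Hh). }
apply is_RInt_gen_pair.
- refine (is_RInt_gen_ext_all _ _ _ _ _ _ (is_RInt_gen_Rlin _ _ (/ (2 * PI)) (/ (2 * PI)) _ _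
    (modosc_integral _ Hs hr C1 eta Hr 0) (modosc_integral _ Hs hi C2 eta Hi (PI / 2)))).
  + intros x. rewrite HP, (Hmod hr C1), (Hmod hi C2), (Hneg hr C1) by assumption.
    simpl. rewrite !cos_minus, !sin_minus, cos_0, sin_0, cos_PI2, sin_PI2, (Rmult_comm x eta). ring.
  + simpl. rewrite cos_0, cos_PI2. field. lra.
- refine (is_RInt_gen_ext_all _ _ _ _ _ _ (is_RInt_gen_Rlin _ _ (- / (2 * PI)) (- / (2 * PI)) _ _
    (modosc_integral _ Hs hi C2 eta Hi 0) (modosc_integral _ Hs hr C1 eta Hr (- (PI / 2))))).
  + intros x. rewrite HP, (Hmod hr C1), (Hmod hi C2), (Hneg hr C1) by assumption.
    simpl. rewrite !cos_minus, !sin_minus, cos_0, sin_0, cos_neg, sin_neg, cos_PI2, sin_PI2, (Rmult_comm x eta). ring.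
  + simpl. rewrite cos_0, cos_neg, cos_PI2. field. lra.
Qed.

End PkTest.

(** * The equation for the discrete solutions *)

Arguments fsum : simpl never.

Lemma C_eq (z w : C) : fst z = fst w -> snd z = snd w -> z = w.
Proof. apply injective_projections. Qed.

Lemma cis_plus (a b : R) : cis (a + b) = (cis a * cis b)%C.
Proof. apply C_eq; simpl; rewrite ?cos_plus, ?sin_plus; ring. Qed.

Lemma cis_conj (a : R) : Cconj (cis a) = cis (- a).
Proof. apply C_eq; simpl; rewrite ?cos_neg, ?sin_neg; reflexivity. Qed.

Definition cfsum (K : nat) (f : nat -> C) : C :=
  (fsum K (fun i => fst (f i)), fsum K (fun i => snd (f i))).

Lemma cfsum_ext (K : nat) (f g : nat -> C) : (forall i, (i < K)%nat -> f i = g i) -> cfsum K f = cfsum K g.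
Proof. intros H. apply C_eq; simpl; apply fsum_ext; intros i Hi; now rewrite H. Qed.

Lemma cfsum_plus (K : nat) (f g : nat -> C) : (cfsum K f + cfsum K g)%C = cfsum K (fun i => (f i + g i)%C).
Proof. apply C_eq; simpl; now rewrite fsum_plus. Qed.

Lemma cfsum_scal (K : nat) (c : C) (f : nat -> C) : (c * cfsum K f)%C = cfsum K (fun i => (c * f i)%C).
Proof.
apply C_eq; simpl.
- rewrite <- !fsum_scal, <- fsum_minus. apply fsum_ext; intros; ring.
- rewrite <- !fsum_scal, <- fsum_plus. apply fsum_ext; intros; ring.
Qed.

Lemma cfsum_scal_r (K : nat) (c : C) (f : nat -> C) : (cfsum K f * c)%C = cfsum K (fun i => (f i * c)%C).
Proof.
rewrite Cmult_comm, cfsum_scal. apply cfsum_ext; intros; apply Cmult_comm.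
Qed.

Lemma cfsum_conj (K : nat) (f : nat -> C) : Cconj (cfsum K f) = cfsum K (fun i => Cconj (f i)).
Proof.
apply C_eq; simpl; [reflexivity |].
replace (- fsum K (fun i => snd (f i))) with (-1 * fsum K (fun i => snd (f i))) by ring.
rewrite <- fsum_scal. apply fsum_ext; intros; ring.
Qed.

Lemma is_RInt_gen_cfsum (K : nat) (f : nat -> R -> C) (l : nat -> C) :
  (forall i, (i < K)%nat -> is_RInt_gen (V := C_R_NormedModule) (f i) minf pinf (l i)) ->
  is_RInt_gen (V := C_R_NormedModule) (fun x => cfsum K (fun i => f i x)) minf pinf (cfsum K l).
Proof.
assert (Z : is_RInt_gen (fun _ : R => 0) minf pinf 0).
{ apply is_RInt_gen_window; [intros; apply ex_RInt_const |]. intros e He. exists 0. intros a b _ _.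
  rewrite RInt_const. unfold scal; simpl; unfold mult; simpl. rewrite Rmult_0_r, Rminus_0_r, Rabs_R0. exact He. }
induction K as [| K IH]; intros H.
- apply is_RInt_gen_pair; exact Z.
- refine (is_RInt_gen_Cext _ _ _ _ _ _ (is_RInt_gen_Cplus _ _ _ _ (IH _) (H K _))).
  + intros x. reflexivity.
  + reflexivity.
  + intros i Hi. apply H. lia.
  + lia.
Qed.

(** The discrete equation summed against [psi] yields the triples whose combined frequency is on the
    grid, while the cube of the wave contains all triples. The others lie beyond the cut-off, where
    [psi] is at most [D * mesh n], and their total weight is at most [C0 ^ 3]. *)
Lemma resonance_defect (n : nat) (G : nat -> R) (m psi : R -> R) (C0 D : R) :
  (forall i, 0 <= G i) ->
  (forall d, (d < len n)%nat -> m (node n d) * G d = mesh n ^ 2 * trilin (len n) G G G d) ->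
  mesh n * fsum (len n) G <= C0 -> (forall x, Rabs (psi x) * jb x <= D) ->
  Rabs (fsum (len n) (fun a => mesh n * G a * (m (node n a) * psi (node n a))) -
    fsum (len n) (fun a => fsum (len n) (fun b => fsum (len n) (fun c =>
      mesh n * G a * (mesh n * G b) * (mesh n * G c) * psi (node n a - node n b + node n c)))))
  <= D * C0 ^ 3 * mesh n.
Proof.
intros HG HEL HC0 Hpsi. pose (K := len n). fold K in HEL, HC0 |- *. pose (h := mesh n). fold h in HEL, HC0 |- *.
assert (Hh : 0 < h) by apply mesh_pos.
pose (g := fun a => h * G a).
assert (Hg : forall a, 0 <= g a) by (intros a; apply Rmult_le_pos; [lra | auto]).
assert (HD : 0 <= D).
{ eapply Rle_trans; [| apply (Hpsi 0)]. apply Rmult_le_pos; [apply Rabs_pos | pose proof (jb_ge1 0); lra]. }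
(* The sum over [d] is moved inside, where it counts the grid indices resonant with [a], [b], [c].
   It equals [1] or [0], and the defect consists of the triples for which it is [0]. *)
assert (E1 : fsum K (fun a => h * G a * (m (node n a) * psi (node n a))) =
  fsum K (fun a => fsum K (fun b => fsum K (fun c =>
    g a * g b * g c * psi (node n a - node n b + node n c) * fsum K (fun d => indic (a + c =? b + d)%nat))))).
{ transitivity (fsum K (fun d => fsum K (fun a => fsum K (fun b => fsum K (fun c =>
    indic (a + c =? b + d)%nat * (g a * g b * g c * psi (node n d))))))).
  - apply fsum_ext; intros d Hd.
    replace (h * G d * (m (node n d) * psi (node n d))) with (h * psi (node n d) * (m (node n d) * G d)) by ring.
    rewrite HEL by exact Hd. unfold trilin.
    replace (h * psi (node n d) * (h ^ 2 * fsum K (fun a => fsum K (fun b => fsum K (fun c =>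
      indic (a + c =? b + d)%nat * (G a * G b * G c)))))) with (h ^ 3 * psi (node n d) * fsum K (fun a => fsum K (fun b => fsum K (fun c =>
      indic (a + c =? b + d)%nat * (G a * G b * G c))))) by ring.
    rewrite <- fsum_scal; apply fsum_ext; intros a _. rewrite <- fsum_scal; apply fsum_ext; intros b _.
    rewrite <- fsum_scal; apply fsum_ext; intros c _. unfold g. ring.
  - rewrite (fsum_swap K K (fun d a => fsum K (fun b => fsum K (fun c =>
      indic (a + c =? b + d)%nat * (g a * g b * g c * psi (node n d)))))).
    apply fsum_ext; intros a _.
    rewrite (fsum_swap K K (fun d b => fsum K (fun c => indic (a + c =? b + d)%nat * (g a * g b * g c * psi (node n d))))).
    apply fsum_ext; intros b _.
    rewrite (fsum_swap K K (fun d c => indic (a + c =? b + d)%nat * (g a * g b * g c * psi (node n d)))).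
    apply fsum_ext; intros c _. rewrite <- fsum_scal. apply fsum_ext; intros d _.
    destruct (Nat.eqb_spec (a + c) (b + d)) as [E | E]; simpl indic; [| ring].
    rewrite (node_resonant n a b c d E). ring. }
rewrite E1.
rewrite <- fsum_minus. rewrite (fsum_ext K _ (fun a => fsum K (fun b => fsum K (fun c =>
   g a * g b * g c * psi (node n a - node n b + node n c) * (fsum K (fun d => indic (a + c =? b + d)%nat) - 1))))).
2:{ intros a _. rewrite <- fsum_minus. apply fsum_ext; intros b _. rewrite <- fsum_minus. apply fsum_ext; intros c _.
    unfold g. ring. }
apply Rle_trans with (fsum K (fun a => fsum K (fun b => fsum K (fun c => g a * g b * g c * (D * h))))).
- eapply Rle_trans; [apply fsum_abs |]. apply fsum_le; intros a Ha.
  eapply Rle_trans; [apply fsum_abs |]. apply fsum_le; intros b Hb.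
  eapply Rle_trans; [apply fsum_abs |]. apply fsum_le; intros c Hc.
  rewrite (Rmult_assoc (g a * g b * g c)), Rabs_mult.
  assert (Hggg : 0 <= g a * g b * g c) by (apply Rmult_le_pos; [apply Rmult_le_pos |]; apply Hg).
  rewrite (Rabs_pos_eq (g a * g b * g c)) by exact Hggg. apply Rmult_le_compat_l; [exact Hggg |].
  assert (HDh : 0 <= D * h) by (apply Rmult_le_pos; lra).
  assert (Hfar : INR (S n) <= Rabs (node n a - node n b + node n c) ->
    Rabs (psi (node n a - node n b + node n c)) <= D * h).
  { intros Hf. specialize (Hpsi (node n a - node n b + node n c)). unfold jb in Hpsi.
    pose proof (Rabs_pos (psi (node n a - node n b + node n c))).
    assert (Hn : 0 < INR (S n)) by (apply lt_0_INR; lia).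
    apply (Rmult_le_reg_r (INR (S n))); [exact Hn |].
    rewrite Rmult_assoc. unfold h. rewrite mesh_mult, Rmult_1_r. nra. }
  assert (Hnd : node n a - node n b + node n c = (INR a + INR c - INR b - INR (mid n)) * h).
  { unfold node, h. ring. }
  assert (Hmid : INR (mid n) * h = 3 * INR (S n)).
  { unfold mid, h. rewrite !mult_INR. replace (INR 3) with 3 by (simpl; ring).
    transitivity (3 * INR (S n) * (mesh n * INR (S n))); [ring | rewrite mesh_mult; ring]. }
  assert (Hn0 : 0 < INR (S n)) by (apply lt_0_INR; lia).
  (* The output index leaves the grid above or below. In both cases it is at distance at least
     [mid n] from the centre, so the frequency is at least [3 * INR (S n)] in modulus. The split
     comes first because [a + c - b] is truncated in [nat]. *)
  destruct (Nat.le_gt_cases b (a + c)) as [Hbl | Hbl].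
  + rewrite (fsum_ext K _ (fun d => indic (d =? a + c - b)%nat * 1)).
    2:{ intros d _. destruct (Nat.eqb_spec (a + c) (b + d)); destruct (Nat.eqb_spec d (a + c - b)); simpl; lia || ring. }
    rewrite (fsum_delta K (a + c - b) (fun _ => 1)).
    destruct (Nat.ltb_spec (a + c - b) K) as [Hin | Hout]; simpl indic.
    * replace (psi (node n a - node n b + node n c) * (1 * 1 - 1)) with 0 by ring. rewrite Rabs_R0. exact HDh.
    * replace (psi (node n a - node n b + node n c) * (0 * 1 - 1)) with (- psi (node n a - node n b + node n c)) by ring.
      rewrite Rabs_Ropp. apply Hfar. rewrite Hnd.
      assert (Hr : INR (mid n) <= INR a + INR c - INR b - INR (mid n)).
      { assert (INR (b + 2 * mid n) <= INR (a + c)) by (apply le_INR; unfold K, len in Hout; lia).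
        rewrite !plus_INR, mult_INR in H. simpl (INR 2) in H. lra. }
      eapply Rle_trans; [| apply Rle_abs].
      apply Rle_trans with (INR (mid n) * h); [lra |]. apply Rmult_le_compat_r; lra.
  + rewrite (fsum_ext K _ (fun _ => 0)).
    2:{ intros d _. destruct (Nat.eqb_spec (a + c) (b + d)); [lia | reflexivity]. }
    rewrite fsum_zero.
    replace (psi (node n a - node n b + node n c) * (0 - 1)) with (- psi (node n a - node n b + node n c)) by ring.
    rewrite Rabs_Ropp. apply Hfar. rewrite Hnd.
    assert (Hr : INR (mid n) <= - (INR a + INR c - INR b - INR (mid n))).
    { assert (INR (a + c) <= INR b) by (apply le_INR; lia). rewrite plus_INR in H. lra. }
    rewrite <- Rabs_Ropp. eapply Rle_trans; [| apply Rle_abs].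
    apply Rle_trans with (INR (mid n) * h); [lra |].
    replace (- ((INR a + INR c - INR b - INR (mid n)) * h)) with (- (INR a + INR c - INR b - INR (mid n)) * h) by ring.
    apply Rmult_le_compat_r; lra.
- assert (Hsum : fsum K g = h * fsum K G) by (unfold g; apply fsum_scal).
  replace (fsum K (fun a => fsum K (fun b => fsum K (fun c => g a * g b * g c * (D * h)))))
    with (fsum K g ^ 3 * (D * h)).
  + rewrite Hsum. replace (D * C0 ^ 3 * h) with (C0 ^ 3 * (D * h)) by ring.
    apply Rmult_le_compat_r; [apply Rmult_le_pos; lra |]. apply pow_incr. split; [| exact HC0].
    rewrite <- Hsum. apply fsum_nonneg; auto.
  + replace (fsum K g ^ 3 * (D * h)) with (fsum K g * (fsum K g * (fsum K g * (D * h)))) by ring.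
    rewrite <- (fsum_scal_r K (fsum K g * (fsum K g * (D * h))) g). apply fsum_ext; intros a _.
    rewrite <- (fsum_scal_r K (fsum K g * (D * h)) g), <- fsum_scal. apply fsum_ext; intros b _.
    rewrite <- (fsum_scal_r K (D * h) g), <- !fsum_scal. apply fsum_ext; intros c _. ring.
Qed.

(** * Weak equation for trigonometric polynomials with a phase, a modulation and a shift *)

Section Level.

Variables (alpha k' s0 a0 c0 : R) (pk m : R -> R) (P phi Fphi : R -> C).
Hypothesis (HP : forall eta, is_RInt_gen (V := C_R_NormedModule)
  (fun x => (cis (eta * x) * Cconj (P x))%C) minf pinf (RtoC (pk eta) * Cconj (Fphi eta))%C).
Hypothesis (Hphi : forall eta, is_RInt_gen (V := C_R_NormedModule)
  (fun x => (cis (eta * x) * Cconj (phi x))%C) minf pinf (Cconj (Fphi eta))).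
Hypothesis (Hsym : forall xi, pk (xi + k') + a0 - c0 * xi = m xi).

(** The parameters serve both equations. With all of them zero except [a0] they give the standing
    equation; with a modulation [k'], a shift [s0], a phase [alpha] and a drift [c0] they give the
    travelling wave, for the symbol of the fractional Laplacian. By [Hsym] the effective symbol is
    [m] in both cases. *)
Definition mode (xi x : R) : C := (cis alpha * cis (k' * x) * cis (xi * (x - s0)))%C.
Definition mode_coeff (xi : R) : C := (cis (alpha - xi * s0) * Cconj (Fphi (xi + k')))%C.

Lemma mode_eq (xi x : R) : mode xi x = (cis (alpha - xi * s0) * cis ((xi + k') * x))%C.
Proof. unfold mode. rewrite <- !cis_plus. f_equal. ring. Qed.

Lemma mode_triple (x1 x2 x3 x : R) :
  (mode x1 x * Cconj (mode x2 x) * mode x3 x)%C = mode (x1 - x2 + x3) x.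
Proof. rewrite !mode_eq, <- !cis_plus, cis_conj, <- !cis_plus. f_equal. ring. Qed.

Lemma mode_integral (xi : R) : is_RInt_gen (V := C_R_NormedModule)
  (fun x => (mode xi x * Cconj (phi x))%C) minf pinf (mode_coeff xi).
Proof.
refine (is_RInt_gen_Cext _ _ _ _ _ _ (is_RInt_gen_Cscal _ _ (cis (alpha - xi * s0)) (Hphi (xi + k')))).
- intros x. rewrite mode_eq. ring.
- reflexivity.
Qed.

Lemma mode_integral_lin (xi : R) : is_RInt_gen (V := C_R_NormedModule)
  (fun x => (mode xi x * Cconj (P x) + RtoC (a0 - c0 * xi) * (mode xi x * Cconj (phi x)))%C) minf pinf
  (RtoC (m xi) * mode_coeff xi)%C.
Proof.
refine (is_RInt_gen_Cext _ _ _ _ _ _ (is_RInt_gen_Cplus _ _ _ _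
  (is_RInt_gen_Cscal _ _ (cis (alpha - xi * s0)) (HP (xi + k')))
  (is_RInt_gen_Cscal _ _ (RtoC (a0 - c0 * xi)) (mode_integral xi)))).
- intros x. rewrite mode_eq. ring.
- unfold mode_coeff. rewrite <- (Hsym xi).
  replace (RtoC (pk (xi + k') + a0 - c0 * xi)) with (RtoC (pk (xi + k')) + RtoC (a0 - c0 * xi))%C
    by (apply C_eq; simpl; ring). ring.
Qed.

Variables (n : nat) (G : nat -> R).

Definition waveN (x : R) : C := cfsum (len n) (fun a => (RtoC (mesh n * G a) * mode (node n a) x)%C).
(** The factor [Ci * node] differentiates the profile alone, leaving the phase and the modulation
    untouched; this represents the drift term [c0 * xi] of [Hsym]. *)
Definition waveN1 (x : R) : C :=
  cfsum (len n) (fun a => (RtoC (mesh n * G a) * (Ci * RtoC (node n a)) * mode (node n a) x)%C).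

Definition residualN (x : R) : C :=
  (waveN x * Cconj (P x) + (RtoC a0 * waveN x + Ci * RtoC c0 * waveN1 x) * Cconj (phi x)
   - waveN x * Cconj (waveN x) * waveN x * Cconj (phi x))%C.

Definition defectN : C :=
  (cfsum (len n) (fun a => (RtoC (mesh n * G a) * (RtoC (m (node n a)) * mode_coeff (node n a)))%C)
   + RtoC (-1) * cfsum (len n) (fun a => cfsum (len n) (fun b => cfsum (len n) (fun c =>
      (RtoC (mesh n * G a * (mesh n * G b) * (mesh n * G c)) *
        mode_coeff (node n a - node n b + node n c))%C))))%C.

(** Integration mode by mode: the linear part multiplies each mode coefficient by [m], and
    [mode_triple] makes the cubic part a sum over all triples, with no restriction to the grid. *)
Lemma residualN_integral :
  is_RInt_gen (V := C_R_NormedModule) residualN minf pinf defectN.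
Proof.
refine (is_RInt_gen_Cext _ _ _ _ _ _ (is_RInt_gen_Cplus _ _ _ _
  (is_RInt_gen_cfsum (len n) (fun a x => (RtoC (mesh n * G a) *
     (mode (node n a) x * Cconj (P x) + RtoC (a0 - c0 * node n a) * (mode (node n a) x * Cconj (phi x))))%C) _ _)
  (is_RInt_gen_Cscal _ _ (RtoC (-1)) (is_RInt_gen_cfsum (len n) (fun a x => cfsum (len n) (fun b => cfsum (len n) (fun c =>
      (RtoC (mesh n * G a * (mesh n * G b) * (mesh n * G c)) *
        (mode (node n a - node n b + node n c) x * Cconj (phi x)))%C))) _ _)))).
3:{ intros a _. apply is_RInt_gen_Cscal, mode_integral_lin. }
3:{ intros a _.
    refine (is_RInt_gen_cfsum (len n) (fun b x => cfsum (len n) (fun c =>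
      (RtoC (mesh n * G a * (mesh n * G b) * (mesh n * G c)) *
        (mode (node n a - node n b + node n c) x * Cconj (phi x)))%C)) _ _). intros b _.
    refine (is_RInt_gen_cfsum (len n) (fun c x =>
      (RtoC (mesh n * G a * (mesh n * G b) * (mesh n * G c)) *
        (mode (node n a - node n b + node n c) x * Cconj (phi x)))%C) _ _). intros c _.
    apply is_RInt_gen_Cscal, mode_integral. }
- intros x. unfold residualN.
  replace (waveN x * Cconj (P x) + (RtoC a0 * waveN x + Ci * RtoC c0 * waveN1 x) * Cconj (phi x)
     - waveN x * Cconj (waveN x) * waveN x * Cconj (phi x))%C with
   ((waveN x * Cconj (P x) + (waveN x * (RtoC a0 * Cconj (phi x)) + waveN1 x * (Ci * RtoC c0 * Cconj (phi x)))
     + RtoC (-1) * (waveN x * (Cconj (waveN x) * (waveN x * Cconj (phi x))))))%C.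
  2:{ replace (RtoC (-1)) with (- (1))%C by (apply C_eq; simpl; ring). ring. }
  f_equal.
  + unfold waveN, waveN1. rewrite !cfsum_scal_r, !cfsum_plus. apply cfsum_ext. intros a _.
    (* The minus sign of the drift is [Ci * Ci], one factor coming from [residualN] and the other
       from [waveN1]. *)
    replace (RtoC (a0 - c0 * node n a)) with (RtoC a0 + (Ci * Ci) * (RtoC c0 * RtoC (node n a)))%C.
    * ring.
    * apply C_eq; simpl; ring.
  + f_equal. unfold waveN at 1. rewrite cfsum_scal_r. apply cfsum_ext. intros a _.
    unfold waveN at 1. rewrite cfsum_conj, cfsum_scal_r, cfsum_scal. apply cfsum_ext. intros b _.
    unfold waveN. rewrite cfsum_scal_r, !cfsum_scal. apply cfsum_ext. intros c _.
    rewrite <- mode_triple, !RtoC_mult, Cmult_conj.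
    replace (Cconj (RtoC (mesh n) * RtoC (G b))) with (RtoC (mesh n) * RtoC (G b))%C by (apply C_eq; simpl; ring).
    ring.
- reflexivity.
Qed.

Lemma defectN_small (C0 D : R) :
  (forall i, 0 <= G i) ->
  (forall d, (d < len n)%nat -> m (node n d) * G d = mesh n ^ 2 * trilin (len n) G G G d) ->
  mesh n * fsum (len n) G <= C0 ->
  (forall xi, Rabs (fst (mode_coeff xi)) * jb xi <= D /\ Rabs (snd (mode_coeff xi)) * jb xi <= D) ->
  Rabs (fst defectN) <= D * C0 ^ 3 * mesh n /\ Rabs (snd defectN) <= D * C0 ^ 3 * mesh n.
Proof.
intros HG HEL HC0 HD.
pose proof (resonance_defect n G m (fun xi => fst (mode_coeff xi)) C0 D HG HEL HC0 (fun x => proj1 (HD x))) as H1.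
pose proof (resonance_defect n G m (fun xi => snd (mode_coeff xi)) C0 D HG HEL HC0 (fun x => proj2 (HD x))) as H2.
assert (Hadd1 : forall z w, fst (z + w)%C = fst z + fst w) by reflexivity.
assert (Hadd2 : forall z w, snd (z + w)%C = snd z + snd w) by reflexivity.
assert (Hfst : forall x z, fst (RtoC x * z)%C = x * fst z) by (intros; simpl; ring).
assert (Hsnd : forall x z, snd (RtoC x * z)%C = x * snd z) by (intros; simpl; ring).
split.
- eapply Rle_trans; [right | exact H1]. f_equal. unfold defectN.
  rewrite Hadd1, Hfst.
  unfold Rminus. f_equal.
  + unfold cfsum. cbn [fst snd]. apply fsum_ext; intros a _. rewrite !Hfst. ring.
  + replace (-1) with (- (1)) by ring. rewrite Ropp_mult_distr_l_reverse, Rmult_1_l. f_equal.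
    unfold cfsum. cbn [fst snd]. apply fsum_ext; intros a _. apply fsum_ext; intros b _. apply fsum_ext; intros c _.
    apply Hfst.
- eapply Rle_trans; [right | exact H2]. f_equal. unfold defectN.
  rewrite Hadd2, Hsnd.
  unfold Rminus. f_equal.
  + unfold cfsum. cbn [fst snd]. apply fsum_ext; intros a _. rewrite !Hsnd. ring.
  + replace (-1) with (- (1)) by ring. rewrite Ropp_mult_distr_l_reverse, Rmult_1_l. f_equal.
    unfold cfsum. cbn [fst snd]. apply fsum_ext; intros a _. apply fsum_ext; intros b _. apply fsum_ext; intros c _.
    apply Hsnd.
Qed.

Lemma waveN_prof (x : R) : waveN x =
  (cis alpha * cis (k' * x) * (prof n G 0 0 (x - s0), prof n G 0 (- (PI / 2)) (x - s0)))%C.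
Proof.
unfold waveN, mode.
rewrite (cfsum_ext _ _ (fun a => (cis alpha * cis (k' * x) * (RtoC (mesh n * G a) * cis (node n a * (x - s0))))%C))
  by (intros; ring).
rewrite <- cfsum_scal. f_equal. apply C_eq; simpl; unfold prof; rewrite <- fsum_scal; apply fsum_ext; intros a _; simpl.
- replace (node n a * (x - s0) + 0 + 0 * (PI / 2)) with (node n a * (x - s0)) by ring. ring.
- replace (node n a * (x - s0) + - (PI / 2) + 0 * (PI / 2)) with (node n a * (x - s0) + - (PI / 2)) by ring.
  rewrite cos_minus_PI2'. ring.
Qed.

Lemma waveN1_prof (x : R) : waveN1 x =
  (cis alpha * cis (k' * x) * (prof n G 1 0 (x - s0), prof n G 1 (- (PI / 2)) (x - s0)))%C.
Proof.
unfold waveN1, mode.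
rewrite (cfsum_ext _ _ (fun a => (cis alpha * cis (k' * x) * (RtoC (mesh n * G a) * (Ci * RtoC (node n a)) * cis (node n a * (x - s0))))%C))
  by (intros; ring).
rewrite <- cfsum_scal. f_equal. apply C_eq; simpl; unfold prof; rewrite <- fsum_scal; apply fsum_ext; intros a _; simpl.
- replace (node n a * (x - s0) + 0 + 1 * (PI / 2)) with (node n a * (x - s0) + PI / 2) by ring.
  rewrite cos_plus, cos_PI2, sin_PI2. ring.
- replace (node n a * (x - s0) + - (PI / 2) + 1 * (PI / 2)) with (node n a * (x - s0)) by ring. ring.
Qed.

End Level.

(** * Passage to the limit *)

Definition cbec (f : nat -> R -> C) : Prop :=
  bec (fun n x => fst (f n x)) /\ bec (fun n x => snd (f n x)).

Lemma bec_opp (f : nat -> R -> R) : bec f -> bec (fun n x => - f n x).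
Proof.
intros H. apply (bec_ext (fun n x => -1 * f n x)); [intros; ring |]. apply bec_mult; [apply bec_const | exact H].
Qed.

Lemma cbec_mult (f g : nat -> R -> C) : cbec f -> cbec g -> cbec (fun n x => (f n x * g n x)%C).
Proof.
intros [H1 H2] [G1 G2]. split; simpl.
- apply (bec_plus (fun n x => fst (f n x) * fst (g n x)) (fun n x => - (snd (f n x) * snd (g n x)))).
  + now apply bec_mult.
  + now apply (bec_opp (fun n x => snd (f n x) * snd (g n x))), bec_mult.
- apply (bec_plus (fun n x => fst (f n x) * snd (g n x)) (fun n x => snd (f n x) * fst (g n x)));
    now apply bec_mult.
Qed.

Lemma cbec_plus (f g : nat -> R -> C) : cbec f -> cbec g -> cbec (fun n x => (f n x + g n x)%C).
Proof. intros [H1 H2] [G1 G2]. split; simpl; now apply bec_plus. Qed.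

Lemma cbec_opp (f : nat -> R -> C) : cbec f -> cbec (fun n x => (- f n x)%C).
Proof. intros [H1 H2]. split; simpl; now apply bec_opp. Qed.

Lemma cbec_conj (f : nat -> R -> C) : cbec f -> cbec (fun n x => Cconj (f n x)).
Proof. intros [H1 H2]. split; simpl; [exact H1 | now apply bec_opp]. Qed.

Lemma cbec_const (c : C) : cbec (fun _ _ => c).
Proof. split; apply bec_const. Qed.

Lemma cbec_ext (f g : nat -> R -> C) : (forall n x, f n x = g n x) -> cbec f -> cbec g.
Proof. intros H [H1 H2]. split; [refine (bec_ext _ _ _ H1) | refine (bec_ext _ _ _ H2)]; intros; now rewrite H. Qed.

Lemma cbec_cis (k : R) : cbec (fun _ x => cis (k * x)).
Proof.
split; simpl.
- apply (bec_fixed (fun x => cos (k * x)) 1); [| intros; apply cos_abs_le1].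
  intros x. apply (@ex_derive_continuous R_AbsRing R_NormedModule). auto_derive. trivial.
- apply (bec_fixed (fun x => sin (k * x)) 1); [| intros; apply Rabs_le, SIN_bound].
  intros x. apply (@ex_derive_continuous R_AbsRing R_NormedModule). auto_derive. trivial.
Qed.

Definition culim (U : (nat -> Prop) -> Prop) (z : nat -> C) (l : C) : Prop :=
  ulim U (fun n => fst (z n)) (fst l) /\ ulim U (fun n => snd (z n)) (snd l).

Section CUlim.

Variables (U : (nat -> Prop) -> Prop) (HU : free_ultra U).

Lemma culim_const (c : C) : culim U (fun _ => c) c.
Proof. split; apply ulim_const, HU. Qed.

Lemma ulim_opp (u : nat -> R) (l : R) : ulim U u l -> ulim U (fun n => - u n) (- l).
Proof.
intros H. replace (- l) with (-1 * l) by ring. apply (ulim_ext U HU (fun n => -1 * u n)); [intros; ring |].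
now apply ulim_scal.
Qed.

Lemma culim_mult (z w : nat -> C) (l l' : C) :
  culim U z l -> culim U w l' -> culim U (fun n => (z n * w n)%C) (l * l')%C.
Proof.
intros [H1 H2] [G1 G2]. split; simpl.
- apply ulim_minus; [exact HU | |]; now apply ulim_mult.
- apply ulim_plus; [exact HU | |]; now apply ulim_mult.
Qed.

Lemma culim_plus (z w : nat -> C) (l l' : C) :
  culim U z l -> culim U w l' -> culim U (fun n => (z n + w n)%C) (l + l')%C.
Proof. intros [H1 H2] [G1 G2]. split; simpl; now apply ulim_plus. Qed.

Lemma culim_opp (z : nat -> C) (l : C) : culim U z l -> culim U (fun n => (- z n)%C) (- l)%C.
Proof. intros [H1 H2]. split; simpl; now apply ulim_opp. Qed.

Lemma culim_conj (z : nat -> C) (l : C) : culim U z l -> culim U (fun n => Cconj (z n)) (Cconj l).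
Proof. intros [H1 H2]. split; simpl; [exact H1 | now apply ulim_opp]. Qed.

Lemma culim_ext (z w : nat -> C) (l : C) : (forall n, z n = w n) -> culim U z l -> culim U w l.
Proof.
intros H [H1 H2]. split; [refine (ulim_ext U HU _ _ _ _ H1) | refine (ulim_ext U HU _ _ _ _ H2)];
  intros; now rewrite H.
Qed.

Variables (s : R) (Hs : 1 < s).

Definition dbec (f : nat -> R -> R) : Prop :=
  equicont f /\ exists B, forall n x, Rabs (f n x) <= B * wt s x.

Lemma dbec_mult (f : nat -> R -> R) (g : R -> R) (D : R) :
  bec f -> dominated s D g -> dbec (fun n x => f n x * g x).
Proof.
intros Hf Hg. pose proof (dominated_const_pos s D g Hg) as HD. destruct Hg as [Hc Hd]. split.
- apply (bec_mult f (fun _ => g) Hf). apply (bec_fixed g D Hc).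
  intros x. eapply Rle_trans; [apply Hd |]. pose proof (wt_le1 s Hs x). pose proof (wt_pos s x). nra.
- destruct Hf as [_ [B HB]]. exists (B * D). intros n x. rewrite Rabs_mult, Rmult_assoc.
  apply Rmult_le_compat; auto using Rabs_pos.
Qed.

Lemma dbec_bec (f : nat -> R -> R) : dbec f -> bec f.
Proof.
intros [H1 [B HB]]. split; [exact H1 |]. exists B. intros n x. eapply Rle_trans; [apply HB |].
assert (0 <= B).
{ specialize (HB n x). pose proof (Rabs_pos (f n x)). pose proof (wt_pos s x). nra. }
pose proof (wt_le1 s Hs x). pose proof (wt_pos s x). nra.
Qed.

Lemma dbec_plus (f g : nat -> R -> R) : dbec f -> dbec g -> dbec (fun n x => f n x + g n x).
Proof.
intros Hf Hg. split; [apply (bec_plus f g); now apply dbec_bec |].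
destruct Hf as [_ [B HB]]. destruct Hg as [_ [D HD]]. exists (B + D). intros n x.
eapply Rle_trans; [apply Rabs_triang |]. specialize (HB n x). specialize (HD n x). lra.
Qed.

Lemma dbec_ext (f g : nat -> R -> R) : (forall n x, f n x = g n x) -> dbec f -> dbec g.
Proof.
intros H [Hf [B HB]]. split.
- intros x e He. destruct (Hf x e He) as [d [Hd Hd']]. exists d. split; [exact Hd |].
  intros n y Hy. rewrite <- !H. auto.
- exists B. intros n x. rewrite <- H. auto.
Qed.

Lemma dbec_pairing (A W : nat -> R -> C) (P phi : R -> C) :
  cbec A -> cbec W -> cdominated s P -> cdominated s phi ->
  dbec (fun n x => fst (A n x * Cconj (P x) + W n x * Cconj (phi x))%C) /\
  dbec (fun n x => snd (A n x * Cconj (P x) + W n x * Cconj (phi x))%C).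
Proof.
intros [A1 A2] [W1 W2] [[D1 P1] [D2 P2]] [[D3 F1] [D4 F2]].
split.
- apply (dbec_ext (fun n x => (fst (A n x) * fst (P x) + snd (A n x) * snd (P x)) +
      (fst (W n x) * fst (phi x) + snd (W n x) * snd (phi x)))).
  { intros n x. simpl. ring. }
  apply dbec_plus; apply dbec_plus.
  + exact (dbec_mult _ _ D1 A1 P1).
  + exact (dbec_mult _ _ D2 A2 P2).
  + exact (dbec_mult _ _ D3 W1 F1).
  + exact (dbec_mult _ _ D4 W2 F2).
- apply (dbec_ext (fun n x => (snd (A n x) * fst (P x) + (- fst (A n x)) * snd (P x)) +
      (snd (W n x) * fst (phi x) + (- fst (W n x)) * snd (phi x)))).
  { intros n x. simpl. ring. }
  apply dbec_plus; apply dbec_plus.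
  + exact (dbec_mult _ _ D1 A2 P1).
  + exact (dbec_mult _ _ D2 (bec_opp _ A1) P2).
  + exact (dbec_mult _ _ D3 W2 F1).
  + exact (dbec_mult _ _ D4 (bec_opp _ W1) F2).
Qed.

Lemma ulim_mesh_zero (u : nat -> R) (B : R) : (forall n, Rabs (u n) <= B * mesh n) -> ulim U u 0.
Proof.
intros H e He.
assert (HB : 0 <= B).
{ specialize (H 0%nat). pose proof (Rabs_pos (u 0%nat)). pose proof (mesh_pos 0). nra. }
destruct (INR_unbounded (B / e)) as [N HN].
refine (fu_imp U HU _ _ _ (fu_ev U HU N)). intros n Hn. rewrite Rminus_0_r.
eapply Rle_lt_trans; [apply H |].
assert (HSn : 0 < INR (S n)) by (apply lt_0_INR; lia).
assert (INR N <= INR (S n)) by (apply le_INR; lia).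
assert (B / e < INR (S n)) by lra.
apply (Rmult_lt_reg_r (INR (S n))); [exact HSn |]. rewrite Rmult_assoc, mesh_mult, Rmult_1_r.
apply (Rmult_lt_compat_r e) in H1; [| exact He]. unfold Rdiv in H1. rewrite Rmult_assoc, Rinv_l in H1 by lra. lra.
Qed.

(** Dominated convergence in each component. The integrals [E n] vanish with the mesh, and
    uniqueness of ultrafilter limits identifies the integral of the limit. *)
Lemma limit_integral_zero (A W : nat -> R -> C) (Al Wl P phi : R -> C) (E : nat -> C) (B : R) :
  cbec A -> cbec W -> cdominated s P -> cdominated s phi ->
  (forall x, culim U (fun n => A n x) (Al x)) -> (forall x, culim U (fun n => W n x) (Wl x)) ->
  (forall n, is_RInt_gen (V := C_R_NormedModule)
    (fun x => (A n x * Cconj (P x) + W n x * Cconj (phi x))%C) minf pinf (E n)) ->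
  (forall n, Rabs (fst (E n)) <= B * mesh n /\ Rabs (snd (E n)) <= B * mesh n) ->
  is_RInt_gen (V := C_R_NormedModule)
    (fun x => (Al x * Cconj (P x) + Wl x * Cconj (phi x))%C) minf pinf (RtoC 0).
Proof.
intros HA HW HP Hphi LA LW HI HE.
destruct (dbec_pairing A W P phi HA HW HP Hphi) as [[Q1 [B1 HB1]] [Q2 [B2 HB2]]].
assert (HL : forall x, culim U (fun n => (A n x * Cconj (P x) + W n x * Cconj (phi x))%C)
  (Al x * Cconj (P x) + Wl x * Cconj (phi x))%C).
{ intros x. apply culim_plus; apply culim_mult; auto; apply culim_const. }
apply is_RInt_gen_pair.
- destruct (ulim_dominated_integral U HU s B1 _ _ (fun n => fst (E n)) Hs Q1 HB1 (fun x => proj1 (HL x))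
    (fun n => proj1 (is_RInt_gen_components _ _ (HI n)))) as [L [HL1 HL2]].
  replace (fst (RtoC 0)) with L; [exact HL1 |].
  apply (ulim_unique U HU (fun n => fst (E n))); [exact HL2 |]. apply (ulim_mesh_zero _ B). intros n. apply HE.
- destruct (ulim_dominated_integral U HU s B2 _ _ (fun n => snd (E n)) Hs Q2 HB2 (fun x => proj2 (HL x))
    (fun n => proj2 (is_RInt_gen_components _ _ (HI n)))) as [L [HL1 HL2]].
  replace (snd (RtoC 0)) with L; [exact HL1 |].
  apply (ulim_unique U HU (fun n => snd (E n))); [exact HL2 |]. apply (ulim_mesh_zero _ B). intros n. apply HE.
Qed.

End CUlim.

Lemma jb_add_le (x k : R) : jb x <= (1 + Rabs k) * jb (x + k).
Proof.
unfold jb. pose proof (Rabs_triang (x + k) (- k)) as H. rewrite Rabs_Ropp in H.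
replace (x + k + - k) with x in H by ring. pose proof (Rabs_pos k). pose proof (Rabs_pos (x + k)). nra.
Qed.

Lemma Cmod2_conj_mult (z : C) : RtoC (Cmod z ^ 2) = (z * Cconj z)%C.
Proof.
apply C_eq; simpl; [| ring]. unfold Cmod. rewrite Rmult_1_r, sqrt_sqrt; [simpl; ring |].
pose proof (pow2_ge_0 (fst z)). pose proof (pow2_ge_0 (snd z)). lra.
Qed.

Section LimitEquation.

Variables (U : (nat -> Prop) -> Prop) (HU : free_ultra U).
Variables (Gs : nat -> nat -> R) (Cs : nat -> R) (m : R -> R).
Hypothesis (HG : forall n i, 0 <= Gs n i).
Hypothesis (HEL : forall n d, (d < len n)%nat ->
  m (node n d) * Gs n d = mesh n ^ 2 * trilin (len n) (Gs n) (Gs n) (Gs n) d).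
Hypothesis (HC : forall n j, mesh n * fsum (len n) (fun a => (1 + Rabs (node n a)) ^ j * Gs n a) <= Cs j).
Variable P : nat -> R -> R -> R.
Hypothesis HP : forall j t x, ulim U (fun n => prof n (Gs n) j t x) (P j t x).

Definition profC (j : nat) (x : R) : C := (P j 0 x, P j (- (PI / 2)) x).

Lemma prof_shift_cbec (j : nat) (s0 : R) :
  cbec (fun n x => (prof n (Gs n) j 0 (x - s0), prof n (Gs n) j (- (PI / 2)) (x - s0))).
Proof.
split; simpl; (apply (bec_lipschitz _ (Cs j) (Cs (S j)));
  [intros; now apply prof_bound |]); intros n x y;
  (eapply Rle_trans; [now apply prof_lipschitz with (Cs := Cs) |]);
  replace (y - s0 - (x - s0)) with (y - x) by ring; lra.
Qed.

(** The free parameters let one passage to the limit serve the standing equation and, at each fixed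
    time, the evolution equation. *)
Lemma limit_equation (sigma kappa alpha k' s0 a0 c0 : R) (phi : R -> C) :
  1 / 2 < sigma < 1 -> test_fun phi ->
  (forall xi, p_sym sigma kappa (xi + k') + a0 - c0 * xi = m xi) ->
  is_RInt_gen (V := C_R_NormedModule)
    (fun x =>
      let V := (cis alpha * cis (k' * x) * profC 0 (x - s0))%C in
      let V1 := (cis alpha * cis (k' * x) * profC 1 (x - s0))%C in
      (V * Cconj (Pk sigma kappa phi x)
       + (RtoC a0 * V + Ci * RtoC c0 * V1 - RtoC (Cmod V ^ 2) * V) * Cconj (phi x))%C)
    minf pinf (RtoC 0).
Proof.
intros Hsig Hphi Hsym.
assert (Hs : 1 < 2 * sigma) by lra.
pose (A := fun n x => waveN alpha k' s0 n (Gs n) x).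
pose (A1 := fun n x => waveN1 alpha k' s0 n (Gs n) x).
pose (V := fun x => (cis alpha * cis (k' * x) * profC 0 (x - s0))%C).
pose (V1 := fun x => (cis alpha * cis (k' * x) * profC 1 (x - s0))%C).
destruct (fourier_decay phi Hphi) as [D [HD0 HD]].
assert (HAb : cbec A).
{ apply (cbec_ext (fun n x => (cis alpha * cis (k' * x) * (prof n (Gs n) 0 0 (x - s0), prof n (Gs n) 0 (- (PI / 2)) (x - s0)))%C)).
  - intros n x. symmetry. apply waveN_prof.
  - apply cbec_mult; [apply cbec_mult; [apply cbec_const | apply cbec_cis] | apply prof_shift_cbec]. }
assert (HA1b : cbec A1).
{ apply (cbec_ext (fun n x => (cis alpha * cis (k' * x) * (prof n (Gs n) 1 0 (x - s0), prof n (Gs n) 1 (- (PI / 2)) (x - s0)))%C)).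
  - intros n x. symmetry. apply waveN1_prof.
  - apply cbec_mult; [apply cbec_mult; [apply cbec_const | apply cbec_cis] | apply prof_shift_cbec]. }
assert (HAl : forall x, culim U (fun n => A n x) (V x)).
{ intros x. apply (culim_ext U HU (fun n => (cis alpha * cis (k' * x) * (prof n (Gs n) 0 0 (x - s0), prof n (Gs n) 0 (- (PI / 2)) (x - s0)))%C)).
  - intros n. symmetry. apply waveN_prof.
  - apply culim_mult; [exact HU | apply culim_const, HU |]. split; simpl; apply HP. }
assert (HA1l : forall x, culim U (fun n => A1 n x) (V1 x)).
{ intros x. apply (culim_ext U HU (fun n => (cis alpha * cis (k' * x) * (prof n (Gs n) 1 0 (x - s0), prof n (Gs n) 1 (- (PI / 2)) (x - s0)))%C)).
  - intros n. symmetry. apply waveN1_prof.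
  - apply culim_mult; [exact HU | apply culim_const, HU |]. split; simpl; apply HP. }
pose (W := fun n x => (RtoC a0 * A n x + Ci * RtoC c0 * A1 n x + - (A n x * Cconj (A n x) * A n x))%C).
pose (Wl := fun x => (RtoC a0 * V x + Ci * RtoC c0 * V1 x + - (V x * Cconj (V x) * V x))%C).
pose (E := fun n => defectN alpha k' s0 m (fourier phi) n (Gs n)).
refine (is_RInt_gen_Cext _ _ _ _ _ eq_refl
  (limit_integral_zero U HU (2 * sigma) Hs A W V Wl (Pk sigma kappa phi) phi E (2 * D * (1 + Rabs k') * Cs 0%nat ^ 3) HAb _ _ _ HAl _ _ _)).
- intros x. cbv zeta. fold (V x) (V1 x). unfold Wl. rewrite Cmod2_conj_mult. ring.
- apply cbec_plus; [apply cbec_plus |].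
  + apply cbec_mult; [apply cbec_const | exact HAb].
  + apply cbec_mult; [apply cbec_const | exact HA1b].
  + apply cbec_opp, cbec_mult; [apply cbec_mult; [exact HAb | now apply cbec_conj] | exact HAb].
- now apply Pk_cdominated.
- now apply test_cdominated.
- intros x. apply culim_plus; [exact HU | apply culim_plus; [exact HU | |] |].
  + apply culim_mult; [exact HU | apply culim_const, HU | apply HAl].
  + apply culim_mult; [exact HU | apply culim_const, HU | apply HA1l].
  + apply culim_opp; [exact HU |]. apply culim_mult; [exact HU | | apply HAl].
    apply culim_mult; [exact HU | apply HAl |]. apply culim_conj; [exact HU | apply HAl].
- intros n.
  refine (is_RInt_gen_Cext _ _ _ _ _ eq_refl (residualN_integral alpha k' s0 a0 c0 (p_sym sigma kappa) m
    (Pk sigma kappa phi) phi (fourier phi) (fun eta => Pk_pairing sigma kappa Hsig phi Hphi eta)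
    (fun eta => test_pairing phi eta Hphi) Hsym n (Gs n))).
  intros x. unfold residualN, W. fold (A n x) (A1 n x). ring.
- intros n. unfold E. replace (2 * D * (1 + Rabs k') * Cs 0%nat ^ 3 * mesh n) with ((2 * D * (1 + Rabs k')) * Cs 0%nat ^ 3 * mesh n) by ring.
  apply (defectN_small alpha k' s0 m (fourier phi) n (Gs n) (Cs 0%nat)); auto.
  + eapply Rle_trans; [right | apply (HC n 0%nat)]. f_equal. apply fsum_ext. intros a _. simpl. ring.
  + intros xi. destruct (HD (xi + k')) as [F1 F2]. pose proof (jb_add_le xi k') as Hj.
    pose proof (jb_ge1 (xi + k')). pose proof (jb_ge1 xi). pose proof (Rabs_pos k').
    pose (c := cos (alpha - xi * s0)). pose (d := sin (alpha - xi * s0)).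
    assert (Hc : Rabs c <= 1) by apply cos_abs_le1. assert (Hd : Rabs d <= 1) by apply Rabs_le, SIN_bound.
    (* [2 * D] bounds a rotation of the two components, and [1 + Rabs k'] is the cost of moving the
       weight [jb] from [xi + k'] to [xi]. *)
    assert (Hgen : forall u v x y, Rabs x <= 1 -> Rabs y <= 1 ->
      Rabs u * jb (xi + k') <= D -> Rabs v * jb (xi + k') <= D ->
      Rabs (x * u + y * v) * jb xi <= 2 * D * (1 + Rabs k')).
    { intros u v x y Hx Hy Hu Hv.
      assert (Ht : Rabs (x * u + y * v) <= Rabs u + Rabs v).
      { eapply Rle_trans; [apply Rabs_triang |]. rewrite !Rabs_mult. pose proof (Rabs_pos u). pose proof (Rabs_pos v). nra. }
      apply Rle_trans with ((Rabs u + Rabs v) * ((1 + Rabs k') * jb (xi + k'))).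
      - apply Rmult_le_compat; auto using Rabs_pos. lra.
      - replace ((Rabs u + Rabs v) * ((1 + Rabs k') * jb (xi + k'))) with
          ((Rabs u * jb (xi + k') + Rabs v * jb (xi + k')) * (1 + Rabs k')) by ring.
        replace (2 * D * (1 + Rabs k')) with ((D + D) * (1 + Rabs k')) by ring.
        apply Rmult_le_compat_r; lra. }
    unfold mode_coeff. destruct (fourier phi (xi + k')) as [u w]. cbn [fst snd] in F1, F2.
    split; simpl; fold c d.
    * replace (c * u - d * - w) with (c * u + d * w) by ring. now apply Hgen.
    * replace (c * - w + d * u) with ((- c) * w + d * u) by ring. apply Hgen; auto. now rewrite Rabs_Ropp.
Qed.

End LimitEquation.

(** * Choice of the mass and conclusion *)

Lemma is_derive_pair (f g : R -> R) (t lf lg : R) : is_derive f t lf -> is_derive g t lg ->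
  is_derive (K := R_AbsRing) (V := C_R_NormedModule) (fun t => (f t, g t) : C) t ((lf, lg) : C).
Proof.
intros Hf Hg.
evar_last.
- apply (is_derive_ext (fun t => plus (scal (f t) ((1, 0) : C_R_NormedModule)) (scal (g t) ((0, 1) : C_R_NormedModule)))).
  + intros x. apply C_eq.
    * change (@eq R (f x * 1 + g x * 0) (f x)). ring.
    * change (@eq R (f x * 0 + g x * 1) (g x)). ring.
  + apply (is_derive_plus (K := R_AbsRing) (V := C_R_NormedModule)).
    * apply (is_derive_scal_l f t lf ((1, 0) : C_R_NormedModule) Hf).
    * apply (is_derive_scal_l g t lg ((0, 1) : C_R_NormedModule) Hg).
- apply C_eq.
  + change (@eq R (lf * 1 + lg * 0) lf). ring.
  + change (@eq R (lf * 0 + lg * 1) lg). ring.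
Qed.

(* The mass is large so that the symbol is coercive without using the convexity of [p_sym]. *)
Lemma coercive_mass (sigma k : R) : 1 / 2 < sigma < 1 ->
  exists omega c mmax, 0 < omega /\ 0 < c /\
    (forall x, c <= (p_sym sigma k x + rpow omega (2 * sigma)) * wt (2 * sigma) x) /\
    (forall x, Rabs x <= 3 -> p_sym sigma k x + rpow omega (2 * sigma) <= mmax).
Proof.
intros Hsig. pose (s := 2 * sigma). assert (Hs : 1 < s < 2) by (unfold s; lra). fold s.
pose (A := rpow (Rabs k) s). pose (B := 2 * sigma * rpow (Rabs k) (s - 2) * k).
assert (Hp : forall x, p_sym sigma k x = rpow (Rabs (x + k)) s - A - B * x) by reflexivity.
assert (HA : 0 <= A) by apply rpow_nonneg.
pose (q := Rpower 2 s). assert (Hq : 0 < q) by apply exp_pos.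
pose (r := Rpower (1 + Rabs k) s). assert (Hr : 0 < r) by apply exp_pos.
(* Here [X0 ^ (s - 1) = 2 q (Rabs B + 1)]: beyond [X0] the drift [Rabs B * X] costs at most half of
   [X ^ s / q]. *)
pose (X0 := Rpower (2 * q * (Rabs B + 1)) (/ (s - 1))). assert (HX0 : 0 < X0) by apply exp_pos.
pose proof (Rabs_pos B) as HB. pose proof (Rabs_pos k) as Hk.
(* [r], [A] and [Rabs B * X0] are the amounts by which the symbol may fall short of [X ^ s / (2 q)];
   the mass makes up for them. *)
pose (lam := r + A + Rabs B * X0 + 1).
assert (Hlam : 0 < lam).
{ unfold lam. assert (0 <= Rabs B * X0) by (apply Rmult_le_pos; lra). lra. }
pose (omega := Rpower lam (/ s)).
assert (Hom : rpow omega s = lam).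
{ rewrite rpow_of_pos by apply exp_pos. unfold omega. rewrite Rpower_mult, Rinv_l by lra. now apply Rpower_1. }
exists omega, (/ (2 * q)), (rpow (3 + Rabs k) s + 3 * Rabs B + lam).
split; [apply exp_pos |]. split; [apply Rinv_0_lt_compat; lra |]. rewrite Hom. split.
- intros x. rewrite Hp. pose (X := 1 + Rabs x). pose proof (Rabs_pos x) as Hx.
  assert (HX : 1 <= X) by (unfold X; lra).
  pose (Y := Rpower X s). assert (HY : 0 < Y) by apply exp_pos.
  assert (Hwt : wt s x = / Y) by (unfold wt; fold X; apply Rpower_Ropp).
  rewrite Hwt.
  (* [X] is at most twice the larger of [1 + Rabs k] and [Rabs (x + k)], and [q] is [2 ^ s]. *)
  assert (H1 : Y <= q * (r + rpow (Rabs (x + k)) s)).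
  { assert (HXle : X <= (1 + Rabs k) + Rabs (x + k)).
    { unfold X. pose proof (Rabs_triang (x + k) (- k)) as H. rewrite Rabs_Ropp in H.
      replace (x + k + - k) with x in H by ring. lra. }
    pose proof (Rabs_pos (x + k)) as Hxk. pose proof (rpow_nonneg (Rabs (x + k)) s).
    destruct (Rle_dec (Rabs (x + k)) (1 + Rabs k)) as [Hle | Hle].
    - apply Rle_trans with (q * r); [| apply Rmult_le_compat_l; lra].
      unfold Y, q, r. rewrite Rpower_mult_distr by lra. apply Rle_Rpower_l; lra.
    - apply Rle_trans with (q * rpow (Rabs (x + k)) s); [| apply Rmult_le_compat_l; lra].
      rewrite rpow_of_pos by lra. unfold Y, q. rewrite Rpower_mult_distr by lra. apply Rle_Rpower_l; lra. }
  assert (H2 : Rabs B * X <= Y / (2 * q) + Rabs B * X0).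
  { assert (0 <= Y / (2 * q)) by (left; apply Rdiv_lt_0_compat; lra).
    destruct (Rle_dec X X0) as [Hle | Hle].
    - assert (Rabs B * X <= Rabs B * X0) by (apply Rmult_le_compat_l; lra). lra.
    - assert (HYX : Y = X * Rpower X (s - 1)).
      { unfold Y. rewrite <- (Rpower_1 X) at 2 by lra. rewrite <- Rpower_plus. f_equal. ring. }
      assert (Hpow : 2 * q * (Rabs B + 1) <= Rpower X (s - 1)).
      { replace (2 * q * (Rabs B + 1)) with (Rpower X0 (s - 1)).
        - apply Rle_Rpower_l; lra.
        - unfold X0. rewrite Rpower_mult, Rinv_l by lra. apply Rpower_1. apply Rmult_lt_0_compat; lra. }
      assert (Rabs B * X <= Y / (2 * q)).
      { apply (Rmult_le_reg_r (2 * q)); [lra |]. unfold Rdiv. rewrite (Rmult_assoc Y), Rinv_l, Rmult_1_r, HYX by lra.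
        replace (Rabs B * X * (2 * q)) with (X * (2 * q * Rabs B)) by ring.
        apply Rmult_le_compat_l; [lra |]. eapply Rle_trans; [| exact Hpow]. apply Rmult_le_compat_l; lra. }
      assert (0 <= Rabs B * X0) by (apply Rmult_le_pos; lra). lra. }
  assert (H3 : Y / q - r <= rpow (Rabs (x + k)) s).
  { apply (Rmult_le_reg_l q); [exact Hq |]. replace (q * (Y / q - r)) with (Y - q * r) by (field; lra). lra. }
  assert (H4 : B * x <= Rabs B * X).
  { eapply Rle_trans; [apply Rle_abs |]. rewrite Rabs_mult. apply Rmult_le_compat_l; unfold X; lra. }
  apply (Rmult_le_reg_r Y); [exact HY |]. rewrite (Rmult_assoc _ (/ Y) Y), Rinv_l, Rmult_1_r by lra.
  replace (/ (2 * q) * Y) with (Y / q - Y / (2 * q)) by (field; lra).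
  unfold lam. lra.
- intros x Hx. rewrite Hp.
  assert (H1 : rpow (Rabs (x + k)) s <= rpow (3 + Rabs k) s).
  { apply rpow_le; [lra |]. pose proof (Rabs_triang x k). lra. }
  assert (H2 : - (B * x) <= 3 * Rabs B).
  { eapply Rle_trans; [apply Rle_abs |]. rewrite Rabs_Ropp, Rabs_mult, Rmult_comm. apply Rmult_le_compat_r; lra. }
  lra.
Qed.

Theorem theorem1p1 (sigma : R) (Hsigma : 1/2 < sigma < 1) (k : R) :
  exists (omega : R) (Q : R -> C),
    0 < omega /\
    (exists x, Q x <> 0%C) /\
    H1_smooth Q /\
    smooth Q /\
    standing_eq sigma k omega Q /\
    NLS_solution sigma (traveling sigma k omega Q).
Proof.
destruct (coercive_mass sigma k Hsigma) as [omega [c [mmax [Hom [Hc [Hm Hmmax]]]]]].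
pose (lam := rpow omega (2 * sigma)). fold lam in Hm, Hmmax.
pose (m := fun x => p_sym sigma k x + lam).
assert (Hs : 1 < 2 * sigma) by lra. assert (Hs2 : 2 * sigma <= 2) by lra.
destruct (discrete_solutions (2 * sigma) Hs Hs2 m c mmax Hc Hm Hmmax) as [c1 [Cs [Hc1 Hsol]]].
destruct (choice _ Hsol) as [Gs HGs].
assert (HG : forall n i, 0 <= Gs n i) by (intros n; apply (HGs n)).
assert (HEL : forall n d, (d < len n)%nat ->
  m (node n d) * Gs n d = mesh n ^ 2 * trilin (len n) (Gs n) (Gs n) (Gs n) d) by (intros n; apply (HGs n)).
assert (Hlow : forall n, c1 <= mesh n * fsum (len n) (Gs n)) by (intros n; apply (HGs n)).
assert (HC : forall n j, mesh n * fsum (len n) (fun a => (1 + Rabs (node n a)) ^ j * Gs n a) <= Cs j)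
  by (intros n; apply (HGs n)).
assert (HC2 : forall n, mesh n * fsum (len n) (fun a => (1 + Rabs (node n a)) ^ 2 * Gs n a ^ 2) <= Cs 0%nat)
  by (intros n; apply (HGs n)).
destruct free_ultra_exists as [U HU].
destruct (prof_limit U HU Gs Cs HG HC) as [P HP].
pose (Q := profC P 0).
assert (HQ : forall x, Q x = (P 0%nat 0 x, P 0%nat (- (PI / 2)) x)) by reflexivity.
assert (Hder : forall j t x, is_derive (P j t) x (P (S j) t x)).
{ intros. now apply (profile_derive U HU Gs Cs HG HC P HP). }
assert (Hmod : forall a b, Cmod (a, b) ^ 2 = a ^ 2 + b ^ 2).
{ intros a b. unfold Cmod. simpl fst; simpl snd. rewrite pow2_sqrt; [reflexivity |].
  pose proof (pow2_ge_0 a). pose proof (pow2_ge_0 b). lra. }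
assert (Hext : forall (f g : R -> R), (forall x, f x = g x) -> ex_RInt_gen f minf pinf -> ex_RInt_gen g minf pinf).
{ intros f g Hfg [l Hl]. exists l. now apply (is_RInt_gen_ext_all f g l l). }
exists omega, Q. split; [exact Hom |]. split; [| split; [| split; [| split]]].
(* At the origin every cosine with phase [0] equals [1], so [prof] is there the whole sum, at least
   [c1] for each [n]. *)
- exists 0. intros H0. apply (f_equal fst) in H0. simpl in H0.
  assert (c1 <= P 0%nat 0 0); [| lra].
  apply (ulim_le U HU (fun _ => c1) (fun n => prof n (Gs n) 0 0 0)); [| apply ulim_const, HU | apply HP].
  apply (fu_all U HU). intros n. eapply Rle_trans; [apply (Hlow n) |]. right. unfold prof. f_equal.
  apply fsum_ext. intros a _. simpl. replace (node n a * 0 + 0 + 0 * (PI / 2)) with 0 by ring. rewrite cos_0. ring.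
- split.
  + refine (Hext _ _ _ (profile_L2 U HU Gs Cs HG HC HC2 P HP 0 ltac:(lia))). intros x. rewrite HQ. symmetry. apply Hmod.
  + refine (Hext _ _ _ (profile_L2 U HU Gs Cs HG HC HC2 P HP 1 ltac:(lia))). intros x.
    unfold cderiv. rewrite Hmod. f_equal; f_equal; symmetry; apply is_derive_unique, Hder.
- intros n x. split.
  + apply (profile_Derive_n U HU Gs Cs HG HC P HP n 0 0 x).
  + apply (profile_Derive_n U HU Gs Cs HG HC P HP n 0 (- (PI / 2)) x).
- intros phi Hphi.
  (* The standing equation has no phase, modulation, shift or drift; [a0] is the mass [lam]. *)
  refine (is_RInt_gen_Cext _ _ _ _ _ eq_refl (limit_equation U HU Gs Cs m HG HEL HC P HP sigma k 0 0 0 lam 0 phi Hsigma Hphi _)).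
  + intros x. cbv zeta. fold lam. rewrite Rmult_0_l, Rminus_0_r.
    replace (cis 0) with (RtoC 1) by (apply C_eq; simpl; [now rewrite cos_0 | now rewrite sin_0]).
    replace (RtoC 1 * RtoC 1 * profC P 0 x)%C with (Q x) by (unfold Q; ring). ring.
  + intros xi. unfold m. rewrite Rplus_0_r. ring.
- pose (Kk := rpow (Rabs k) (2 * sigma)). pose (v := 2 * sigma * rpow (Rabs k) (2 * sigma - 2) * k).
  pose (th := fun t => - (t * (Kk - lam))).
  assert (Hu : forall t x, traveling sigma k omega Q t x = (cis (th t) * cis (k * x) * profC P 0 (x - v * t))%C).
  { intros t x. unfold traveling. fold lam Kk. unfold th, Q. do 2 f_equal. unfold v. ring. }
  (* The first term comes from the rotating phase, the second from the centre moving with velocity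
     [v], which brings in the derivative profile [profC P 1]. *)
  exists (fun t x => ((- Ci * RtoC (Kk - lam) * (cis (th t) * cis (k * x) * profC P 0 (x - v * t)))
     - RtoC v * (cis (th t) * cis (k * x) * profC P 1 (x - v * t)))%C).
  split.
  + intros t x.
    assert (Hin : is_derive (fun t => x - v * t) t (- v)) by (auto_derive; [trivial | ring]).
    assert (D0 : forall p, is_derive (fun t => P 0%nat p (x - v * t)) t (- v * P 1%nat p (x - v * t))).
    { intros p. apply (is_derive_comp (P 0%nat p) (fun t => x - v * t)); [apply Hder | exact Hin]. }
    apply (is_derive_ext (K := R_AbsRing) (V := C_R_NormedModule) (fun t =>
      (cos (th t + k * x) * P 0%nat 0 (x - v * t) - sin (th t + k * x) * P 0%nat (- (PI / 2)) (x - v * t),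
       cos (th t + k * x) * P 0%nat (- (PI / 2)) (x - v * t) + sin (th t + k * x) * P 0%nat 0 (x - v * t)))).
    { intros u. rewrite Hu, <- cis_plus. reflexivity. }
    assert (Dc : is_derive (fun t => cos (th t + k * x)) t (sin (th t + k * x) * (Kk - lam))).
    { unfold th. auto_derive; [trivial | ring]. }
    assert (Ds : is_derive (fun t => sin (th t + k * x)) t (- cos (th t + k * x) * (Kk - lam))).
    { unfold th. auto_derive; [trivial | ring]. }
    evar_last.
    * apply is_derive_pair.
      -- apply (is_derive_minus (fun t => cos (th t + k * x) * P 0%nat 0 (x - v * t))
           (fun t => sin (th t + k * x) * P 0%nat (- (PI / 2)) (x - v * t)));
         (eapply (is_derive_mult (K := R_AbsRing)); [eassumption | apply D0 | intros; apply Rmult_comm]).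
      -- apply (is_derive_plus (fun t => cos (th t + k * x) * P 0%nat (- (PI / 2)) (x - v * t))
           (fun t => sin (th t + k * x) * P 0%nat 0 (x - v * t)));
         (eapply (is_derive_mult (K := R_AbsRing)); [eassumption | apply D0 | intros; apply Rmult_comm]).
    * rewrite <- cis_plus. apply C_eq; unfold plus, minus, opp, mult; simpl; unfold plus, opp, mult; simpl; ring.
  + intros t phi Hphi.
    (* The identity [p_sym sigma 0 (xi + k) = p_sym sigma k xi + Kk + v * xi] dictates
       [a0 = lam - Kk] and [c0 = v]. *)
    pose proof (limit_equation U HU Gs Cs m HG HEL HC P HP sigma 0 (th t) k (v * t) (lam - Kk) v phi Hsigma Hphi) as HI.
    (* The integrand of the evolution equation is the opposite of that of [limit_equation], hence
       the factor [-1]. *)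
    refine (is_RInt_gen_Cext _ _ _ _ _ _ (is_RInt_gen_Cscal _ _ (- (1))%C (HI _))).
    * intros x. cbv zeta. rewrite !Hu. rewrite (RtoC_minus lam Kk), (RtoC_minus Kk lam).
      set (V := (cis (th t) * cis (k * x) * profC P 0 (x - v * t))%C).
      set (V1 := (cis (th t) * cis (k * x) * profC P 1 (x - v * t))%C).
      replace (Ci * (- Ci * (RtoC Kk - RtoC lam) * V - RtoC v * V1))%C with
        (- (Ci * Ci) * (RtoC Kk - RtoC lam) * V - Ci * RtoC v * V1)%C by ring.
      replace (Ci * Ci)%C with (- (1))%C by (apply C_eq; simpl; ring). ring.
    * apply C_eq; simpl; ring.
    * intros xi. unfold m, p_sym. rewrite Rplus_0_r, Rabs_R0, rpow_0. fold Kk v. ring.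
Qed.
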